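(* For any number field $K$, the number of $\bar{\mathbf Q}$-isomorphism classes of Lamé curves of odd degree and signature $1$ defined over $K$ is bounded by $2^d$, where $d$ is the maximal degree of the residual extensions of $K$ at $2$ (i.e. the maximum, over the primes $\mathfrak p$ of $K$ above $2$, of the degree of the residue field of $\mathfrak p$ over $\mathbf F_2$).
   Context: Let $E$ be an elliptic curve over an algebraically closed field $k$ of characteristic $\neq 3$, with identity $0_E$, and let $P\in E(k)$ be a torsion point of exact order $n>1$, with $n$ not divisible by the characteristic of $k$. There is $f_P\in k(E)$, unique up to a multiplicative constant, with divisor $n(P)-n(0_E)$; it induces a degree $n$ cover $f_P:E\to\mathbf P^1_k$. The pair $(E,P)$ is a Lamé curve of order (or degree) $n$ if $f_P$ is tamely ramified and is ramified exactly at $0_E$ and $P$, with ramification index $n$, and at one third point $Q$, with ramification index $3$. In this case $2Q=P$ in $E(k)$, and the signature of $(E,P)$ is $1$ if $Q$ has order $n$ and $0$ if $Q$ has order $2n$. Here $k=\bar{\mathbf Q}$, and Lamé curves of all odd orders $n$ are considered together. A Lamé curve $(E,P)$ over $\bar{\mathbf Q}$ is defined over $K$ if it is $\bar{\mathbf Q}$-isomorphic to a pair $(E_0,P_0)$ with $E_0$ an elliptic curve over $K$ and $P_0\in E_0(K)$. *)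

(* Defs.v *)
From HB Require Import structures.
From mathcomp Require Import all_boot all_order all_algebra all_field.
From mathcomp Require Import generic_quotient fraction ring_quotient polyXY qpoly qfpoly.
From mathcomp Require Import boolp classical_sets cardinality.
From mathcomp Require Import ring zify.

Set Implicit Arguments.
Unset Strict Implicit.
Unset Printing Implicit Defensive.

Import GRing.Theory Num.Theory.
Local Open Scope ring_scope.

Section WeierstrassCurves.
Variable F : fieldType.

(* The equation y^2 + a1 x y + a3 y = x^3 + a2 x^2 + a4 x + a6. *)
Record weierstrass := Weierstrass { a1 : F; a2 : F; a3 : F; a4 : F; a6 : F }.

Definition discriminant (W : weierstrass) : F :=
  let b2 := a1 W ^+ 2 + 4 * a2 W in
  let b4 := 2 * a4 W + a1 W * a3 W in
  let b6 := a3 W ^+ 2 + 4 * a6 W in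
  let b8 := a1 W ^+ 2 * a6 W + 4 * a2 W * a6 W - a1 W * a3 W * a4 W
            + a2 W * a3 W ^+ 2 - a4 W ^+ 2 in
  - b2 ^+ 2 * b8 - 8 * b4 ^+ 3 - 27 * b6 ^+ 2 + 9 * b2 * b4 * b6.

Record ecurve := ECurve {
  weq :> weierstrass;
  discriminant_neq0 : discriminant weq != 0
}.

(* [None] is the point at infinity, i.e. the identity of the group law. *)
Definition on_curve (W : weierstrass) (P : option (F * F)) : bool :=
  if P is Some (x, y) then
    y ^+ 2 + a1 W * x * y + a3 W * y
      == x ^+ 3 + a2 W * x ^+ 2 + a4 W * x + a6 W
  else true.

Definition point (E : ecurve) := {P : option (F * F) | on_curve E P}.

Definition zero_point (E : ecurve) : point E := exist _ None isT.

(* The chord-and-tangent law. *)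
Definition add_pt (W : weierstrass) (P Q : option (F * F)) : option (F * F) :=
  match P, Q with
  | None, _ => Q
  | _, None => P
  | Some (x1, y1), Some (x2, y2) =>
    if (x1 == x2) && (y1 == - y2 - a1 W * x2 - a3 W) then None else
    let l :=
      if x1 == x2
      then (3 * x1 ^+ 2 + 2 * a2 W * x1 + a4 W - a1 W * y1)
             / (2 * y1 + a1 W * x1 + a3 W)
      else (y2 - y1) / (x2 - x1) in
    let x3 := l ^+ 2 + a1 W * l - a2 W - x1 - x2 in
    Some (x3, - (l * (x3 - x1) + y1) - a1 W * x3 - a3 W)
  end.

Definition mul_pt (W : weierstrass) (n : nat) (P : option (F * F)) :=
  iter n (add_pt W P) None.

Definition has_order (E : ecurve) (P : point E) (n : nat) : Prop :=
  [/\ (0 < n)%N, mul_pt E n (val P) = None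
    & forall m : nat, (0 < m < n)%N -> mul_pt E m (val P) <> None].

End WeierstrassCurves.

Arguments zero_point {F E}.

Local Notation "x %:F" := (@FracField.tofrac _ x).

Lemma quadratic_clear (F : fieldType) (a b l c : F) :
  b != 0 -> (a / b) ^+ 2 + l * (a / b) - c = 0 ->
  a ^+ 2 + l * (a * b) = c * b ^+ 2.
Proof.
move=> b0 h; have -> : c = (a / b) ^+ 2 + l * (a / b).
  by apply/esym/eqP; rewrite -subr_eq0 h.
by field.
Qed.

Lemma fractionP (R : idomainType) (u : {fraction R}) :
  exists a b : R, b != 0 /\ u = a%:F / b%:F.
Proof.
elim/quotW: u => r; exists r.1, r.2; split; first exact: denom_ratioP.
apply: (canRL (mulfK _)); first by rewrite tofrac_eq0 denom_ratioP.
unlock FracField.tofrac; rewrite -[LHS]FracField.pi_mul.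
apply/eqmodP; rewrite /= FracField.equivfE /FracField.mulf /=.
by rewrite !numden_Ratio ?mulr1 ?oner_neq0 ?mulf_neq0 ?denom_ratioP
           ?oner_neq0 // mulrC.
Qed.

Section FunctionField.
Variables (k : fieldType) (E : ecurve k).

(* The equation of E as a polynomial in y with coefficients in k(x). *)
Definition curve_poly : {poly {fraction {poly k}}} :=
  'X^2 + ((a1 E *: 'X + (a3 E)%:P)%:F) *: 'X
  - (('X^3 + a2 E *: 'X^2 + a4 E *: 'X + (a6 E)%:P)%:F)%:P.

Let lin : {poly k} := a1 E *: 'X + (a3 E)%:P.
Let cub : {poly k} := 'X^3 + a2 E *: 'X^2 + a4 E *: 'X + (a6 E)%:P.

Lemma size_curve_poly_tail :
  (size (lin%:F *: 'X - (cub%:F)%:P : {poly {fraction {poly k}}})%R < 3)%N.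
Proof.
apply: (leq_ltn_trans (size_polyD _ _)); rewrite size_polyN gtn_max.
apply/andP; split; last by apply: (leq_ltn_trans (size_polyC_leq1 _)).
by apply: (leq_ltn_trans (size_scale_leq _ _)); rewrite size_polyX.
Qed.

Lemma size_curve_poly : size curve_poly = 3%N.
Proof.
by rewrite /curve_poly -addrA size_polyDl size_polyXn // size_curve_poly_tail.
Qed.

Lemma curve_poly_monic : curve_poly \is monic.
Proof.
rewrite monicE /curve_poly -addrA lead_coefDl ?lead_coefXn //.
by rewrite size_polyXn size_curve_poly_tail.
Qed.

Let size_lin : (size lin <= 2)%N.
Proof.
apply: (leq_trans (size_polyD _ _)); rewrite geq_max.
rewrite (leq_trans (size_scale_leq _ _)) ?size_polyX //.
exact: (leq_trans (size_polyC_leq1 _)).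
Qed.

Let size_cub : size cub = 4%N.
Proof.
rewrite /cub -!addrA size_polyDl size_polyXn //.
rewrite !addrA !(leq_ltn_trans (size_polyD _ _)) // gtn_max.
rewrite (leq_ltn_trans (size_polyC_leq1 _)) // andbT.
rewrite (leq_ltn_trans (size_polyD _ _)) // gtn_max.
by rewrite !(leq_ltn_trans (size_scale_leq _ _)) // ?size_polyXn ?size_polyX.
Qed.

Lemma curve_poly_irreducible : monic_irreducible_poly curve_poly.
Proof.
split; last exact: curve_poly_monic.
apply: cubic_irreducible; first by rewrite size_curve_poly.
move=> u; have [a [b [bn0 ->]]] := fractionP u.
have b0 : b%:F != 0 :> {fraction {poly k}} by rewrite tofrac_eq0.
apply/negP; rewrite /root /curve_poly !hornerE -/lin -/cub => /eqP h.
have {}h : a ^+ 2 + lin * (a * b) = cub * b ^+ 2.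
  move: (lin) (cub) h => l c; rewrite /= -mulrA => h; apply/eqP.
  rewrite -tofrac_eq !(rmorphD, rmorphM, rmorphXn) /=.
  by apply/eqP; apply: quadratic_clear h.
have sb : (0 < size b)%N by rewrite size_poly_gt0.
have sR : size (cub * b ^+ 2) = (size b + size b + 2)%N.
  rewrite size_mul ?expf_neq0 // -?size_poly_gt0 ?size_cub //.
  by rewrite expr2 size_mul //; lia.
have [a0|a0] := eqVneq a 0.
  by move: sR; rewrite -h a0 mul0r mulr0 expr0n /= addr0 size_poly0; lia.
have sa : (0 < size a)%N by rewrite size_poly_gt0.
have s2 : size (a ^+ 2) = (size a + size a).-1 by rewrite expr2 size_mul.
have sL : (size (lin * (a * b))%R <= size a + size b)%N.
  apply: (leq_trans (size_polyMleq _ _)); rewrite size_mul //.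
  by move: size_lin sa sb; lia.
have [le|gt] := leqP (size a) (size b).+1.
  suff : (size (a ^+ 2 + lin * (a * b))%R < size b + size b + 2)%N.
    by rewrite h sR ltnn.
  apply: (leq_ltn_trans (size_polyD _ _)); rewrite gtn_max s2.
  by rewrite (leq_ltn_trans sL) ?andbT; lia.
move: sR; rewrite -h size_polyDl s2; first by lia.
by apply: (leq_ltn_trans sL); lia.
Qed.

(* k(E), as the quadratic extension k(x)[y] / (curve_poly) of k(x). *)
Definition funfield : fieldType :=
  {poly %/ curve_poly with curve_poly_irreducible}.

Definition fun_cst (c : k) : funfield := qpolyC curve_poly (c%:P%:F).
Definition fun_x : funfield := qpolyC curve_poly ('X%:F).
Definition fun_y : funfield := in_qpoly curve_poly 'X.

(* Functions on an affine chart containing R, and the coordinates of R in that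
   chart: (x, y) at the affine points, (x / y, 1 / y) at infinity. *)
Definition chart (R : point E) : (funfield * funfield) * (k * k) :=
  if val R is Some c then ((fun_x, fun_y), c)
  else ((fun_x / fun_y, fun_y^-1), (0, 0)).

Definition eval_fun (R : point E) (g : {poly {poly k}}) : funfield :=
  (map_poly (map_poly fun_cst) g).[(chart R).1.1, (chart R).1.2].
Definition eval_pt (R : point E) (g : {poly {poly k}}) : k :=
  g.[(chart R).2.1, (chart R).2.2].

(* The local ring of E at R, its maximal ideal, and the valuation of a nonzero
   function at R. *)
Definition regular_at (R : point E) (f : funfield) : Prop :=
  exists g h : {poly {poly k}},
    eval_pt R h != 0 /\ f = eval_fun R g / eval_fun R h.

Definition vanishes_at (R : point E) (f : funfield) : Prop :=
  exists g h : {poly {poly k}},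
    [/\ eval_pt R h != 0, f = eval_fun R g / eval_fun R h & eval_pt R g = 0].

Definition uniformizer (R : point E) (t : funfield) : Prop :=
  vanishes_at R t /\
  forall f, vanishes_at R f -> exists2 g, regular_at R g & f = g * t.

Definition ord_at (R : point E) (f : funfield) (m : int) : Prop :=
  exists t u, [/\ uniformizer R t, u != 0, regular_at R u, regular_at R u^-1
                & f = u * t ^ m].

(* The ramification index at R of the morphism f : E -> P^1: the first case is
   f(R) = c finite, the second one is f(R) = infinity. *)
Definition ram_index (f : funfield) (R : point E) (e : nat) : Prop :=
  (0 < e)%N /\
  ((exists c : k, ord_at R (f - fun_cst c) e%:Z) \/ ord_at R f (- e%:Z)).

Definition tamely_ramified (f : funfield) : Prop :=
  forall (R : point E) (e : nat), ram_index f R e -> e%:R != 0 :> k.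

(* div f = n (P) - n (0) *)
Definition has_divisor (f : funfield) (n : nat) (P : point E) : Prop :=
  forall R : point E,
    ord_at R f (n%:Z * ((R == P)%:Z - (R == zero_point)%:Z)).

End FunctionField.

Record pointed_curve (k : fieldType) := PointedCurve {
  pc_curve :> ecurve k;
  pc_point : point pc_curve
}.

(* C is a Lamé curve of order n, with Q as its third ramification point. *)
Definition lame (k : closedFieldType) (C : pointed_curve k) (n : nat)
    (Q : point C) : Prop :=
  let P := pc_point C in
  [/\ (1 < n)%N, n%:R != 0 :> k, has_order P n &
    exists f : funfield C,
      [/\ has_divisor f n P, tamely_ramified f, Q != zero_point, Q != P &
        [/\ ram_index f zero_point n, ram_index f P n, ram_index f Q 3 &
          forall R, R != zero_point -> R != P -> R != Q -> ram_index f R 1]]].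

Definition lame_signature (k : closedFieldType) (C : pointed_curve k)
    (n s : nat) : Prop :=
  exists2 Q : point C, lame n Q &
    (s = 1%N /\ has_order Q n) \/ (s = 0%N /\ has_order Q (2 * n)).

(* An isomorphism of curves C -> D over k respecting origins and marked points:
   a bijection g on k-points together with the pullback phi of functions, which
   identifies the local rings at R and g R. *)
Definition isomorphic (k : closedFieldType) (C D : pointed_curve k) : Prop :=
  exists (g : point C -> point D) (phi : {rmorphism funfield D -> funfield C}),
    [/\ bijective g /\ bijective phi,
        forall c : k, phi (fun_cst D c) = fun_cst C c,
        forall R f, regular_at (g R) f <-> regular_at R (phi f),
        g zero_point = zero_point & g (pc_point C) = pc_point D].

Definition iso_class (k : closedFieldType) (C : pointed_curve k) :
  set (pointed_curve k) := [set D | isomorphic C D]%classic.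

Section BaseChange.
Variables (K L : fieldType) (iota : {rmorphism K -> L}).

Definition map_weierstrass (W : weierstrass K) : weierstrass L :=
  Weierstrass (iota (a1 W)) (iota (a2 W)) (iota (a3 W)) (iota (a4 W))
    (iota (a6 W)).

Lemma discriminant_map (W : weierstrass K) :
  discriminant (map_weierstrass W) = iota (discriminant W).
Proof.
case: W => *; rewrite /discriminant /=; ring.
Qed.

Lemma discriminant_map_neq0 (E : ecurve K) :
  discriminant (map_weierstrass E) != 0.
Proof. by rewrite discriminant_map fmorph_eq0 discriminant_neq0. Qed.

Definition map_ecurve (E : ecurve K) : ecurve L :=
  ECurve (discriminant_map_neq0 E).

Definition map_coords (P : option (K * K)) : option (L * L) :=
  omap (fun c => (iota c.1, iota c.2)) P.

Lemma on_curve_map (E : ecurve K) (P : point E) :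
  on_curve (map_ecurve E) (map_coords (val P)).
Proof.
case: P => -[[x y]|] //= /eqP eP.
by rewrite -!rmorphXn -!rmorphM -!rmorphD eP.
Qed.

Definition map_point (E : ecurve K) (P : point E) : point (map_ecurve E) :=
  exist (fun c => on_curve (map_ecurve E) c) _ (on_curve_map P).

Definition map_pointed_curve (C : pointed_curve K) : pointed_curve L :=
  PointedCurve (map_point (pc_point C)).

End BaseChange.

Definition defined_over (K : fieldType) (k : closedFieldType)
    (iota : {rmorphism K -> k}) (C : pointed_curve k) : Prop :=
  exists C0 : pointed_curve K, isomorphic C (map_pointed_curve iota C0).

Section ResidualDegree.
Variable K : fieldExtType rat.

Definition is_integer : {pred K} :=
  fun x => `[< integralOver (intr : int -> K) x >].

Lemma is_integer_subring : subring_closed is_integer.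
Proof.
split=> [|x y|x y].
- by apply/asboolP; exact: (integral1 (intr : {rmorphism int -> K})).
- by move=> /asboolP ? /asboolP ?; apply/asboolP; exact: integral_sub.
- by move=> /asboolP ? /asboolP ?; apply/asboolP; exact: integral_mul.
Qed.

HB.instance Definition _ :=
  GRing.isSubringClosed.Build K is_integer is_integer_subring.

Record integers := Integers {
  integer_val :> K;
  _ : integer_val \in is_integer
}.

HB.instance Definition _ := [isSub for integer_val].
HB.instance Definition _ := [Choice of integers by <:].
HB.instance Definition _ := [SubChoice_isSubComNzRing of integers by <:].

Definition residue_degree (p : prime_idealr integers) (f : nat) : Prop :=
  exists (F : fieldExtType 'F_2) (phi : {rmorphism {ideal_quot p} -> F}),
    bijective phi /\ \dim {: F} = f.

Definition max_residue_degree2 (d : nat) : Prop :=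
  (exists p : prime_idealr integers, 2 \in p /\ residue_degree p d) /\
  (forall (p : prime_idealr integers) (f : nat),
     2 \in p -> residue_degree p f -> (f <= d)%N).

End ResidualDegree.

Definition odd_lame_signature1 (C : pointed_curve algC) : Prop :=
  exists2 n : nat, odd n & lame_signature C n 1.

(* Main.v *)
Require Import Defs.
From HB Require Import structures.
From mathcomp Require Import all_boot all_order all_algebra all_field.
From mathcomp Require Import fraction ring_quotient qpoly.
From mathcomp Require Import boolp classical_sets cardinality.
From mathcomp Require Import ring zify.
Require Import Defs.

Set Implicit Arguments.
Unset Strict Implicit.
Unset Printing Implicit Defensive.

Import Order.TTheory GRing.Theory Num.Theory.
Local Open Scope ring_scope.

(** Let (E, P) be a Lamé curve of odd order n and signature 1, and let F and G be
    functions with divisors n (P) - n (O) and n (Q) - n (O). The differential dF/F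
    has simple poles at P and O and, by the triple ramification, a double zero at
    Q. Hence P = 2 Q, and F is a constant multiple of G^2 / g^n for the function g
    with divisor 2 (Q) - (P) - (O) ([dlog_F], [F_eq]). On the model
    y^2 + a3 y = x^3 + a2 x^2 + a4 x with Q at the origin this becomes a linear
    differential equation x dG/omega = n (y + a3) G, a system for the polynomials
    A and B in x such that G = A + B y ([nf_ode]). The powers of G solve the same
    equation for the multiples of n, which makes curves of different orders
    comparable. Moreover Q is a multiple of P; over a field K of definition the
    models of the curve are therefore (a2, a3, a4) = (u^2 c2, u^3 c3, u^4 c4) with
    c2, c3, c4 in K and u arbitrary ([lame_normal_form]).

    Let p be a prime of K above 2, and choose a place of algC above p. In
    characteristic 2 the equation reads A = a3 x B' and forces a2 = 0, and a4 = 0 as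
    soon as a3 = 0 ([ode_char2]). It follows that the model with a3 = 1 is integral
    at the place ([lame_integral]) and reduces to y^2 + y = x^3 + a4 x, a
    supersingular curve that depends on a4 only. The solution (A, B) is rigid.
    Modulo the place it is determined by its zero of order n at the origin
    ([char2_unique]), and it lifts in at most one way together with its curve, an
    infinitesimal deformation being a polynomial H of degree less than that of B
    with (H B)' = 0, where B and B' are coprime ([deformation]). So a4 modulo the
    place determines the pair (E, P) ([lame_rigid]).

    Finally a4^3 = c4^3 / c3^4 lies in K, and the three cube roots of this number
    are the values of a4 for the three choices of u with u^3 c3 = 1. The class of
    (E, P) is thus determined by the residue of an element of K, that is by an
    element of the residue field of p ([residue_approx]). Taking for p the prime
    of maximal residual degree d leaves 2^d possibilities. *)

(** * The function field as an abstract field *)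

Lemma MXaddC_eq0 (F : fieldType) (a b : F) :
  b%:P * 'X + a%:P = 0 -> a = 0 /\ b = 0.
Proof.
move/eqP; rewrite -size_poly_eq0 size_MXaddC polyC_eq0.
by case: ifP => // /andP[/eqP-> /eqP->].
Qed.

Lemma frac_add (F : fieldType) (a b d e y : F) : d != 0 -> e != 0 ->
  a / d + b / e * y = (a * e + b * d * y) / (d * e).
Proof. by move=> d0 e0; field; rewrite ?d0 ?e0. Qed.

Section CoordinateRing.
Variables (k : fieldType) (E : ecurve k).

Local Notation x := (fun_x E).
Local Notation y := (fun_y E).
Local Notation KE := (funfield E).
Local Notation cst := (fun_cst E).

Fact fun_cst_zmod : zmod_morphism cst.
Proof. by move=> a b; rewrite /fun_cst !rmorphB. Qed.
Fact fun_cst_monoid : monoid_morphism cst.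
Proof. by split=> [|a b]; rewrite /fun_cst ?rmorph1 ?rmorphM. Qed.
HB.instance Definition _ := GRing.isZmodMorphism.Build k KE cst fun_cst_zmod.
HB.instance Definition _ := GRing.isMonoidMorphism.Build k KE cst fun_cst_monoid.

Definition polx (A : {poly k}) : KE :=
  qpolyC (curve_poly E) (FracField.tofrac A).
Fact polx_zmod : zmod_morphism polx.
Proof. by move=> a b; rewrite /polx !rmorphB. Qed.
Fact polx_monoid : monoid_morphism polx.
Proof. by split=> [|a b]; rewrite /polx ?rmorph1 ?rmorphM. Qed.
HB.instance Definition _ := GRing.isZmodMorphism.Build {poly k} KE polx polx_zmod.
HB.instance Definition _ := GRing.isMonoidMorphism.Build {poly k} KE polx polx_monoid.

Lemma polxC c : polx c%:P = cst c. Proof. by []. Qed.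
Lemma polxX : polx 'X = x. Proof. by []. Qed.
Lemma polxXn i : polx 'X^i = x ^+ i. Proof. by rewrite rmorphXn. Qed.
Lemma polxE A : polx A = (map_poly cst A).[x].
Proof.
elim/poly_ind: A => [|p c IH]; first by rewrite !rmorph0 horner0.
by rewrite rmorphD rmorphM /= polxX IH polxC rmorphD rmorphM /= map_polyX map_polyC hornerMXaddC.
Qed.

Lemma mk_monic_curve : mk_monic (curve_poly E) = curve_poly E.
Proof. by rewrite /mk_monic size_curve_poly curve_poly_monic. Qed.

Definition inq (p : {poly {fraction {poly k}}}) : KE := in_qpoly (curve_poly E) p.
Fact inq_zmod : zmod_morphism inq.
Proof. by move=> a b; rewrite /inq rmorphB. Qed.
Fact inq_monoid : monoid_morphism inq.
Proof. by split=> [|a b]; rewrite /inq ?rmorph1 ?rmorphM. Qed.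
HB.instance Definition _ := GRing.isZmodMorphism.Build _ KE inq inq_zmod.
HB.instance Definition _ := GRing.isMonoidMorphism.Build _ KE inq inq_monoid.

Lemma inqE (p : {poly {fraction {poly k}}}) : (size p < 3)%N -> val (inq p) = p :> {poly _}.
Proof. by move=> h; rewrite [LHS]in_qpoly_small // mk_monic_curve size_curve_poly. Qed.

Lemma inqC (A : {poly k}) : inq (FracField.tofrac A)%:P = polx A.
Proof.
by apply: val_inj; rewrite inqE // (leq_ltn_trans (size_polyC_leq1 _)).
Qed.
Lemma inqX : inq 'X = y. Proof. by []. Qed.

Lemma size_val_fun (f : KE) : (size (val f) < 3)%N.
Proof.
have := congr1 (fun p : {poly _} => size p) mk_monic_curve.
by rewrite size_curve_poly => <-; exact: size_mk_monic.
Qed.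

Lemma inq_surj (f : KE) : f = inq (val f).
Proof.
apply: val_inj; rewrite inqE //.
exact: size_val_fun.
Qed.

Lemma inq_curve : inq (curve_poly E) = 0.
Proof.
by apply: val_inj; rewrite /= mk_monic_curve Pdiv.RingMonic.rmodpp ?curve_poly_monic.
Qed.

Opaque funfield.

Lemma weierstrass_xy :
  y ^+ 2 + cst (a1 E) * x * y + cst (a3 E) * y =
  x ^+ 3 + cst (a2 E) * x ^+ 2 + cst (a4 E) * x + cst (a6 E).
Proof.
have e : inq (curve_poly E) =
    y ^+ 2 + polx (a1 E *: 'X + (a3 E)%:P) * y
    - polx ('X^3 + a2 E *: 'X^2 + a4 E *: 'X + (a6 E)%:P).
  rewrite -(inqC (_ + (a3 E)%:P)) -(inqC (_ + (a6 E)%:P)) -inqX.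
  by rewrite -rmorphXn -rmorphM -rmorphD -rmorphB /= mul_polyC.
move: inq_curve; rewrite e => /subr0_eq.
rewrite !rmorphD /= -!mul_polyC ![polx (_%:P * _)]rmorphM /= !polxC !polxXn polxX.
by rewrite mulrDl addrA.
Qed.

Lemma polxy_inj A B : polx A + polx B * y = 0 -> A = 0 /\ B = 0.
Proof.
rewrite -!inqC -inqX -rmorphM -rmorphD addrC => h.
have sz (b a : {fraction {poly k}}) : (size (b%:P * 'X + a%:P)%R < 3)%N.
  rewrite size_MXaddC; case: ifP => // _; rewrite ltnS.
  by case: (size _) (size_polyC_leq1 b) => [|[]].
have e : (FracField.tofrac B)%:P * 'X + (FracField.tofrac A)%:P = 0 :> {poly {fraction {poly k}}}.
  by rewrite -(inqE (sz _ _)) h.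
have [/eqP + /eqP] := MXaddC_eq0 e; rewrite !tofrac_eq0.
by move=> /eqP-> /eqP->.
Qed.

Lemma polx_inj A : polx A = 0 -> A = 0.
Proof.
by move=> h; have [] := @polxy_inj A 0; first by rewrite h rmorph0 mul0r addr0.
Qed.

Lemma polx_eq0 A : (polx A == 0) = (A == 0).
Proof. by apply/eqP/eqP => [/polx_inj|->]; rewrite // rmorph0. Qed.

Lemma inq_frac (u v : {poly k}) : v != 0 ->
  inq (FracField.tofrac u / FracField.tofrac v)%:P = polx u / polx v.
Proof.
move=> v0; apply: (canRL (mulfK _)); first by rewrite polx_eq0.
by rewrite -!inqC -rmorphM /= -polyCM divfK // tofrac_eq0.
Qed.

Lemma funfieldP (f : KE) : exists A B d,
  d != 0 /\ f = (polx A + polx B * y) / polx d.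
Proof.
have [a [d [d0 ea]]] := fractionP (val f)`_0.
have [b [e [e0 eb]]] := fractionP (val f)`_1.
exists (a * e), (b * d), (d * e); split; first by rewrite mulf_neq0.
have -> : f = polx a / polx d + polx b / polx e * y.
  rewrite -!inq_frac // -ea -eb -inqX -rmorphM -rmorphD [LHS]inq_surj.
  congr (inq _); apply/polyP => -[|[|i]]; rewrite coefD coefC coefMX coefC /= ?addr0 ?add0r //.
  rewrite nth_default //; apply: (@leq_trans 2%N) => //.
  by rewrite -ltnS; exact: size_val_fun.
rewrite !(rmorphM polx); apply: frac_add; by rewrite polx_eq0.
Qed.

End CoordinateRing.

Section Models.
Variables (k : fieldType) (E : ecurve k).

(** A field generated over k by two elements x and y subject to the equation of E
    and to no other relation: the function field of E, without its construction
    as a quotient of polynomials. *)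
Record ffmodel := FFModel {
  ff_field :> fieldType;
  ff_cst : {rmorphism k -> ff_field};
  ff_x : ff_field;
  ff_y : ff_field;
  ff_weierstrass :
    ff_y ^+ 2 + ff_cst (a1 E) * ff_x * ff_y + ff_cst (a3 E) * ff_y =
    ff_x ^+ 3 + ff_cst (a2 E) * ff_x ^+ 2 + ff_cst (a4 E) * ff_x + ff_cst (a6 E);
  ff_free : forall A B : {poly k},
    (map_poly ff_cst A).[ff_x] + (map_poly ff_cst B).[ff_x] * ff_y = 0 ->
    A = 0 /\ B = 0;
  ff_gen : forall f : ff_field, exists A B d : {poly k}, d != 0 /\
    f = ((map_poly ff_cst A).[ff_x] + (map_poly ff_cst B).[ff_x] * ff_y)
          / (map_poly ff_cst d).[ff_x]
}.

Fact funfield_free (A B : {poly k}) :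
  (map_poly (fun_cst E) A).[fun_x E] + (map_poly (fun_cst E) B).[fun_x E] * fun_y E = 0 ->
  A = 0 /\ B = 0.
Proof. by rewrite -!polxE; exact: polxy_inj. Qed.

Fact funfield_gen (f : funfield E) : exists A B d : {poly k}, d != 0 /\
    f = ((map_poly (fun_cst E) A).[fun_x E] + (map_poly (fun_cst E) B).[fun_x E] * fun_y E)
          / (map_poly (fun_cst E) d).[fun_x E].
Proof.
have [A [B [d [d0 e]]]] := funfieldP f; exists A, B, d; split; first exact: d0.
by rewrite -!polxE.
Qed.

Definition function_field : ffmodel :=
  FFModel (weierstrass_xy E) funfield_free funfield_gen.
End Models.

(** * Polynomials in x and y *)

Section Bivariate.
Variables (k L : comNzRingType) (h : {rmorphism k -> L}) (u v : L).

Definition ev1 (A : {poly k}) : L := (map_poly h A).[u].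
Fact ev1_zmod : zmod_morphism ev1.
Proof. by move=> a b; rewrite /ev1 rmorphB hornerD hornerN. Qed.
Fact ev1_monoid : monoid_morphism ev1.
Proof. by split=> [|a b]; rewrite /ev1 ?rmorph1 ?hornerC // rmorphM hornerM. Qed.
HB.instance Definition _ := GRing.isZmodMorphism.Build {poly k} L ev1 ev1_zmod.
HB.instance Definition _ := GRing.isMonoidMorphism.Build {poly k} L ev1 ev1_monoid.
Lemma ev1C c : ev1 c%:P = h c.
Proof. by rewrite /ev1 map_polyC hornerC. Qed.
Lemma ev1X : ev1 'X = u.
Proof. by rewrite /ev1 map_polyX hornerX. Qed.

Lemma ev1D A B : ev1 (A + B) = ev1 A + ev1 B. Proof. exact: rmorphD. Qed.
Lemma ev1B A B : ev1 (A - B) = ev1 A - ev1 B. Proof. exact: rmorphB. Qed.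
Lemma ev1M A B : ev1 (A * B) = ev1 A * ev1 B. Proof. exact: rmorphM. Qed.
Lemma ev1Xn n : ev1 'X^n = u ^+ n.
Proof. by rewrite rmorphXn /= ev1X. Qed.

Definition ev2 (g : {poly {poly k}}) : L := (map_poly (map_poly h) g).[u, v].
Fact ev2_zmod : zmod_morphism ev2.
Proof. by move=> a b; rewrite /ev2 rmorphB !hornerE. Qed.
Fact ev2_monoid : monoid_morphism ev2.
Proof. by split=> [|a b]; rewrite /ev2 ?rmorph1 ?hornerE // rmorphM !hornerM. Qed.
HB.instance Definition _ := GRing.isZmodMorphism.Build {poly {poly k}} L ev2 ev2_zmod.
HB.instance Definition _ := GRing.isMonoidMorphism.Build {poly {poly k}} L ev2 ev2_monoid.
Lemma ev2CC c : ev2 c%:P%:P = h c.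
Proof. by rewrite /ev2 map_polyC /= map_polyC /= !hornerC. Qed.
Lemma ev2X : ev2 'X = u.
Proof. by rewrite /ev2 map_polyX hornerX hornerC. Qed.
Lemma ev2Y : ev2 'X%:P = v.
Proof. by rewrite /ev2 map_polyC /= map_polyX hornerC hornerX. Qed.
End Bivariate.

Lemma ev2_id (k : comNzRingType) (u v : k) g : ev2 idfun u v g = g.[u, v].
Proof.
by rewrite /ev2; congr (_.[_, _]); apply: map_poly_id => p _; exact: map_poly_id.
Qed.

Lemma poly2_ind (k : comNzRingType) (P : {poly {poly k}} -> Prop) :
  (forall c, P c%:P%:P) -> P 'X -> P 'X%:P ->
  (forall g h, P g -> P h -> P (g + h)) -> (forall g h, P g -> P h -> P (g * h)) ->
  forall g, P g.
Proof.
move=> pC pX pY pD pM; elim/poly_ind => [|g c Pg]; first exact: (pC 0).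
apply: (pD); first exact: pM.
elim/poly_ind: c {Pg} => [|c d Pc]; first exact: (pC 0).
by rewrite polyCD polyCM; apply: pD => //; apply: pM.
Qed.

Section Weierstrass.
Variables (k : fieldType) (E : ecurve k).

Definition wlin : {poly k} := (a1 E)%:P * 'X + (a3 E)%:P.
Definition wcub : {poly k} := 'X^3 + (a2 E)%:P * 'X^2 + (a4 E)%:P * 'X + (a6 E)%:P.

Definition on_weq (L : comNzRingType) (h : k -> L) (u v : L) :=
  v ^+ 2 + h (a1 E) * u * v + h (a3 E) * v =
  u ^+ 3 + h (a2 E) * u ^+ 2 + h (a4 E) * u + h (a6 E).

Lemma ev1_wlin (L : comNzRingType) (h : {rmorphism k -> L}) u :
  ev1 h u wlin = h (a1 E) * u + h (a3 E).
Proof. by rewrite rmorphD rmorphM /= !ev1C ev1X. Qed.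
Lemma ev1_wcub (L : comNzRingType) (h : {rmorphism k -> L}) u :
  ev1 h u wcub = u ^+ 3 + h (a2 E) * u ^+ 2 + h (a4 E) * u + h (a6 E).
Proof. by rewrite !rmorphD /= ![ev1 _ _ (_%:P * _)]rmorphM /= !ev1Xn !ev1C ev1X. Qed.

Lemma on_weqE (L : comNzRingType) (h : {rmorphism k -> L}) u v :
  on_weq h u v -> v ^+ 2 = ev1 h u wcub - ev1 h u wlin * v.
Proof. by rewrite /on_weq ev1_wlin ev1_wcub => <-; ring. Qed.

(** The reduction of powers of y to degree 1 in y is uniform in the point of the
    curve at which the polynomial is evaluated. *)
Lemma reduce_poly2 (g : {poly {poly k}}) : exists A B : {poly k},
  forall (L : comNzRingType) (h : {rmorphism k -> L}) u v, on_weq h u v ->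
    ev2 h u v g = ev1 h u A + ev1 h u B * v.
Proof.
elim/poly2_ind: g => [c|||g1 g2 [A1 [B1 e1]] [A2 [B2 e2]]|g1 g2 [A1 [B1 e1]] [A2 [B2 e2]]].
- by exists c%:P, 0 => L h u v _; rewrite ev2CC ev1C rmorph0 mul0r addr0.
- by exists 'X, 0 => L h u v _; rewrite ev2X ev1X rmorph0 mul0r addr0.
- by exists 0, 1 => L h u v _; rewrite ev2Y rmorph1 rmorph0 mul1r add0r.
- exists (A1 + A2), (B1 + B2) => L h u v e.
  by rewrite !rmorphD /= e1 // e2 //; ring.
- exists (A1 * A2 + B1 * B2 * wcub), (A1 * B2 + A2 * B1 - B1 * B2 * wlin) => L h u v e.
  rewrite rmorphM /= e1 // e2 //; have := on_weqE e.
  generalize wcub wlin => c l e'.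
  by rewrite !(ev1M, ev1B, ev1D); ring: e'.
Qed.

Lemma size_wcub : size wcub = 4%N.
Proof.
rewrite /wcub !mul_polyC -!addrA size_polyDl size_polyXn //.
rewrite !addrA !(leq_ltn_trans (size_polyD _ _)) // gtn_max.
rewrite (leq_ltn_trans (size_polyC_leq1 _)) // andbT.
rewrite (leq_ltn_trans (size_polyD _ _)) // gtn_max.
by rewrite !(leq_ltn_trans (size_scale_leq _ _)) // ?size_polyXn ?size_polyX.
Qed.

Lemma size_wlin : (size wlin <= 2)%N.
Proof. by rewrite size_MXaddC; case: ifP => // _; rewrite ltnS size_polyC_leq1. Qed.
End Weierstrass.

(** Sizes of polynomials over a field occur with several convertible spellings
    of the coefficient structure, which linear arithmetic would keep apart. *)
Definition psize (F : fieldType) (p : {poly F}) : nat := size p.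
Ltac size_lia :=
  repeat match goal with
  | |- context [@size ?T (@polyseq ?R ?p)] =>
      change (@size T (@polyseq R p)) with (psize p)
  | H : context [@size ?T (@polyseq ?R ?p)] |- _ =>
      change (@size T (@polyseq R p)) with (psize p) in H
  end;
  repeat match goal with H : context [psize _] |- _ => revert H end;
  repeat match goal with |- context [psize ?p] =>
    let v := fresh "v" in set v := (psize p); clearbody v
  end; lia.

Lemma psizeM (F : fieldType) (p q : {poly F}) :
  (psize (p * q) <= (psize p + psize q).-1)%N.
Proof. exact: size_polyMleq. Qed.
Lemma psizeD (F : fieldType) (p q : {poly F}) :
  (psize (p + q) <= maxn (psize p) (psize q))%N.
Proof. exact: size_polyD. Qed.
Lemma psizeB (F : fieldType) (p q : {poly F}) :
  (psize (p - q) <= maxn (psize p) (psize q))%N.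
Proof. by rewrite /psize (leq_trans (size_polyD _ _)) // size_polyN. Qed.
Lemma psize_gt0 (F : fieldType) (p : {poly F}) : p != 0 -> (0 < psize p)%N.
Proof. by rewrite /psize size_poly_gt0. Qed.
Lemma psize0 (F : fieldType) : psize (0 : {poly F}) = 0%N.
Proof. exact: size_poly0. Qed.

(** The norm of A + B y from k[x, y] to k[x], for y^2 + l y = c. *)
Definition wnorm (k : comNzRingType) (l c A B : {poly k}) : {poly k} :=
  A ^+ 2 - l * A * B - c * B ^+ 2.

Section Norm.
Variables (k : fieldType) (l c : {poly k}).
Local Notation wnorm := (wnorm l c).

Lemma wnormM A B A' B' :
  wnorm (A * A' + B * B' * c) (A * B' + A' * B - B * B' * l) = wnorm A B * wnorm A' B'.
Proof. by rewrite /wnorm; ring. Qed.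

Hypotheses (sl : (size l <= 2)%N) (sc : size c = 4%N).

Lemma size_cB2 (B : {poly k}) : B != 0 -> size (c * B ^+ 2) = (2 * size B + 2)%N.
Proof.
move=> B0; have B1 : (0 < size B)%N by rewrite size_poly_gt0.
have c0 : c != 0 by rewrite -size_poly_gt0 sc.
rewrite size_mul // ?expf_neq0 // expr2 size_mul // sc; size_lia.
Qed.

Lemma size_lAB (A B : {poly k}) : (size (l * A * B)%R <= size A + size B)%N.
Proof.
have := size_polyMleq (l * A) B; have := size_polyMleq l A.
move: sl; size_lia.
Qed.

Lemma size_wnorm_le (A B : {poly k}) m :
  (2 * size A <= m.+2)%N -> (2 * size B <= m.-1)%N -> (size (wnorm A B) <= m.+1)%N.
Proof.
move=> hA hB; rewrite /wnorm.
have h1 : (size (A ^+ 2) <= m.+1)%N.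
  by rewrite expr2; have := size_polyMleq A A; size_lia.
have [->|B0] := eqVneq B 0; first by rewrite !mulr0 expr0n /= mulr0 !subr0.
have B1 : (0 < size B)%N by rewrite size_poly_gt0.
apply: leq_trans (size_polyD _ _) _; rewrite size_polyN geq_max; apply/andP; split.
  apply: leq_trans (size_polyD _ _) _; rewrite size_polyN geq_max h1 /=.
  by apply: leq_trans (size_lAB _ _) _; size_lia.
by rewrite size_cB2 //; size_lia.
Qed.

Lemma size_wnorm_ge (A B : {poly k}) m : (size (wnorm A B) <= m.+1)%N ->
  (2 * size A <= m.+2)%N /\ (2 * size B <= m.-1)%N.
Proof.
have [->|A0] := eqVneq A 0.
  rewrite /wnorm mulr0 expr0n /= mul0r subrr add0r size_polyN.
  have [->|B0] := eqVneq B 0; first by rewrite !size_poly0.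
  by rewrite size_cB2 // size_poly0; size_lia.
have A1 : (0 < size A)%N by rewrite size_poly_gt0.
have h1 : size (A ^+ 2) = (2 * size A - 1)%N by rewrite expr2 size_mul //; size_lia.
have [->|B0] := eqVneq B 0.
  by rewrite /wnorm mulr0 expr0n /= mulr0 !subr0 size_poly0 h1; size_lia.
have B1 : (0 < size B)%N by rewrite size_poly_gt0.
have h2 := size_lAB A B; have h3 := size_cB2 B0.
have h4 : (size (A ^+ 2 - l * A * B)%R <= maxn (2 * size A - 1) (size A + size B))%N.
  by apply: leq_trans (size_polyD _ _) _; rewrite size_polyN h1 geq_max leq_maxl (leq_trans h2) // leq_maxr.
have [le|gt] := leqP (size A) (size B).+1.
  rewrite /wnorm addrC size_polyDl size_polyN h3; first by size_lia.
  by apply: leq_ltn_trans h4 _; size_lia.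
have h5 : size (A ^+ 2 - l * A * B) = (2 * size A - 1)%N.
  by rewrite size_polyDl h1 // size_polyN; apply: leq_ltn_trans h2 _; size_lia.
rewrite /wnorm size_polyDl h5 ?size_polyN ?h3; by size_lia.
Qed.

Lemma wnorm_eq0 (A B : {poly k}) : wnorm A B = 0 -> A = 0 /\ B = 0.
Proof.
move=> h; have [] := @size_wnorm_ge A B 0%N; first by rewrite h size_poly0.
rewrite /= => h1 h2; have B0 : B = 0.
  by apply/eqP; rewrite -size_poly_eq0; size_lia.
move: h; rewrite /wnorm B0 mulr0 expr0n /= mulr0 !subr0 => /eqP.
by rewrite sqrf_eq0 => /eqP.
Qed.
End Norm.

(** * Growth at infinity *)

Section Weights.
Variables (k : fieldType) (E : ecurve k) (M : ffmodel E).
Local Notation j := (ff_cst M).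
Local Notation x := (ff_x M).
Local Notation y := (ff_y M).
Local Notation l := (wlin E).
Local Notation c := (wcub E).

Definition px : {poly k} -> M := ev1 j x.
HB.instance Definition _ := GRing.RMorphism.on px.

Lemma pxC a : px a%:P = j a. Proof. exact: ev1C. Qed.
Lemma pxX : px 'X = x. Proof. exact: ev1X. Qed.

Lemma curve_xy : on_weq E j x y. Proof. exact: ff_weierstrass. Qed.
Lemma y2E : y ^+ 2 = px c - px l * y. Proof. exact: on_weqE curve_xy. Qed.

Lemma px_free A B : px A + px B * y = 0 -> A = 0 /\ B = 0.
Proof. exact: ff_free. Qed.
Lemma px_gen f : exists A B d, d != 0 /\ f = (px A + px B * y) / px d.
Proof. exact: ff_gen. Qed.

Lemma px_inj A B A' B' : px A + px B * y = px A' + px B' * y -> A = A' /\ B = B'.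
Proof.
move=> e; have [] := @px_free (A - A') (B - B').
  rewrite !rmorphB /=; have -> : px A = px A' + px B' * y - px B * y by rewrite -e; ring.
  by ring.
by split; apply: subr0_eq.
Qed.
Lemma px_eq0 A : (px A == 0) = (A == 0).
Proof.
apply/eqP/eqP => [h|->]; last exact: rmorph0.
by have [] := @px_free A 0; rewrite // rmorph0 mul0r addr0.
Qed.
Lemma y_neq0 : y != 0.
Proof.
apply/eqP => y0; have [] := @px_free 0 1; first by rewrite y0 mulr0 addr0 rmorph0.
by move=> _ /eqP; rewrite oner_eq0.
Qed.
Lemma x_neq0 : x != 0. Proof. by rewrite -pxX px_eq0 polyX_eq0. Qed.

Lemma px_mul A B A' B' : (px A + px B * y) * (px A' + px B' * y) =
  px (A * A' + B * B' * c) + px (A * B' + A' * B - B * B' * l) * y.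
Proof.
have := y2E; generalize c l => c0 l0 e.
by rewrite !(rmorphB, rmorphD, rmorphM) /=; ring: e.
Qed.

(** [wle f m] says that f is a polynomial in x and y of weight at most m, the
    coordinates x and y having weights 2 and 3: a pole of order at most m at
    infinity and no other pole. *)
Definition wle (f : M) (m : nat) := exists A B,
  [/\ f = px A + px B * y, (2 * size A <= m.+2)%N & (2 * size B <= m.-1)%N].

Lemma wle_leq f m n : (m <= n)%N -> wle f m -> wle f n.
Proof. by move=> mn [A [B [-> hA hB]]]; exists A, B; split=> //; size_lia. Qed.

Lemma wleD f g m : wle f m -> wle g m -> wle (f + g) m.
Proof.
move=> [A [B [-> hA hB]]] [A' [B' [-> hA' hB']]]; exists (A + A'), (B + B'); split.
- by rewrite !rmorphD /=; ring.
- by have := psizeD A A'; size_lia.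
- by have := psizeD B B'; size_lia.
Qed.

Lemma wle_cst a : wle (j a) 0.
Proof.
exists a%:P, 0; split; rewrite ?rmorph0 ?mul0r ?addr0 ?pxC ?size_poly0 //.
by have := size_polyC_leq1 a; size_lia.
Qed.
Lemma wle_x : wle x 2.
Proof. by exists 'X, 0; split; rewrite ?rmorph0 ?mul0r ?addr0 ?pxX ?size_poly0 ?size_polyX. Qed.
Lemma wle_y : wle y 3.
Proof. by exists 0, 1; split; rewrite ?rmorph0 ?rmorph1 ?mul1r ?add0r ?size_poly0 ?size_poly1. Qed.

Lemma wleM f g m n : wle f m -> wle g n -> wle (f * g) (m + n).
Proof.
move=> [A [B [-> hA hB]]] [A' [B' [-> hA' hB']]].
exists (A * A' + B * B' * c), (A * B' + A' * B - B * B' * l); split.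
- exact: px_mul.
- have [->|/psize_gt0 B0] := eqVneq B 0.
    by rewrite !mul0r addr0; have := psizeM A A'; size_lia.
  have [->|/psize_gt0 B0'] := eqVneq B' 0.
    by rewrite mulr0 !mul0r addr0; have := psizeM A A'; size_lia.
  have := psizeD (A * A') (B * B' * c); have := psizeM A A'.
  have := psizeM (B * B') c; have := psizeM B B'; have := size_wcub E.
  by size_lia.
- have := psizeM A B'; have := psizeM A' B.
  have := psizeM (B * B') l; have := psizeM B B'; have := size_wlin E.
  have := psizeD (A * B') (A' * B); have := psizeB (A * B' + A' * B) (B * B' * l).
  have [->|/psize_gt0 B0] := eqVneq B 0.
    have [->|/psize_gt0 B0'] := eqVneq B' 0; first by rewrite !mulr0 !mul0r !subr0 addr0 size_poly0.
    by rewrite !mul0r !mulr0 !subr0 !addr0 !psize0; size_lia.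
  have [->|/psize_gt0 B0'] := eqVneq B' 0.
    by rewrite !(mulr0, mul0r, subr0, add0r, psize0); size_lia.
  by size_lia.
Qed.

Lemma wle_exp f m n : wle f m -> wle (f ^+ n) (n * m).
Proof.
move=> h; elim: n => [|n IH]; first by rewrite expr0 mul0n -(rmorph1 j); exact: wle_cst.
by rewrite exprS mulSn; apply: wleM.
Qed.

(** The norm of y^N is a power of that of y, which bounds its weight from below. *)
Lemma px_expy N : exists A B,
  y ^+ N = px A + px B * y /\ wnorm l c A B = (- c) ^+ N.
Proof.
elim: N => [|N [A [B [e n]]]].
  by exists 1, 0; rewrite rmorph0 rmorph1 mul0r addr0 /wnorm; split=> //; ring.
exists (0 * A + 1 * B * c), (0 * B + A * 1 - 1 * B * l).
split; first by rewrite -px_mul -e rmorph0 rmorph1 add0r mul1r exprS.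
by rewrite wnormM n exprS /wnorm; ring.
Qed.

Lemma size_cubX N : size ((- c) ^+ N) = (3 * N).+1.
Proof.
have c0 : (- c) ^+ N != 0 by rewrite expf_neq0 // -size_poly_gt0 size_polyN size_wcub.
have := size_exp (- c) N; rewrite size_polyN size_wcub /=.
by move: (psize_gt0 c0); size_lia.
Qed.

Lemma wle_expy_ge a N m : a != 0 -> wle (j a * y ^+ N) m -> (3 * N <= m)%N.
Proof.
move=> a0 [A [B [e hA hB]]]; have [A' [B' [e' n]]] := px_expy N.
have [eA eB] : A = a%:P * A' /\ B = a%:P * B'.
  by apply: px_inj; rewrite -e e' !rmorphM /= pxC; ring.
have := size_wnorm_le (size_wlin E) (size_wcub E) hA hB.
have -> : wnorm l c A B = (a ^+ 2)%:P * (- c) ^+ N.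
  by rewrite -n eA eB /wnorm rmorphXn /=; ring.
by rewrite mul_polyC size_scale ?expf_neq0 // size_cubX; lia.
Qed.

(** Regular, respectively vanishing at infinity: y^N f has at most, respectively
    less than, the weight 3 N of y^N. *)
Definition bounded (f : M) := exists N, wle (y ^+ N * f) (3 * N).
Definition infinitesimal (f : M) := exists N, wle (y ^+ N.+1 * f) (3 * N + 2).

Lemma inf_bounded f : infinitesimal f -> bounded f.
Proof. by move=> [N h]; exists N.+1; apply: wle_leq h; lia. Qed.
Lemma bounded_cst a : bounded (j a).
Proof. by exists 0%N; rewrite mul1r; exact: wle_cst. Qed.

Lemma wle_expyM f i m : wle f m -> wle (y ^+ i * f) (3 * i + m).
Proof. by move=> h; rewrite mulnC; apply: wleM (wle_exp _ wle_y) h. Qed.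

Lemma boundedD f g : bounded f -> bounded g -> bounded (f + g).
Proof.
move=> [N hN] [P hP]; exists (N + P)%N.
rewrite mulrDr {1}exprD (mulrC (y ^+ N)) -mulrA [in y ^+ (N + P) * g]exprD -mulrA.
apply: wleD; first by apply: wle_leq (wle_expyM P hN); lia.
by apply: wle_leq (wle_expyM N hP); lia.
Qed.
Lemma infD f g : infinitesimal f -> infinitesimal g -> infinitesimal (f + g).
Proof.
move=> [N hN] [P hP]; exists (N + P.+1)%N.
rewrite mulrDr {1}(_ : (N + P.+1).+1 = P.+1 + N.+1)%N ?[in y ^+ _ * g](_ : (N + P.+1).+1 = N.+1 + P.+1)%N; try lia.
rewrite !exprD -!mulrA.
apply: wleD; first by apply: wle_leq (wle_expyM P.+1 hN); lia.
by apply: wle_leq (wle_expyM N.+1 hP); lia.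
Qed.
Lemma infM f g : infinitesimal f -> bounded g -> infinitesimal (f * g).
Proof.
move=> [N hN] [P hP]; exists (N + P)%N.
rewrite -addSn exprD mulrACA; apply: wle_leq (wleM hN hP); lia.
Qed.
Lemma boundedM f g : bounded f -> bounded g -> bounded (f * g).
Proof.
move=> [N hN] [P hP]; exists (N + P)%N.
by rewrite exprD mulrACA mulnDr; apply: wleM.
Qed.
Lemma inf_cst a : infinitesimal (j a) -> a = 0.
Proof.
move=> [N h]; apply/eqP; apply: contraT => a0.
by have := @wle_expy_ge a N.+1 (3 * N + 2) a0; rewrite mulrC => /(_ h); lia.
Qed.

Lemma inf_xy : infinitesimal (x / y).
Proof. by exists 0%N; rewrite expr1 mulrC divfK ?y_neq0 //; exact: wle_x. Qed.
Lemma inf_yV : infinitesimal y^-1.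
Proof.
exists 0%N; rewrite expr1 mulfV ?y_neq0 // -(rmorph1 j).
by apply: wle_leq (wle_cst 1).
Qed.

Lemma inf_ev2 (g : {poly {poly k}}) :
  bounded (ev2 j (x / y) y^-1 g) /\ infinitesimal (ev2 j (x / y) y^-1 g - j g.[0, 0]).
Proof.
have inf0 : infinitesimal 0 by exists 0%N; rewrite mulr0 -(rmorph0 j); apply: wle_leq (wle_cst 0).
elim/poly2_ind: g => [a|||g h [bg ig] [bh ih]|g h [bg ig] [bh ih]].
- by rewrite ev2CC !hornerE subrr; split=> //; exact: bounded_cst.
- rewrite ev2X !hornerE rmorph0 subr0; split; last exact: inf_xy.
  exact/inf_bounded/inf_xy.
- rewrite ev2Y !hornerE rmorph0 subr0; split; last exact: inf_yV.
  exact/inf_bounded/inf_yV.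
- rewrite !(rmorphD, hornerD) /=; split; first exact: boundedD.
  by have := infD ig ih; congr infinitesimal; ring.
- rewrite !hornerM !rmorphM /=; split; first exact: boundedM.
  have := infD (infM ig bh) (infM ih (bounded_cst g.[0, 0])).
  by congr infinitesimal; ring.
Qed.

(** A function of the chart at infinity with nonzero value there is not 0, as a
    nonzero constant is not infinitesimal. *)
Lemma ev2_inf_neq0 (g : {poly {poly k}}) : g.[0, 0] != 0 -> ev2 j (x / y) y^-1 g != 0.
Proof.
move=> g0; apply/eqP => e; have [_ [N h]] := inf_ev2 g.
have : infinitesimal (j (- g.[0, 0])) by exists N; move: h; rewrite e rmorphN sub0r.
by move/inf_cst/eqP; rewrite oppr_eq0 (negPf g0).
Qed.
End Weights.

(** * Values and orders of functions *)

Lemma poly2_taylor (k : fieldType) (g : {poly {poly k}}) (a b : k) :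
  exists g1 g2, g = ('X - a%:P%:P) * g1 + ('X%:P - b%:P%:P) * g2 + g.[a, b]%:P%:P.
Proof.
have /factor_theorem[g1 e1] : root (g - g.[a%:P]%:P) a%:P.
  by rewrite /root !hornerE subrr.
have /factor_theorem[g2 e2] : root (g.[a%:P] - g.[a, b]%:P) b.
  by rewrite /root !hornerE subrr.
exists g1, g2%:P; rewrite -[LHS](subrK g.[a%:P]%:P) e1 mulrC -addrA; congr (_ + _).
rewrite -polyCB -polyCM -polyCD; congr (_%:P).
by rewrite -[LHS](subrK g.[a, b]%:P) e2 mulrC.
Qed.

Lemma singular_discriminant (k : fieldType) (W : weierstrass k) (a b : k) :
  on_curve W (Some (a, b)) -> 2 * b + a1 W * a + a3 W = 0 ->
  3 * a ^+ 2 + 2 * a2 W * a + a4 W - a1 W * b = 0 -> discriminant W = 0.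
Proof.
case: W => w1 w2 w3 w4 w6; rewrite /on_curve /discriminant /= => /eqP e0 e1 e2.
have {e1} h3 : w3 = - (2 * b + w1 * a) by rewrite -[LHS]subr0 -e1; ring.
have {e2} h4 : w4 = w1 * b - 3 * a ^+ 2 - 2 * w2 * a by rewrite -[LHS]subr0 -e2; ring.
have h6 : w6 = b ^+ 2 + w1 * a * b + w3 * b - (a ^+ 3 + w2 * a ^+ 2 + w4 * a).
  by rewrite e0; ring.
by rewrite h6 h4 h3; ring.
Qed.

Section Local.
Variables (k : fieldType) (E : ecurve k) (M : ffmodel E).
Local Notation j := (ff_cst M).
Local Notation x := (ff_x M).
Local Notation y := (ff_y M).

Definition mchart (R : point E) : (M * M) * (k * k) :=
  if val R is Some c then ((x, y), c) else ((x / y, y^-1), (0, 0)).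
Definition mfun R : {poly {poly k}} -> M := ev2 j (mchart R).1.1 (mchart R).1.2.
HB.instance Definition _ R := GRing.RMorphism.on (mfun R).
Definition mpt R : {poly {poly k}} -> k := ev2 idfun (mchart R).2.1 (mchart R).2.2.
HB.instance Definition _ R := GRing.RMorphism.on (mpt R).

Lemma mptE R g : mpt R g = g.[(mchart R).2.1, (mchart R).2.2].
Proof. exact: ev2_id. Qed.

Lemma mfun_neq0 R h : mpt R h != 0 -> mfun R h != 0.
Proof.
rewrite mptE /mfun; case: R => -[[a b]|] oR; rewrite /mchart /=; last exact: ev2_inf_neq0.
rewrite -[_.[_, _]]ev2_id => h0; apply: contraNneq h0 => e.
have [A [B red]] := reduce_poly2 E h.
have eab : on_weq E idfun a b by exact/eqP.
rewrite (red _ _ _ _ eab); move: e; rewrite (red _ _ _ _ (curve_xy M)).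
by move/(@px_free _ _ M) => [-> ->]; rewrite !rmorph0 mul0r addr0.
Qed.

Lemma mfunX R : mfun R 'X = (mchart R).1.1. Proof. exact: ev2X. Qed.
Lemma mfunY R : mfun R 'X%:P = (mchart R).1.2. Proof. exact: ev2Y. Qed.
Lemma mfunC R a : mfun R a%:P%:P = j a. Proof. exact: ev2CC. Qed.

(** [hv R f c]: f is regular at R with value c. *)
Definition hv (R : point E) (f : M) (c : k) :=
  exists g h, [/\ mpt R h != 0, f = mfun R g / mfun R h & c = mpt R g / mpt R h].

Lemma hv_fun R g : hv R (mfun R g) (mpt R g).
Proof. by exists g, 1; rewrite !rmorph1 !divr1 oner_neq0. Qed.
Lemma hvD R f f' c c' : hv R f c -> hv R f' c' -> hv R (f + f') (c + c').
Proof.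
move=> [g [h [h0 -> ->]]] [g' [h' [h0' -> ->]]].
exists (g * h' + g' * h), (h * h'); rewrite !rmorphD !rmorphM /= mulf_neq0 //.
by split=> //; rewrite addf_div // mfun_neq0.
Qed.
Lemma hvM R f f' c c' : hv R f c -> hv R f' c' -> hv R (f * f') (c * c').
Proof.
move=> [g [h [h0 -> ->]]] [g' [h' [h0' -> ->]]].
exists (g * g'), (h * h'); rewrite !rmorphM /= mulf_neq0 //.
by split=> //; rewrite mulf_div.
Qed.
Lemma hv_cst R a : hv R (j a) a.
Proof. by have := hv_fun R a%:P%:P; rewrite /mfun /mpt !ev2CC. Qed.
Lemma hv0 R : hv R 0 0. Proof. by have := hv_cst R 0; rewrite rmorph0. Qed.
Lemma hv1 R : hv R 1 1. Proof. by have := hv_cst R 1; rewrite rmorph1. Qed.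
Lemma hvN R f c : hv R f c -> hv R (- f) (- c).
Proof.
by move=> h; have := hvM (hv_cst R (-1)) h; rewrite rmorphN rmorph1 !mulN1r.
Qed.
Lemma hvB R f f' c c' : hv R f c -> hv R f' c' -> hv R (f - f') (c - c').
Proof. by move=> h /hvN; exact: hvD. Qed.
Lemma hvX R f c n : hv R f c -> hv R (f ^+ n) (c ^+ n).
Proof.
move=> h; elim: n => [|n IH]; first by rewrite !expr0; exact: hv1.
by rewrite !exprS; exact: hvM.
Qed.
Lemma hvV R f c : c != 0 -> hv R f c -> hv R f^-1 c^-1.
Proof.
move=> c0 [g [h [h0 -> e]]]; exists h, g; rewrite e !invf_div; split=> //.
by move: c0; rewrite e mulf_eq0 negb_or => /andP[].
Qed.
Lemma hv_div R f f' c c' : c' != 0 -> hv R f c -> hv R f' c' -> hv R (f / f') (c / c').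
Proof. by move=> c0 h /(hvV c0); exact: hvM. Qed.
Lemma hv_uniq R f c c' : hv R f c -> hv R f c' -> c = c'.
Proof.
move=> [g [h [h0 -> ->]]] [g' [h' [h0' e ->]]].
have : mfun R (g * h' - g' * h) = 0.
  move: e; rewrite rmorphB !rmorphM /= => /eqP.
  by rewrite eqr_div ?mfun_neq0 // => /eqP ->; rewrite subrr.
have [e0 _|/mfun_neq0/eqP //] := eqVneq (mpt R (g * h' - g' * h)) 0.
apply/eqP; rewrite eqr_div //; apply/eqP/subr0_eq.
by move: e0; rewrite rmorphB !rmorphM.
Qed.
Lemma hv_neq0 R f c : c != 0 -> hv R f c -> f != 0.
Proof. by move=> c0 h; apply: contraNneq c0 => f0; apply/eqP/(hv_uniq h); rewrite f0; exact: hv0. Qed.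

Lemma hv_X R : hv R (mchart R).1.1 (mchart R).2.1.
Proof. by have := hv_fun R 'X; rewrite /mfun /mpt !ev2X. Qed.
Lemma hv_Y R : hv R (mchart R).1.2 (mchart R).2.2.
Proof. by have := hv_fun R 'X%:P; rewrite /mfun /mpt !ev2Y. Qed.

Lemma hv_ev2 R X Y a b g : hv R X a -> hv R Y b -> hv R (ev2 j X Y g) g.[a, b].
Proof.
move=> hX hY; elim/poly2_ind: g => [c|||g h hg hh|g h hg hh].
- by rewrite ev2CC !hornerE; exact: hv_cst.
- by rewrite ev2X !hornerE.
- by rewrite ev2Y !hornerE.
- by rewrite rmorphD !hornerD; exact: hvD.
- by rewrite rmorphM !hornerM; exact: hvM.
Qed.

(** A local parameter: y - b at the points where the y-derivative of the equation
    vanishes, x - a at the other affine points, x / y at infinity. *)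
Definition t0 (R : point E) : M :=
  if val R is Some (a, b)
  then if 2 * b + a1 E * a + a3 E == 0 then y - j b else x - j a
  else x / y.

Lemma xc_neq0 a : x - j a != 0.
Proof. by rewrite -pxX -pxC -rmorphB /= px_eq0 polyXsubC_eq0. Qed.
Lemma line_neq0 a b : y - j a * x - j b != 0.
Proof.
apply/eqP => h; have [] := @px_free _ _ M (- (a%:P * 'X) - b%:P) 1.
  by rewrite -h !rmorphB rmorphN rmorphM rmorph1 /= !pxC pxX; ring.
by move=> _ /eqP; rewrite oner_eq0.
Qed.
Lemma yc_neq0 b : y - j b != 0.
Proof. by have := line_neq0 0 b; rewrite rmorph0 mul0r subr0. Qed.
Lemma t0_neq0 R : t0 R != 0.
Proof.
rewrite /t0; case: R => -[[a b]|] oR /=; last by rewrite mulf_neq0 ?invr_neq0 ?x_neq0 ?y_neq0.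
by case: ifP => _; rewrite ?xc_neq0 ?yc_neq0.
Qed.

Lemma hv_x R a b : val R = Some (a, b) -> hv R x a.
Proof. by move=> e; have := hv_X R; rewrite /mchart e. Qed.
Lemma hv_y R a b : val R = Some (a, b) -> hv R y b.
Proof. by move=> e; have := hv_Y R; rewrite /mchart e. Qed.
Lemma hv_z R : val R = None -> hv R (x / y) 0.
Proof. by move=> e; have := hv_X R; rewrite /mchart e. Qed.
Lemma hv_w R : val R = None -> hv R y^-1 0.
Proof. by move=> e; have := hv_Y R; rewrite /mchart e. Qed.

Lemma valP_curve (R : point E) a b : val R = Some (a, b) ->
  b ^+ 2 + a1 E * a * b + a3 E * b = a ^+ 3 + a2 E * a ^+ 2 + a4 E * a + a6 E.
Proof. by case: R => r oR /= e; move: oR; rewrite e => /eqP. Qed.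

(** The second factors take at (a, b) the values of the two partial derivatives of
    the equation, one of which does not vanish on a smooth curve. *)
Lemma chord_eq (a b : k) : b ^+ 2 + a1 E * a * b + a3 E * b = a ^+ 3 + a2 E * a ^+ 2 + a4 E * a + a6 E ->
  (y - j b) * (y + j b + j (a1 E) * x + j (a3 E)) =
  (x - j a) * (x ^+ 2 + j a * x + j a ^+ 2 + j (a2 E) * (x + j a) + j (a4 E) - j (a1 E) * j b).
Proof.
move/(congr1 j); rewrite !(rmorphD, rmorphM, rmorphXn) /= => e.
apply/eqP; rewrite -subr_eq0; apply/eqP.
transitivity ((y ^+ 2 + j (a1 E) * x * y + j (a3 E) * y) -
  (x ^+ 3 + j (a2 E) * x ^+ 2 + j (a4 E) * x + j (a6 E)) -
  ((j b ^+ 2 + j (a1 E) * j a * j b + j (a3 E) * j b) -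
   (j a ^+ 3 + j (a2 E) * j a ^+ 2 + j (a4 E) * j a + j (a6 E)))); first by ring.
by rewrite ff_weierstrass e; ring.
Qed.

Lemma hv_yder R a b : val R = Some (a, b) ->
  hv R (y + j b + j (a1 E) * x + j (a3 E)) (2 * b + a1 E * a + a3 E).
Proof.
move=> e; have -> : 2 * b + a1 E * a + a3 E = b + b + a1 E * a + a3 E by ring.
by do ![apply: hvD|apply: hvM|apply: hv_cst|exact: hv_x e|exact: hv_y e].
Qed.
Lemma hv_xder R a b : val R = Some (a, b) ->
  hv R (x ^+ 2 + j a * x + j a ^+ 2 + j (a2 E) * (x + j a) + j (a4 E) - j (a1 E) * j b)
       (3 * a ^+ 2 + 2 * a2 E * a + a4 E - a1 E * b).
Proof.
move=> e.
have -> : 3 * a ^+ 2 + 2 * a2 E * a + a4 E - a1 E * b =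
  a ^+ 2 + a * a + a ^+ 2 + a2 E * (a + a) + a4 E - a1 E * b by ring.
by do ![apply: hvB|apply: hvD|apply: hvM|apply: hvX|apply: hv_cst|exact: hv_x e|exact: hv_y e].
Qed.
Lemma smooth (R : point E) a b : val R = Some (a, b) -> 2 * b + a1 E * a + a3 E = 0 ->
  3 * a ^+ 2 + 2 * a2 E * a + a4 E - a1 E * b != 0.
Proof.
move=> e h; apply/eqP => h'; have := discriminant_neq0 E.
by rewrite (@singular_discriminant _ E a b) ?eqxx // -e; case: (R).
Qed.

(** The unit by which 1 / y differs from the cube of x / y at infinity. *)
Definition winf : M := 1 + j (a1 E) * (x / y) + j (a3 E) * y^-1 - j (a2 E) * (x / y) ^+ 2
   - j (a4 E) * (x / y) * y^-1 - j (a6 E) * y^-1 ^+ 2.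
Lemma winfE : winf = x ^+ 3 / y ^+ 2.
Proof.
have y0 := y_neq0 M; have e := ff_weierstrass M.
have e' : x ^+ 3 = y ^+ 2 + j (a1 E) * x * y + j (a3 E) * y - j (a2 E) * x ^+ 2 - j (a4 E) * x - j (a6 E).
  by rewrite e; ring.
by rewrite e' /winf; field.
Qed.
Lemma hv_winf R : val R = None -> hv R winf 1.
Proof.
move=> e.
have -> : 1 = 1 + a1 E * 0 + a3 E * 0 - a2 E * 0 ^+ 2 - a4 E * 0 * 0 - a6 E * 0 ^+ 2 :> k by ring.
by do ![apply: hvB|apply: hvD|apply: hvM|apply: hvX|apply: hv_cst|exact: hv_z e|exact: hv_w e|exact: hv1].
Qed.

Lemma chart_t0 R : exists c1 c2,
  hv R (((mchart R).1.1 - j (mchart R).2.1) / t0 R) c1 /\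
  hv R (((mchart R).1.2 - j (mchart R).2.2) / t0 R) c2.
Proof.
have tn := t0_neq0 R; move: tn; rewrite /mchart /t0.
case e : (val R) => [[a b]|] /= tn; last first.
  rewrite rmorph0 !subr0; exists 1, (0 ^+ 2 / 1); rewrite divff //; split; first exact: hv1.
  have -> : y^-1 / (x / y) = (x / y) ^+ 2 / winf.
    by rewrite winfE; field; rewrite ?x_neq0 ?y_neq0.
  by apply: hv_div (hv_winf e); rewrite ?oner_neq0 //; exact/hvX/hv_z.
have ce := chord_eq (valP_curve e).
have hy := hv_yder e; have hx := hv_xder e.
move: tn; case: ifP => [/eqP s0|/negbT s0] tn.
  have n0 := smooth e s0.
  eexists; exists 1; rewrite divff //; split; last exact: hv1.
  rewrite (_ : (x - j a) / (y - j b) = (y + j b + j (a1 E) * x + j (a3 E)) /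
     (x ^+ 2 + j a * x + j a ^+ 2 + j (a2 E) * (x + j a) + j (a4 E) - j (a1 E) * j b)).
    exact: hv_div hy hx.
  by apply/eqP; rewrite eqr_div ?(hv_neq0 n0 hx) // -ce mulrC.
exists 1; eexists; rewrite divff //; split; first exact: hv1.
rewrite (_ : (y - j b) / (x - j a) =
     (x ^+ 2 + j a * x + j a ^+ 2 + j (a2 E) * (x + j a) + j (a4 E) - j (a1 E) * j b) /
     (y + j b + j (a1 E) * x + j (a3 E))).
  exact: hv_div hx hy.
by apply/eqP; rewrite eqr_div ?(hv_neq0 s0 hy) // ce mulrC.
Qed.

Lemma hv_t0 R : hv R (t0 R) 0.
Proof.
rewrite /t0; case e : (val R) => [[a b]|]; last exact: hv_z.
case: ifP => _.
  by rewrite -(subrr b); apply: hvB (hv_cst R b); exact: hv_y e.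
by rewrite -(subrr a); apply: hvB (hv_cst R a); exact: hv_x e.
Qed.

Lemma hv_div_t0 R f : hv R f 0 -> exists c, hv R (f / t0 R) c.
Proof.
move=> [g [h [h0 -> e]]].
have g0 : mpt R g = 0.
  by apply/eqP; move/eqP: e; rewrite eq_sym mulf_eq0 invr_eq0 (negPf h0) orbF.
have [g1 [g2 eg]] := poly2_taylor g (mchart R).2.1 (mchart R).2.2.
rewrite -mptE g0 !polyC0 addr0 in eg.
have [c1 [c2 [h1 h2]]] := chart_t0 R.
eexists; rewrite (_ : _ / _ = (((mchart R).1.1 - j (mchart R).2.1) / t0 R * mfun R g1 +
  ((mchart R).1.2 - j (mchart R).2.2) / t0 R * mfun R g2) / mfun R h).
  apply: hv_div h0 _ (hv_fun R h).
  by apply: hvD; apply: hvM; eauto using hv_fun.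
rewrite eg rmorphD !rmorphM !rmorphB /= mfunX mfunY !mfunC.
by field; rewrite t0_neq0 mfun_neq0.
Qed.

(** Order m at R, measured by the local parameter. *)
Definition isord (R : point E) (f : M) (m : int) :=
  exists2 c, c != 0 & hv R (f / t0 R ^ m) c.

Lemma t0X_neq0 R m : t0 R ^ m != 0.
Proof. by rewrite expfz_neq0 ?t0_neq0. Qed.
Lemma isordM R f g m n : isord R f m -> isord R g n -> isord R (f * g) (m + n).
Proof.
move=> [c c0 hc] [d d0 hd]; exists (c * d); first exact: mulf_neq0.
by rewrite expfzDr ?t0_neq0 // -mulf_div; exact: hvM.
Qed.
Lemma isordV R f m : isord R f m -> isord R f^-1 (- m).
Proof.
move=> [c c0 hc]; exists c^-1; first exact: invr_neq0.
by have := hvV c0 hc; rewrite invf_div -invr_expz invrK mulrC.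
Qed.
Lemma isord_div R f g m n : isord R f m -> isord R g n -> isord R (f / g) (m - n).
Proof. by move=> h /isordV; exact: isordM. Qed.
Lemma isord_unit R f c : c != 0 -> hv R f c -> isord R f 0.
Proof. by move=> c0 h; exists c => //; rewrite expr0z divr1. Qed.
Lemma isord_cst R c : c != 0 -> isord R (j c) 0.
Proof. by move=> c0; apply: isord_unit c0 (hv_cst R c). Qed.
Lemma isord1 R : isord R 1 0.
Proof. exact: isord_unit (oner_neq0 _) (hv1 R). Qed.
Lemma isord_t0 R : isord R (t0 R) 1.
Proof. by exists 1; rewrite ?oner_neq0 // expr1z divff ?t0_neq0 //; exact: hv1. Qed.
Lemma isordX R f m n : isord R f m -> isord R (f ^+ n) (m * n%:Z).
Proof.
move=> h; elim: n => [|n IH]; first by rewrite mulr0; exact: isord1.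
by rewrite exprS (_ : m * n.+1%:Z = m + m * n%:Z); [exact: isordM | lia].
Qed.
Lemma isord_neq0 R f m : isord R f m -> f != 0.
Proof. by move=> [c c0 /(hv_neq0 c0)]; rewrite mulf_eq0 negb_or => /andP[]. Qed.

Lemma isord_hv R f (m : nat) : isord R f m%:Z ->
  exists2 c, hv R f c & (m = 0%N -> c != 0) /\ ((0 < m)%N -> c = 0).
Proof.
move=> [c c0 h]; exists (c * 0 ^+ m).
  by rewrite -(divfK (t0X_neq0 R m%:Z) f); apply: hvM h _; exact/hvX/hv_t0.
by split=> [->|]; rewrite ?expr0 ?mulr1 //; case: m h => // m _ _; rewrite exprS mul0r mulr0.
Qed.
Lemma isord_ge0 R f m : 0 <= m -> isord R f m -> exists c, hv R f c.
Proof. by case: m => // m _ /isord_hv[c]; exists c. Qed.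
Lemma isord_gt0 R f m : 0 < m -> isord R f m -> hv R f 0.
Proof. by case: m => // m m0 /isord_hv[c h [_ <-]]. Qed.
Lemma isord_ord0 R f : isord R f 0 -> exists2 c, c != 0 & hv R f c.
Proof. by move=> /(@isord_hv _ _ 0)[c h [h' _]]; exists c => //; exact: h'. Qed.

Lemma isord_neg R f m c : m < 0 -> isord R f m -> ~ hv R f c.
Proof.
move=> m0 h hf; have m1 : 0 < - m by lia.
have := hvM hf (isord_gt0 m1 (isordV h)).
rewrite mulr0 divff ?(isord_neq0 h) // => /hv_uniq/(_ (hv1 R))/eqP.
by rewrite eq_sym oner_eq0.
Qed.

Lemma isord_uniq R f m n : isord R f m -> isord R f n -> m = n.
Proof.
move=> h h'; have f0 := isord_neq0 h.
have i1 := isord_div h h'; have i2 := isord_div h' h.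
rewrite divff // in i1 i2.
case: (ltgtP m n) => // mn; exfalso.
  by apply: (@isord_neg R 1 (m - n) 1) => //; [lia | exact: hv1].
by apply: (@isord_neg R 1 (n - m) 1) => //; [lia | exact: hv1].
Qed.
End Local.

(** * Comparison with the valuations of the function field *)

Section GenericLocal.
Variables (k : fieldType) (E : ecurve k) (M : ffmodel E).

Lemma hvXz R (f : M) c (m : int) : c != 0 -> hv R f c -> hv R (f ^ m) (c ^ m).
Proof.
move=> c0 h; case: m => n; first exact: hvX.
by rewrite !NegzE -!invr_expz; apply: hvV; rewrite ?expf_neq0 //; exact: hvX.
Qed.

Definition mregular (R : point E) (f : M) : Prop :=
  exists g h, mpt M R h != 0 /\ f = mfun M R g / mfun M R h.
Definition mvanishes (R : point E) (f : M) : Prop :=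
  exists g h, [/\ mpt M R h != 0, f = mfun M R g / mfun M R h & mpt M R g = 0].
Definition muniformizer (R : point E) (t : M) : Prop :=
  mvanishes R t /\
  forall f, mvanishes R f -> exists2 g, mregular R g & f = g * t.
Definition mord (R : point E) (f : M) (m : int) : Prop :=
  exists t u, [/\ muniformizer R t, u != 0, mregular R u, mregular R u^-1
                & f = u * t ^ m].

Lemma mregularE (R : point E) (f : M) : mregular R f <-> exists c, hv R f c.
Proof.
split=> [[g [h [h0 e]]]|[c [g [h [h0 e _]]]]]; first by eexists; exists g, h.
by exists g, h.
Qed.

Lemma mvanishesE (R : point E) (f : M) : mvanishes R f <-> hv R f 0.
Proof.
split=> [[g [h [h0 e g0]]]|[g [h [h0 e /esym/eqP]]]].
  by exists g, h; rewrite g0 mul0r.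
by rewrite mulf_eq0 invr_eq0 (negPf h0) orbF => /eqP g0; exists g, h.
Qed.

Lemma muniformizerE (R : point E) (t : M) : muniformizer R t <-> isord R t 1.
Proof.
split=> [[/mvanishesE vt ut]|[c c0]].
  have /ut[g /mregularE[d hd] e] : mvanishes R (t0 M R) by apply/mvanishesE; exact: hv_t0.
  have [c hc] := hv_div_t0 vt; exists c => //.
  have := t0_neq0 M R; rewrite e mulf_eq0 negb_or => /andP[g0 tn0].
  have := hvM hc hd; rewrite e.
  have -> : t / (g * t) * g = 1 by field; rewrite g0 tn0.
  move/hv_uniq/(_ (hv1 M R)) => cd; apply/eqP => c0; move/eqP: cd.
  by rewrite c0 mul0r eq_sym oner_eq0.
rewrite expr1z => hc; have vt : hv R t 0.
  rewrite -(divfK (t0_neq0 M R) t) -(mulr0 c).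
  exact: hvM hc (hv_t0 M R).
have tn0 : t != 0.
  by have := hv_neq0 c0 hc; rewrite mulf_eq0 negb_or => /andP[].
split; first exact/mvanishesE.
move=> f /mvanishesE vf; have [d hd] := hv_div_t0 vf.
exists (f / t); last by rewrite divfK.
apply/mregularE; exists (d / c).
have -> : f / t = (f / t0 M R) / (t / t0 M R).
  by rewrite invf_div mulrA divfK ?t0_neq0.
exact: hv_div.
Qed.

Lemma mordE (R : point E) (f : M) m : mord R f m <-> isord R f m.
Proof.
split=> [[t [u [/muniformizerE[c c0 hc] u0 /mregularE[a ha] /mregularE[b hb] ->]]]|[c c0 hc]].
  exists (a * c ^ m).
    rewrite mulf_neq0 ?expfz_neq0 //; apply/eqP => a0.
    have := hvM ha hb; rewrite mulfV // => /hv_uniq/(_ (hv1 M R))/eqP.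
    by rewrite a0 mul0r eq_sym oner_eq0.
  rewrite expr1z in hc; rewrite -mulrA; apply: (hvM ha).
  by have := hvXz m c0 hc; rewrite expfzMl exprz_inv invr_expz.
exists (t0 M R), (f / t0 M R ^ m); split.
- exact/muniformizerE/isord_t0.
- exact: hv_neq0 hc.
- by apply/mregularE; exists c.
- by apply/mregularE; exists c^-1; exact: hvV.
- by rewrite divfK // t0X_neq0.
Qed.
End GenericLocal.

Section Link.
Variables (k : fieldType) (E : ecurve k).
Local Notation M := (function_field E).

Lemma eval_ptE (R : point E) g : eval_pt R g = mpt M R g.
Proof. by rewrite mptE /eval_pt /chart /mchart; case: (val R). Qed.

Lemma eval_funE (R : point E) g : eval_fun R g = mfun M R g.
Proof. by rewrite /eval_fun /mfun /ev2 /chart /mchart; case: (val R) => [c|]; reflexivity. Qed.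

Lemma regular_mE (R : point E) (f : funfield E) : regular_at R f <-> mregular (M := M) R f.
Proof.
split=> [[g [h [h0 e]]]|[g [h [h0 e]]]]; exists g, h; split.
- by rewrite -eval_ptE.
- by rewrite -2!eval_funE; exact: e.
- by rewrite eval_ptE.
- by rewrite 2!eval_funE; exact: e.
Qed.

Lemma vanishes_mE (R : point E) (f : funfield E) : vanishes_at R f <-> mvanishes (M := M) R f.
Proof.
split=> [[g [h [h0 e g0]]]|[g [h [h0 e g0]]]]; exists g, h; split.
- by rewrite -eval_ptE.
- by rewrite -2!eval_funE; exact: e.
- by rewrite -eval_ptE.
- by rewrite eval_ptE.
- by rewrite 2!eval_funE; exact: e.
- by rewrite eval_ptE.
Qed.

Lemma uniformizer_mE (R : point E) (t : funfield E) :
  uniformizer R t <-> muniformizer (M := M) R t.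
Proof.
split=> -[/vanishes_mE vt ut]; split=> // f /vanishes_mE/ut[g /regular_mE rg e]; exists g.
- exact: rg.
- exact: e.
- exact: rg.
- exact: e.
Qed.

Lemma ord_atE (R : point E) (f : funfield E) m : ord_at R f m <-> isord (M := M) R f m.
Proof.
apply: iff_trans (mordE _ _ _).
split=> -[t [u [/uniformizer_mE ut u0 /regular_mE ru /regular_mE rv e]]]; exists t, u; split.
- exact: ut.
- exact: u0.
- exact: ru.
- exact: rv.
- exact: e.
- exact: ut.
- exact: u0.
- exact: ru.
- exact: rv.
- exact: e.
Qed.

End Link.

(** * The invariant derivation *)

Lemma deriv_wlin (k : fieldType) (E : ecurve k) : (wlin E)^`() = (a1 E)%:P.
Proof. by rewrite /wlin derivD derivM derivX !derivC mul0r add0r mulr1 addr0. Qed.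
Lemma deriv_wcub (k : fieldType) (E : ecurve k) :
  (wcub E)^`() = 3%:P * 'X^2 + (2 * a2 E)%:P * 'X + (a4 E)%:P.
Proof.
rewrite /wcub !derivD ![(_%:P * _)^`()]derivM !derivXn !derivC derivX /= polyCM.
by rewrite !polyC_natr; ring.
Qed.

Section Derivation.
Variables (k : fieldType) (E : ecurve k) (M : ffmodel E).
Local Notation j := (ff_cst M).
Local Notation x := (ff_x M).
Local Notation y := (ff_y M).
Local Notation l := (wlin E).
Local Notation c := (wcub E).
Local Notation px := (@px k E M).

Definition Dx : M := 2 * y + px l.
Definition Dy : M := px c^`() - px l^`() * y.

Lemma pxM A B : px (A * B) = px A * px B. Proof. exact: rmorphM. Qed.
Lemma pxD A B : px (A + B) = px A + px B. Proof. exact: rmorphD. Qed.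
Lemma pxB A B : px (A - B) = px A - px B. Proof. exact: rmorphB. Qed.

Definition dquo (A d : {poly k}) : M :=
  (px A^`() * px d - px A * px d^`()) / px d ^+ 2.
(** The derivative of (A + B y) / d by the quotient rule; it will turn out not to
    depend on the representation of the fraction. *)
Definition dformula (A B d : {poly k}) : M :=
  dquo A d * Dx + dquo B d * Dx * y + px B / px d * Dy.

Lemma dquo_uniq A d A' d' : d != 0 -> d' != 0 -> A * d' = A' * d -> dquo A d = dquo A' d'.
Proof.
rewrite -!(px_eq0 M) => d0 d0' e.
have e1 := congr1 px e; have e2 := congr1 (fun p => px p^`()) e.
rewrite !derivM !pxD !pxM in e1 e2.
apply/eqP; rewrite /dquo eqr_div ?expf_neq0 //; apply/eqP.
transitivity (px d * px d' * (px A^`() * px d' + px A * px d'^`())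
  - px d * px d'^`() * (px A * px d') - px d^`() * px d' * (px A * px d')); first by ring.
by rewrite e2 e1; ring.
Qed.

Lemma dformula_uniq A B d A' B' d' : d != 0 -> d' != 0 ->
  (px A + px B * y) / px d = (px A' + px B' * y) / px d' ->
  dformula A B d = dformula A' B' d'.
Proof.
move=> d0 d0' /eqP; rewrite eqr_div ?px_eq0 // => /eqP e.
have [eA eB] : A * d' = A' * d /\ B * d' = B' * d.
  by apply: (@px_inj _ _ M); rewrite !pxM -[LHS]addrC; move: e; rewrite !mulrDl => e;
     rewrite [LHS]addrC mulrAC e; ring.
rewrite /dformula (dquo_uniq d0 d0' eA) (dquo_uniq d0 d0' eB); congr (_ + _ * _).
by apply/eqP; rewrite eqr_div ?px_eq0 // -!pxM eB.
Qed.

Lemma derivation_ex : exists D : M -> M, forall A B d, d != 0 ->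
  D ((px A + px B * y) / px d) = dformula A B d.
Proof.
have h f : exists v, forall A B d, d != 0 -> f = (px A + px B * y) / px d -> v = dformula A B d.
  have [A [B [d [d0 e]]]] := px_gen f; exists (dformula A B d) => A' B' d' d0' e'.
  by apply: dformula_uniq => //; rewrite -e.
have [D hD] := choice h; exists D => A B d d0; exact: hD.
Qed.

(** The derivation D = (2 y + a1 x + a3) d/dx, dual to the invariant differential. *)
Definition D : M -> M := projT1 (cid derivation_ex).
Lemma DE A B d : d != 0 -> D ((px A + px B * y) / px d) = dformula A B d.
Proof. exact: (projT2 (cid derivation_ex)). Qed.

Lemma D_poly A B : D (px A + px B * y) = (px A^`() + px B^`() * y) * Dx + px B * Dy.
Proof.
have h := @DE A B 1 (oner_neq0 _); rewrite rmorph1 divr1 in h.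
by rewrite h /dformula /dquo rmorph1 derivC rmorph0 expr1n !divr1; ring.
Qed.

Lemma D_px A : D (px A) = px A^`() * Dx.
Proof. by have := D_poly A 0; rewrite deriv0 rmorph0 !mul0r !addr0. Qed.
Lemma D_cst a : D (j a) = 0.
Proof. by rewrite -pxC D_px derivC rmorph0 mul0r. Qed.
Lemma D_x : D x = Dx.
Proof. by rewrite -pxX D_px derivX rmorph1 mul1r. Qed.
Lemma D_y : D y = Dy.
Proof. by have := D_poly 0 1; rewrite deriv0 derivC rmorph0 rmorph1 !mul0r !add0r !mul1r !mul0r add0r. Qed.

Lemma DD f g : D (f + g) = D f + D g.
Proof.
have [A [B [d [d0 ->]]]] := px_gen f; have [A' [B' [d' [d0' ->]]]] := px_gen g.
have dd : d * d' != 0 by exact: mulf_neq0.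
have -> : (px A + px B * y) / px d + (px A' + px B' * y) / px d' =
  (px (A * d' + A' * d) + px (B * d' + B' * d) * y) / px (d * d').
  by rewrite !pxD !pxM; field; rewrite !px_eq0 d0 d0'.
rewrite !DE // /dformula /dquo !derivD !derivM !pxD !pxM.
by field; rewrite !px_eq0 d0 d0'.
Qed.

Lemma DM f g : D (f * g) = D f * g + f * D g.
Proof.
have [A [B [d [d0 ->]]]] := px_gen f; have [A' [B' [d' [d0' ->]]]] := px_gen g.
have dd : d * d' != 0 by exact: mulf_neq0.
rewrite mulf_div px_mul -pxM !DE // /dformula /dquo /Dx /Dy.
move: (y2E M); generalize c l => cc ll.
rewrite !(derivB, derivD, derivM) !(pxB, pxD, pxM).
have u0 : px d != 0 by rewrite px_eq0. have u0' : px d' != 0 by rewrite px_eq0.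
set b_ := px B^`(); set b'_ := px B'^`(); set l_ := px ll^`().
move=> e; have -> : px cc = y ^+ 2 + px ll * y by rewrite e; ring.
by field; rewrite u0 u0'.
Qed.

Lemma D1 : D 1 = 0. Proof. by rewrite -(rmorph1 j) D_cst. Qed.
Lemma DN f : D (- f) = - D f.
Proof. by rewrite -mulN1r DM -(rmorph1 j) -rmorphN D_cst mul0r add0r rmorphN rmorph1 mulN1r. Qed.
Lemma DB f g : D (f - g) = D f - D g. Proof. by rewrite DD DN. Qed.
Lemma DV f : f != 0 -> D f^-1 = - D f / f ^+ 2.
Proof.
move=> f0; have := D1; rewrite -(divff f0) DM => h.
apply: (mulfI f0); rewrite -[LHS]subr0 -h; field; exact: f0.
Qed.
Lemma D_div f g : g != 0 -> D (f / g) = (D f * g - f * D g) / g ^+ 2.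
Proof. by move=> g0; rewrite DM DV //; field. Qed.
Lemma DXn f n : D (f ^+ n) = n%:R * f ^+ n.-1 * D f.
Proof.
elim: n => [|n IH]; first by rewrite expr0 D1 !mul0r.
rewrite exprS DM IH /=; case: n {IH} => [|n]; first by rewrite !mul0r mulr0 addr0 expr0; ring.
by rewrite /= exprS [in RHS]mulrS; ring.
Qed.
Lemma DXz f (m : int) : f != 0 -> D (f ^ m) = m%:~R * f ^ (m - 1) * D f.
Proof.
move=> f0; case: m => n.
  case: n => [|n]; first by rewrite expr0z D1 !mul0r.
  by rewrite -exprnP DXn /= (_ : n.+1%:Z - 1 = n%:Z); last lia.
rewrite NegzE -invr_expz -exprnP DV ?expf_neq0 // DXn /=.
have -> : - n.+1%:Z - 1 = - (n.+2)%:Z by lia.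
rewrite -invr_expz -exprnP rmorphN /= -pmulrn !exprS.
by field; rewrite f0 expf_neq0.
Qed.

Lemma px_wlin : px l = j (a1 E) * x + j (a3 E). Proof. exact: ev1_wlin. Qed.
Lemma px_deriv_wlin : px l^`() = j (a1 E). Proof. by rewrite deriv_wlin pxC. Qed.
Lemma px_deriv_wcub : px c^`() = 3 * x ^+ 2 + 2 * j (a2 E) * x + j (a4 E).
Proof. by rewrite deriv_wcub !pxD !pxM !pxC !pxX rmorphM /= !rmorph_nat; ring. Qed.

Lemma D_z : D (x / y) = 2 + j (a1 E) * (x / y) + j (a3 E) * y^-1 - 3 * winf M
    - 2 * j (a2 E) * (x / y) ^+ 2 - j (a4 E) * (x / y) * y^-1 + j (a1 E) * (x / y).
Proof.
have y0 := y_neq0 M.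
by rewrite D_div // D_x D_y /Dx /Dy winfE px_wlin px_deriv_wlin px_deriv_wcub; field.
Qed.
Lemma D_w : D y^-1 = - (3 * (x / y) ^+ 2 + 2 * j (a2 E) * (x / y) * y^-1 + j (a4 E) * y^-1 ^+ 2
    - j (a1 E) * y^-1).
Proof.
have y0 := y_neq0 M.
by rewrite DV // D_y /Dy px_deriv_wlin px_deriv_wcub; field.
Qed.

Lemma hv_nat R n : hv R (n%:R : M) n%:R.
Proof. by have := hv_cst M R n%:R; rewrite rmorph_nat. Qed.

Lemma hv_Dx R a b : val R = Some (a, b) -> hv R (D x) (2 * b + a1 E * a + a3 E).
Proof.
move=> e; rewrite D_x /Dx px_wlin -addrA.
by do ![apply: hv_nat|apply: hv_cst|exact: hv_x e|exact: hv_y e|apply: hvD|apply: hvM].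
Qed.
Lemma hv_Dy R a b : val R = Some (a, b) ->
  hv R (D y) (3 * a ^+ 2 + 2 * a2 E * a + a4 E - a1 E * b).
Proof.
move=> e; rewrite D_y /Dy px_deriv_wlin px_deriv_wcub.
by do ![apply: hv_nat|apply: hv_cst|exact: hv_x e|exact: hv_y e|apply: hvX|apply: hvB|apply: hvD|apply: hvM].
Qed.
Lemma hv_Dz R : val R = None -> hv R (D (x / y)) (- 1).
Proof.
move=> e; rewrite D_z.
have -> : - 1 = 2 + a1 E * 0 + a3 E * 0 - 3 * 1 - 2 * a2 E * 0 ^+ 2 - a4 E * 0 * 0 + a1 E * 0 :> k.
  by ring.
by do ![apply: hv_nat|apply: hv_cst|exact: hv_z e|exact: hv_w e|exact: hv_winf e|apply: hvX|apply: hvB|apply: hvD|apply: hvM].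
Qed.

(** Near a point, both chart coordinates have regular derivatives. *)
Lemma hv_D_chart R : exists d1 d2,
  hv R (D (mchart M R).1.1) d1 /\ hv R (D (mchart M R).1.2) d2.
Proof.
rewrite /mchart; case e : (val R) => [[a b]|] /=.
  by do 2 eexists; split; [exact: hv_Dx e | exact: hv_Dy e].
exists (- 1); eexists; split; first exact: hv_Dz.
rewrite D_w; apply: hvN.
by do ![apply: hv_nat|apply: hv_cst|exact: hv_z e|exact: hv_w e|apply: hvX|apply: hvB|apply: hvD|apply: hvM].
Qed.

Lemma hv_Dfun R g : exists d, hv R (D (mfun M R g)) d.
Proof.
have [d1 [d2 [h1 h2]]] := hv_D_chart R.
elim/poly2_ind: g => [a|||g h [d hd] [d' hd']|g h [d hd] [d' hd']].
- by exists 0; rewrite mfunC D_cst; exact: hv0.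
- by exists d1; rewrite mfunX.
- by exists d2; rewrite mfunY.
- by exists (d + d'); rewrite rmorphD /= DD; exact: hvD.
- eexists; rewrite rmorphM /= DM.
  exact: hvD (hvM hd (hv_fun _ _ _)) (hvM (hv_fun _ _ _) hd').
Qed.

Lemma hv_D R f a : hv R f a -> exists d, hv R (D f) d.
Proof.
move=> [g [h [h0 -> _]]].
have [d hd] := hv_Dfun R g; have [d' hd'] := hv_Dfun R h.
eexists; rewrite D_div ?mfun_neq0 //.
apply: hv_div; last exact: hvX (hv_fun _ _ _).
  exact: expf_neq0.
exact: hvB (hvM hd (hv_fun _ _ _)) (hvM (hv_fun _ _ _) hd').
Qed.

Lemma hv_Dt0 R : exists2 d, d != 0 & hv R (D (t0 M R)) d.
Proof.
rewrite /t0; case e : (val R) => [[a b]|].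
  case: ifP => [/eqP h|/negbT h]; rewrite DB D_cst subr0.
    by eexists; [exact: smooth e h | exact: hv_Dy e].
  by eexists; [exact: h | exact: hv_Dx e].
by exists (- 1); [rewrite oppr_eq0 oner_eq0 | exact: hv_Dz].
Qed.

(** D preserves the local rings and takes local parameters to units, so that it
    lowers orders prime to the characteristic by one. *)
Lemma isord_D R f m : (m%:~R : k) != 0 -> isord R f m -> isord R (D f) (m - 1).
Proof.
move=> m0 [a a0 h]; have [d hd] := hv_D h; have [b b0 hb] := hv_Dt0 R.
have tn := t0_neq0 M R.
exists (0 * d + m%:~R * a * b).
  by rewrite mul0r add0r !mulf_neq0.
have -> : D f / t0 M R ^ (m - 1) = t0 M R * D (f / t0 M R ^ m) + j (m%:~R) * (f / t0 M R ^ m) * D (t0 M R).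
  rewrite D_div ?t0X_neq0 // DXz // rmorph_int.
  have -> : t0 M R ^ m = t0 M R ^ (m - 1) * t0 M R.
    by rewrite -[X in _ * X]expr1z -expfzDr // subrK.
  by field; rewrite tn t0X_neq0.
apply: hvD; first exact: hvM (hv_t0 M R) hd.
by apply: hvM => //; apply: hvM => //; exact: hv_cst.
Qed.

Lemma isord_dlog R f m : (m%:~R : k) != 0 -> isord R f m -> isord R (D f / f) (-1).
Proof.
by move=> m0 h; have := isord_div (isord_D m0 h) h; rewrite addrAC subrr sub0r.
Qed.
End Derivation.

(** * Divisors of lines *)

Section Divisors.
Variables (k : fieldType) (E : ecurve k) (M : ffmodel E).
Local Notation j := (ff_cst M).
Local Notation x := (ff_x M).
Local Notation y := (ff_y M).
Local Notation l := (wlin E).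
Local Notation c := (wcub E).
Local Notation px := (@px k E M).

(** The second coordinate of the opposite of (a, b). *)
Definition neg_y (a b : k) : k := - b - a1 E * a - a3 E.

Lemma on_curve_neg a b : on_curve E (Some (a, b)) -> on_curve E (Some (a, neg_y a b)).
Proof. by move=> /eqP e; apply/eqP; rewrite -e /neg_y; ring. Qed.

Lemma on_curve_fiber a b b' : on_curve E (Some (a, b)) -> on_curve E (Some (a, b')) ->
  b' = b \/ b' = neg_y a b.
Proof.
move=> /eqP e /eqP e'.
have /eqP : (b' - b) * (b' - neg_y a b) = 0.
  have -> : (b' - b) * (b' - neg_y a b) = (b' ^+ 2 + a1 E * a * b' + a3 E * b')
    - (b ^+ 2 + a1 E * a * b + a3 E * b) by rewrite /neg_y; ring.
  by rewrite e e' subrr.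
by rewrite mulf_eq0 !subr_eq0 => /orP[/eqP|/eqP]; [left | right].
Qed.

Lemma point_on (R : point E) a b : val R = Some (a, b) -> on_curve E (Some (a, b)).
Proof. by move=> <-; exact: (valP R). Qed.

Lemma isord_xc_tors R a b : val R = Some (a, b) -> 2 * b + a1 E * a + a3 E = 0 ->
  isord R (x - j a) 2.
Proof.
move=> e s; have n0 := smooth e s.
have t0E : t0 M R = y - j b by rewrite /t0 e s eqxx.
have ce := chord_eq M (valP_curve e); have hx := hv_xder M e; have hy := hv_y M e.
set q := (_ - j (a1 E) * j b) in ce hx.
have hq : hv R (q - j (a1 E) * (y - j b)) (3 * a ^+ 2 + 2 * a2 E * a + a4 E - a1 E * b).
  rewrite -[X in hv _ _ X]subr0 -(mulr0 (a1 E)) -(subrr b).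
  by do ![exact: hx|exact: hy|apply: hv_cst|apply: hvB|apply: hvM].
have e2 : (y - j b) ^+ 2 = (x - j a) * (q - j (a1 E) * (y - j b)).
  have s' : j 2 * j b + j (a1 E) * j a + j (a3 E) = 0.
    by move/(congr1 j): s; rewrite !(rmorphD, rmorphM) rmorph0.
  rewrite mulrBr -ce -[LHS]addr0; have -> : 0 = (y - j b) * (j 2 * j b + j (a1 E) * j a + j (a3 E)).
    by rewrite s' mulr0.
  by rewrite rmorph_nat; ring.
have yb0 := yc_neq0 M b.
exists (3 * a ^+ 2 + 2 * a2 E * a + a4 E - a1 E * b)^-1; first by rewrite invr_eq0.
rewrite t0E -exprnP e2.
rewrite invfM mulrA divff ?xc_neq0 // mul1r; exact: hvV.
Qed.

Lemma isord_xc_nontors R a b : val R = Some (a, b) -> 2 * b + a1 E * a + a3 E != 0 ->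
  isord R (x - j a) 1.
Proof.
move=> e s; have -> : x - j a = t0 M R by rewrite /t0 e (negPf s).
exact: isord_t0.
Qed.

Lemma isord_xc_ne R a a' b : val R = Some (a', b) -> a' != a -> isord R (x - j a) 0.
Proof.
move=> e ne; apply: (@isord_unit _ _ _ _ _ (a' - a)); first by rewrite subr_eq0.
exact: hvB (hv_x M e) (hv_cst M R a).
Qed.

Lemma t0_inf R : val R = None -> t0 M R = x / y.
Proof. by move=> e; rewrite /t0 e. Qed.

Lemma isord_xc_inf R a : val R = None -> isord R (x - j a) (-2).
Proof.
move=> e; exists 1; first exact: oner_neq0.
rewrite t0_inf // -invr_expz invrK -exprnP.
have -> : (x - j a) * (x / y) ^+ 2 = winf M - j a * (x / y) ^+ 2.
  by rewrite winfE; field; exact: y_neq0.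
have -> : 1 = 1 - a * 0 ^+ 2 :> k by ring.
exact: hvB (hv_winf M e) (hvM (hv_cst M R a) (hvX 2 (hv_z M e))).
Qed.

Lemma neg_y_eq a b : (neg_y a b == b) = (2 * b + a1 E * a + a3 E == 0).
Proof.
rewrite -subr_eq0 (_ : neg_y a b - b = - (2 * b + a1 E * a + a3 E)) ?oppr_eq0 //.
by rewrite /neg_y; ring.
Qed.

Lemma neg_yK a b : neg_y a (neg_y a b) = b.
Proof. by rewrite /neg_y; ring. Qed.

(** The multiplicity at R of the divisor (p). *)
Definition at_pt (p : option (k * k)) (R : point E) : int := (val R == p)%:Z.

Lemma isord_vertical R a b : on_curve E (Some (a, b)) ->
  isord R (x - j a)
    (at_pt (Some (a, b)) R + at_pt (Some (a, neg_y a b)) R - 2 * at_pt None R).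
Proof.
move=> oab; rewrite /at_pt; case e : (val R) => [[a' b']|] /=; last first.
  exact: (isord_xc_inf a e).
rewrite mulr0 subr0 !(inj_eq Some_inj) !xpair_eqE.
have [aa|ne] := eqVneq a' a; last by rewrite /= addr0; exact: isord_xc_ne e ne.
rewrite aa /= in e *; have h := on_curve_fiber oab (point_on e).
have [s0|s0] := eqVneq (2 * b' + a1 E * a + a3 E) 0.
  have nb : neg_y a b' = b' by apply/eqP; rewrite neg_y_eq s0.
  have bb : b' = b by case: h => // h; rewrite -nb h neg_yK.
  by rewrite -bb nb eqxx; exact: isord_xc_tors e s0.
have nb : neg_y a b' != b' by rewrite neg_y_eq.
suff -> : (b' == b)%:Z + (b' == neg_y a b)%:Z = 1 by exact: isord_xc_nontors e s0.
case: h => h; subst b'; rewrite eqxx; first by rewrite eq_sym (negPf nb).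
by move: nb; rewrite neg_yK => nb; rewrite eq_sym (negPf nb).
Qed.

(** At infinity the triple pole is that of y. At an affine point the order is read
    off the product of the line by its conjugate, (x - x1) (x - x2) (x - x3); both
    factors vanish only at the points where x - a is not a local parameter, and
    there each of them has order 1. *)
Lemma isord_line R la nu x1 x2 x3 :
  c - (la%:P * 'X + nu%:P) ^+ 2 - l * (la%:P * 'X + nu%:P)
    = ('X - x1%:P) * ('X - x2%:P) * ('X - x3%:P) ->
  isord R (y - j la * x - j nu)
    (at_pt (Some (x1, la * x1 + nu)) R + at_pt (Some (x2, la * x2 + nu)) R
     + at_pt (Some (x3, la * x3 + nu)) R - 3 * at_pt None R).
Proof.
move=> hN.
have N : (y - j la * x - j nu) * (y + j la * x + j nu + px l) =
    (x - j x1) * (x - j x2) * (x - j x3).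
  move/(congr1 px): hN (y2E M); generalize c l => cc ll.
  rewrite !(pxB, pxD) ![px (- _)]rmorphN /= ![px (_ ^+ _)]rmorphXn /= !(pxM, pxB, pxD, pxC, pxX) => <- e.
  have -> : px cc = y ^+ 2 + px ll * y by rewrite e; ring.
  by ring.
rewrite /at_pt; case e : (val R) => [[a b]|] /=; last first.
  suff : isord R (y - j la * x - j nu) (-3) by [].
  exists 1; first exact: oner_neq0.
  rewrite t0_inf // -invr_expz invrK -exprnP.
  have -> : (y - j la * x - j nu) * (x / y) ^+ 3 = winf M - j la * (x / y) * winf M - j nu * (x / y) ^+ 3.
    by rewrite winfE; field; exact: y_neq0.
  have -> : 1 = 1 - la * 0 * 1 - nu * 0 ^+ 3 :> k by ring.
  by do ![apply: hv_cst|exact: hv_z e|exact: hv_winf e|apply: hvX|apply: hvB|apply: hvM].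
rewrite mulr0 subr0 !(inj_eq Some_inj) !xpair_eqE.
have hl : hv R (y - j la * x - j nu) (b - la * a - nu).
  by do ![apply: hv_cst|exact: hv_x e|exact: hv_y e|apply: hvB|apply: hvM].
have cE u : (a == u) && (b == la * u + nu) = (a == u) && (b == la * a + nu).
  by have [->|] := eqVneq a u.
rewrite !cE.
have [on|off] := eqVneq b (la * a + nu); last first.
  rewrite !andbF; apply: isord_unit hl.
  by rewrite -addrA -opprD subr_eq0.
rewrite !andbT.
have oxc u : exists m : int, isord R (x - j u) ((a == u)%:Z * m) /\ 
    (2 * b + a1 E * a + a3 E == 0 -> m = 2) /\ (2 * b + a1 E * a + a3 E != 0 -> m = 1).
  have [s0|s0] := eqVneq (2 * b + a1 E * a + a3 E) 0.
    exists 2; split => //; have [<-|ne] := eqVneq a u; last by rewrite mul0r; exact: isord_xc_ne e ne.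
    by rewrite mul1r; exact: isord_xc_tors e s0.
  exists 1; split => //; have [<-|ne] := eqVneq a u; last by rewrite mul0r; exact: isord_xc_ne e ne.
  by rewrite mul1r; exact: isord_xc_nontors e s0.
have [m1 [o1 [t1 n1]]] := oxc x1; have [m2 [o2 [t2 n2]]] := oxc x2.
have [m3 [o3 [t3 n3]]] := oxc x3.
have oN := isordM (isordM o1 o2) o3; rewrite -N in oN.
have hc : hv R (y + j la * x + j nu + px l) (2 * b + a1 E * a + a3 E).
  rewrite px_wlin (_ : 2 * b + _ + _ = b + la * a + nu + (a1 E * a + a3 E)); last by rewrite on; ring.
  by do ![apply: hv_cst|exact: hv_x e|exact: hv_y e|apply: hvD|apply: hvM].
have [s0|s0] := eqVneq (2 * b + a1 E * a + a3 E) 0; last first.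
  have := isord_div oN (isord_unit s0 hc).
  rewrite mulfK; last exact: hv_neq0 s0 hc.
  by rewrite n1 // n2 // n3 // subr0 !mulr1.
have t0E : t0 M R = y - j b by rewrite /t0 e s0 eqxx.
have hd : hv R ((x - j a) / t0 M R) 0.
  have [d d0 h2] := isord_xc_tors e s0.
  have := hvM h2 (hv_t0 M R); rewrite mulr0 -exprnP.
  by congr (hv _ _ _); field; exact: t0_neq0.
have onM : j b = j la * j a + j nu by rewrite on rmorphD rmorphM.
have i1 : isord R (y - j la * x - j nu) 1.
  exists 1; first exact: oner_neq0.
  have -> : (y - j la * x - j nu) / t0 M R ^ 1 = 1 - j la * ((x - j a) / t0 M R).
    by rewrite expr1z t0E onM; field; rewrite -onM yc_neq0.
  rewrite -[X in hv _ _ X]subr0 -(mulr0 la).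
  exact: hvB (hv1 M R) (hvM (hv_cst M R la) hd).
have i2 : isord R (y + j la * x + j nu + px l) 1.
  exists 1; first exact: oner_neq0.
  have s' : j 2 * j b + j (a1 E) * j a + j (a3 E) = 0.
    by move/(congr1 j): s0; rewrite !(rmorphD, rmorphM) rmorph0.
  have -> : (y + j la * x + j nu + px l) / t0 M R ^ 1 = 1 + (j la + j (a1 E)) * ((x - j a) / t0 M R).
    have a3E : j (a3 E) = - (2 * (j la * j a + j nu) + j (a1 E) * j a).
      by rewrite -onM -[LHS]subr0 -s' rmorph_nat; ring.
    by rewrite expr1z t0E px_wlin a3E onM; field; rewrite -onM yc_neq0.
  rewrite -[X in hv _ _ X]addr0 -(mulr0 (la + a1 E)).
  by apply: hvD (hv1 M R) (hvM _ hd); exact: hvD (hv_cst _ _ _) (hv_cst _ _ _).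
have := isord_uniq oN (isordM i1 i2).
rewrite t1 ?s0 // t2 ?s0 // t3 ?s0 // -!mulrDl => h.
by have -> : (a == x1)%:Z + (a == x2)%:Z + (a == x3)%:Z = 1 by lia.
Qed.
End Divisors.

(** * The group law and divisors *)

Section GroupLaw.
Variables (k : fieldType) (E : ecurve k) (M : ffmodel E).
Local Notation j := (ff_cst M).
Local Notation x := (ff_x M).
Local Notation y := (ff_y M).
Local Notation l := (wlin E).
Local Notation c := (wcub E).

(** The choice of x3 makes the coefficients of X^2 agree, which leaves the two
    coefficients al and be to be shown to vanish. *)
Lemma intersection_poly (la nu x1 x2 : k) (x3 := la ^+ 2 + a1 E * la - a2 E - x1 - x2) :
  let al := a4 E - 2 * la * nu - a1 E * nu - a3 E * la - (x1 * x2 + x1 * x3 + x2 * x3) in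
  let be := a6 E - nu ^+ 2 - a3 E * nu + x1 * x2 * x3 in
  c - (la%:P * 'X + nu%:P) ^+ 2 - l * (la%:P * 'X + nu%:P)
    = ('X - x1%:P) * ('X - x2%:P) * ('X - x3%:P) + al%:P * 'X + be%:P.
Proof.
rewrite /= /x3 /wlin /wcub !(polyCD, polyCN, polyCM).
by rewrite ?polyC1; ring.
Qed.

Lemma add_pt_line (x1 y1 x2 y2 : k) :
  on_curve E (Some (x1, y1)) -> on_curve E (Some (x2, y2)) ->
  ~~ ((x1 == x2) && (y1 == - y2 - a1 E * x2 - a3 E)) ->
  exists la nu x3, [/\ y1 = la * x1 + nu, y2 = la * x2 + nu,
    c - (la%:P * 'X + nu%:P) ^+ 2 - l * (la%:P * 'X + nu%:P)
      = ('X - x1%:P) * ('X - x2%:P) * ('X - x3%:P) &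
    add_pt E (Some (x1, y1)) (Some (x2, y2)) = Some (x3, neg_y E x3 (la * x3 + nu))].
Proof.
move=> o1 o2 nneg; rewrite /add_pt (negPf nneg).
set la := if _ then _ else _; set x3 := _ - x1 - x2.
have hy2 : y2 = la * (x2 - x1) + y1.
  rewrite /la; case: eqVneq => [e|ne]; last by field; rewrite subr_eq0 eq_sym.
  rewrite e subrr mulr0 add0r; move: nneg; rewrite e eqxx /= => nneg.
  rewrite e in o1; have [//|h] := on_curve_fiber o1 o2.
  by move: nneg; rewrite h -/(neg_y E x2 _) neg_yK eqxx.
exists la, (y1 - la * x1), x3; split; [by ring | by rewrite {1}hy2; ring | | ].
  have /= := intersection_poly la (y1 - la * x1) x1 x2; rewrite -/x3.
  set al := (X in _ = _ + X%:P * _ + _); set be := (X in _ = _ + _ + X%:P) => ->.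
  move/eqP: (o1) => e1; move/eqP: (o2) => e2.
  have r1 : al * x1 + be = 0.
    transitivity ((x1 ^+ 3 + a2 E * x1 ^+ 2 + a4 E * x1 + a6 E) -
      (y1 ^+ 2 + a1 E * x1 * y1 + a3 E * y1)); last by rewrite e1 subrr.
    by rewrite /al /be /x3; ring.
  have al0 : al = 0.
    have [ex|ne] := eqVneq x1 x2; last first.
      have r2 : al * x2 + be = 0.
        transitivity ((x2 ^+ 3 + a2 E * x2 ^+ 2 + a4 E * x2 + a6 E) -
          (y2 ^+ 2 + a1 E * x2 * y2 + a3 E * y2)); last by rewrite e2 subrr.
        by rewrite hy2 /al /be /x3; ring.
      have /eqP : al * (x1 - x2) = 0.
        by rewrite -[RHS](subrr 0) -{1}r1 -r2; ring.
      by rewrite mulf_eq0 => /orP[/eqP //|]; rewrite subr_eq0 (negPf ne).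
    have den : 2 * y1 + a1 E * x1 + a3 E != 0.
      rewrite -neg_y_eq; move: nneg; rewrite ex eqxx /=.
      have -> : y2 = y1 by rewrite hy2 ex subrr mulr0 add0r.
      by rewrite -/(neg_y E x2 y1) -ex eq_sym.
    have laE : la * (2 * y1 + a1 E * x1 + a3 E) =
      3 * x1 ^+ 2 + 2 * a2 E * x1 + a4 E - a1 E * y1.
      by rewrite /la ex eqxx -ex divfK.
    transitivity (3 * x1 ^+ 2 + 2 * a2 E * x1 + a4 E - a1 E * y1 -
      la * (2 * y1 + a1 E * x1 + a3 E)); last by rewrite laE subrr.
    by rewrite /al /x3 -ex; ring.
  by move: r1; rewrite al0 mul0r add0r => ->; rewrite !polyC0 mul0r !addr0.
by rewrite /neg_y; congr (Some (_, _)); ring.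
Qed.

Lemma on_curve_line la nu x1 x2 x3 :
  c - (la%:P * 'X + nu%:P) ^+ 2 - l * (la%:P * 'X + nu%:P)
      = ('X - x1%:P) * ('X - x2%:P) * ('X - x3%:P) -> on_curve E (Some (x3, la * x3 + nu)).
Proof.
move/(congr1 (fun p => p.[x3])).
rewrite !(hornerD, hornerN, hornerM, horner_exp, hornerX, hornerC) subrr mulr0 => h.
rewrite /on_curve -subr_eq0 -oppr_eq0; apply/eqP; rewrite -h; ring.
Qed.

(** The divisors (P1) + (P2) and (P1 + P2) + (O) are linearly equivalent, by the
    quotient of the chord by a vertical line: the chord-and-tangent law computes
    in the divisor class group. *)
Lemma add_pt_div (P1 P2 : option (k * k)) : on_curve E P1 -> on_curve E P2 ->
  on_curve E (add_pt E P1 P2) /\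
  exists f : M, forall R,
    isord R f (at_pt P1 R + at_pt P2 R - at_pt (add_pt E P1 P2) R - at_pt None R).
Proof.
case: P1 => [[x1 y1]|] o1; last first.
  case: P2 => [P2|] o2; split=> //; exists 1 => R;
    rewrite (_ : _ - _ - _ = 0) /=; try exact: isord1; lia.
case: P2 => [[x2 y2]|] o2; last first.
  by split=> //; exists 1 => R; rewrite /= (_ : _ - _ - _ = 0); [exact: isord1 | lia].
have [/andP[/eqP ex /eqP ey]|nneg] := boolP ((x1 == x2) && (y1 == - y2 - a1 E * x2 - a3 E)).
  have -> : add_pt E (Some (x1, y1)) (Some (x2, y2)) = None by rewrite /add_pt ex ey !eqxx.
  split=> //; exists (x - j x2) => R; have := isord_vertical M R o2.
  rewrite -/(neg_y E x2 y2) in ey; rewrite ex ey.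
  by congr isord; lia.
have [la [nu [x3 [e1 e2 N ->]]]] := add_pt_line o1 o2 nneg.
have o3 := on_curve_line N; split; first exact: on_curve_neg.
exists ((y - j la * x - j nu) / (x - j x3)) => R.
have := isord_div (isord_line M R N) (isord_vertical M R o3).
by rewrite -e1 -e2; congr isord; ring.
Qed.

Lemma mul_pt_div (P : option (k * k)) n : on_curve E P ->
  on_curve E (mul_pt E n P) /\
  exists f : M, forall R,
    isord R f (n%:Z * (at_pt P R - at_pt None R) - (at_pt (mul_pt E n P) R - at_pt None R)).
Proof.
move=> oP; elim: n => [|n [on [f hf]]].
  by split=> //; exists 1 => R; rewrite (_ : _ - _ = 0); [exact: isord1 | rewrite /mul_pt /=; lia].
rewrite /mul_pt iterS -/(mul_pt E n P).
have [oS [g hg]] := add_pt_div oP on; split=> //; exists (f * g) => R.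
by have := isordM (hf R) (hg R); congr isord; lia.
Qed.
End GroupLaw.

(** * Functions with few poles *)

Definition mk_point (k : fieldType) (E : ecurve k) P (o : on_curve E P) : point E :=
  exist (fun P => is_true (on_curve E P)) P o.

Section Infinity.
Variables (k : fieldType) (E : ecurve k) (M : ffmodel E).
Local Notation j := (ff_cst M).
Local Notation x := (ff_x M).
Local Notation y := (ff_y M).
Local Notation l := (wlin E).
Local Notation c := (wcub E).
Local Notation px := (@px k E M).

Lemma wle_wnorm A B m : wle (px A + px B * y) m -> (size (wnorm l c A B) <= m.+1)%N.
Proof.
move=> [A' [B' [e hA hB]]]; have [-> ->] := px_inj e.
exact: size_wnorm_le (size_wlin E) (size_wcub E) _ _ _ hA hB.
Qed.
Lemma wnorm_wle A B m : (size (wnorm l c A B) <= m.+1)%N -> wle (px A + px B * y) m.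
Proof.
by move=> /(size_wnorm_ge (size_wlin E) (size_wcub E))[hA hB]; exists A, B.
Qed.

(** Written as a quotient of functions of the chart at infinity, f / x bounds the
    weight of f, on comparing the degrees of the norms. *)
Lemma poly_pole2 R A B v : val R = None -> hv R ((px A + px B * y) / x) v ->
  (size A <= 2)%N /\ B = 0.
Proof.
move=> e [g [h [h0 efg _]]]; have fh0 := mfun_neq0 h0.
have mf f : mfun M R f = ev2 j (x / y) y^-1 f by rewrite /mfun /mchart e.
have mp f : mpt M R f = f.[0, 0] by rewrite mptE /mchart e.
have [[N hN] _] := inf_ev2 M g; have [_ [P hP]] := inf_ev2 M h.
rewrite -mf in hN; rewrite -mf -mp in hP.
set a := mpt M R h in h0 hP; set G := mfun M R g in efg hN; set H := mfun M R h in efg hP fh0.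
pose T := (N + P.+1)%N.
have efH : (px A + px B * y) * (y ^+ T * H) = x * (y ^+ T * G).
  have x0 := x_neq0 M.
  have -> : px A + px B * y = x * (G / H) by rewrite -efg; field.
  by field.
have wH : wle (y ^+ T * (H - j a)) (3 * T - 1).
  by rewrite /T exprD -mulrA; apply: wle_leq (wle_expyM N hP); rewrite /T; lia.
have wT : wle (y ^+ T * j a) (3 * T).
  by apply: wle_leq (wleM (wle_exp T (wle_y M)) (wle_cst M a)); lia.
have [U [V [eU _ _]]] : wle (y ^+ T * H) (3 * T).
  rewrite -[H](subrK (j a)) mulrDr; apply: wleD => //.
  by apply: wle_leq wH; lia.
have sU : (3 * T < size (wnorm l c U V))%N.
  rewrite ltnNge; apply/negP => sU.
  have : wle (px U + px V * y) (3 * T - 1) by apply: wnorm_wle; rewrite /T in sU *; lia.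
  rewrite -eU => w; have := wle_expy_ge (M := M) (a := - a) (N := T) (m := 3 * T - 1).
  rewrite oppr_eq0 h0 => /(_ isT).
  have -> : j (- a) * y ^+ T = y ^+ T * (H - j a) + (- 1) * (y ^+ T * H) by rewrite rmorphN; ring.
  suff w' : wle (-1 * (y ^+ T * H)) (3 * T - 1) by move/(_ (wleD wH w')); rewrite /T; lia.
  rewrite -(rmorph1 j) -rmorphN -[(3 * T - 1)%N]add0n; apply: wleM => //; exact: wle_cst.
have : wle (x * (y ^+ T * G)) (3 * T + 2).
  rewrite mulrC; apply: wleM; last exact: wle_x.
  by rewrite /T addnC exprD -mulrA; apply: wle_leq (wle_expyM P.+1 hN); lia.
rewrite -efH eU px_mul => /wle_wnorm; rewrite wnormM => sN.
have s3 : (size (wnorm l c A B) <= 3)%N.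
  have [->|n0] := eqVneq (wnorm l c A B) 0; first by rewrite size_poly0.
  have n1 : wnorm l c U V != 0 by rewrite -size_poly_gt0; move: sU; size_lia.
  by move: sN; rewrite size_mul // => sN; move: sU sN; rewrite /T; size_lia.
have [hA hB] := size_wnorm_ge (size_wlin E) (size_wcub E) s3.
split; first by size_lia.
by apply/eqP; rewrite -size_poly_eq0; size_lia.
Qed.
End Infinity.

Section Global.
Variables (k : closedFieldType) (E : ecurve k) (M : ffmodel E).
Local Notation j := (ff_cst M).
Local Notation x := (ff_x M).
Local Notation y := (ff_y M).
Local Notation l := (wlin E).
Local Notation c := (wcub E).
Local Notation px := (@px k E M).

Lemma point_above (a : k) : exists b, on_curve E (Some (a, b)).
Proof.
have [b hb] : exists b, root ('X^2 + l.[a] *: 'X - (c.[a])%:P) b.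
  apply/closed_rootP; rewrite -addrA size_polyDl size_polyXn //.
  rewrite (leq_ltn_trans (size_polyD _ _)) // gtn_max size_polyN.
  rewrite (leq_ltn_trans (size_scale_leq _ _)) ?size_polyX //=.
  by rewrite (leq_ltn_trans (size_polyC_leq1 _)).
exists b; move: hb; rewrite /root /wlin /wcub /on_curve.
rewrite !(hornerD, hornerN, hornerZ, hornerXn, hornerMX, hornerCM, hornerX, hornerC) => /eqP h.
by rewrite -subr_eq0 -h; apply/eqP; ring.
Qed.

Lemma hv_px R a b A : val R = Some (a, b) -> hv R (px A) A.[a].
Proof.
move=> e; have := hv_ev2 A%:P (hv_y M e) (hv_x M e).
by rewrite /ev2 map_polyC /= !hornerC.
Qed.

(** By descent on the degree of the denominator: a root a of it is also a root of
    the numerators A and B, since the function has values at the points above a. *)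
Lemma affine_regular_poly (f : M) :
  (forall R : point E, val R != None -> exists v, hv R f v) -> exists A B, f = px A + px B * y.
Proof.
move=> reg; have [A [B [d [d0 e]]]] := px_gen f.
move: {2}(size d) (leqnn (size d)) => n; elim: n A B d d0 e => [|n IH] A B d d0 e.
  by rewrite leqn0 size_poly_eq0 (negPf d0).
move=> sd; have [s1|s1] := eqVneq (size d) 1.
  have /size_poly1P[u u0 du] : size d == 1 by rewrite s1.
  exists (u^-1 *: A), (u^-1 *: B); rewrite e du -!mul_polyC !pxM !pxC fmorphV.
  by field; rewrite fmorph_eq0.
have [a /factor_theorem[d1 ed]] : exists a, root d a by apply/closed_rootP.
have d10 : d1 != 0 by apply: contraNneq d0 => z; rewrite ed z mul0r.
have px0 : px d1 != 0 by rewrite px_eq0.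
have xa0 := xc_neq0 M a.
have pd : px d = px d1 * (x - j a) by rewrite ed pxM pxB pxC pxX.
pose h := f * px d1.
have hE : h * (x - j a) = px A + px B * y by rewrite /h e pd; field; rewrite px0 xa0.
have regh (R : point E) : val R != None -> exists v, hv R h v.
  move=> nR; have [v hv1] := reg R nR; case eR : (val R) nR => [[u w]|] // _.
  by exists (v * d1.[u]); exact: hvM hv1 (hv_px d1 eR).
have zero (b : k) : on_curve E (Some (a, b)) -> A.[a] + B.[a] * b = 0.
  move=> ob; pose R := mk_point ob; have eR : val R = Some (a, b) by [].
  have [v hh] : exists v, hv R h v by exact: regh.
  have h1 := hvM hh (hvB (hv_x M eR) (hv_cst M R a)); rewrite hE subrr mulr0 in h1.
  exact: hv_uniq (hvD (hv_px A eR) (hvM (hv_px B eR) (hv_y M eR))) h1.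
have [b ob] := point_above a.
have Ba : B.[a] = 0.
  have [s0|s0] := eqVneq (2 * b + a1 E * a + a3 E) 0; last first.
    have /eqP : B.[a] * (neg_y E a b - b) = 0.
      by rewrite -[RHS](subrr 0) -{1}(zero _ (on_curve_neg ob)) -(zero _ ob); ring.
    by rewrite mulf_eq0 subr_eq0 neg_y_eq (negPf s0) orbF => /eqP.
  pose R := mk_point ob; have eR : val R = Some (a, b) by [].
  have [v hh] : exists v, hv R h v by exact: regh.
  apply/eqP; apply: contraT => Bn0.
  have /factor_theorem[A2 eA] : root (A - A.[a]%:P) a by rewrite /root !hornerE subrr.
  have /factor_theorem[B2 eB] : root (B - B.[a]%:P) a by rewrite /root !hornerE subrr.
  have E1 : j B.[a] * (y - j b) / (x - j a) = h - (px A2 + px B2 * y).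
    apply: (mulIf xa0); rewrite divfK // mulrBl hE.
    have := congr1 px eA; have := congr1 px eB; rewrite !pxB !pxM !pxB !pxC !pxX => eB' eA'.
    have zM : j A.[a] + j B.[a] * j b = 0 by rewrite -rmorphM -rmorphD zero ?rmorph0.
    rewrite -[px A](subrK (j A.[a])) -[px B](subrK (j B.[a])) eA' eB' -[LHS]addr0 -zM; ring.
  have yb : isord R (y - j b) 1.
    have <- : t0 M R = y - j b by rewrite /t0 /= s0 eqxx.
    exact: isord_t0.
  have := isord_div (isordM (isord_cst M R Bn0) yb) (isord_xc_tors M eR s0).
  rewrite E1 => o1; exfalso; have hg := hvB hh (hvD (hv_px A2 eR) (hvM (hv_px B2 eR) (hv_y M eR))).
  by have := isord_neg _ o1 hg; apply.
have Aa : A.[a] = 0 by have := zero b ob; rewrite Ba mul0r addr0.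
have /factor_theorem[A1 eA] : root A a by rewrite /root Aa.
have /factor_theorem[B1 eB] : root B a by rewrite /root Ba.
apply: (IH A1 B1 d1 d10).
  rewrite e pd eA eB !pxM !pxB !pxC pxX; field; exact/andP.
have : size d = (size d1).+1 by rewrite ed size_Mmonic ?monicXsubC // size_XsubC addn2.
by move: sd => /[swap] ->.
Qed.
End Global.

Section Constants.
Variables (k : closedFieldType) (E : ecurve k) (M : ffmodel E).
Local Notation j := (ff_cst M).
Local Notation x := (ff_x M).
Local Notation y := (ff_y M).
Local Notation px := (@px k E M).

Lemma poly_size2 (A : {poly k}) : (size A <= 2)%N ->
  exists u v, A = u%:P * 'X + v%:P.
Proof.
move=> sA; exists A`_1, A`_0; apply/polyP => -[|[|i]].
- by rewrite coefD coefMX !coefC /= add0r.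
- by rewrite coefD coefMX !coefC /= addr0.
- by rewrite coefD coefMX !coefC /= addr0 nth_default // (leq_trans sA).
Qed.

(** With an affine pole (a, b), the product of the function by x - a is a
    polynomial of weight at most 2, that is of degree at most 1 in x, and it
    vanishes at a: at the point opposite to the pole or, if this is the pole,
    because x - a has a double zero there. Hence it is a multiple of x - a. *)
Lemma single_pole (P : point E) (f : M) :
  (forall R, R != P -> exists v, hv R f v) -> (exists v, hv P (f * t0 M P) v) ->
  exists a, f = j a.
Proof.
move=> reg [v hP]; case eP : (val P) => [[a b]|].
  have ob := point_on eP.
  have xa0 := xc_neq0 M a.
  have tx : hv P ((x - j a) : M) 0 by rewrite -(subrr a); exact: hvB (hv_x M eP) (hv_cst M P a).
  have [w hw] := hv_div_t0 tx.
  have gP : hv P (f * (x - j a)) (v * w).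
    by have := hvM hP hw; congr (hv _ _ _); field; exact: t0_neq0.
  have [A [B gE]] : exists A B, f * (x - j a) = px A + px B * y.
    apply: affine_regular_poly => R nR; have [->|ne] := eqVneq R P; first by exists (v * w).
    have [u hu] := reg R ne; case eR : (val R) nR => [[a' b']|] // _.
    by exists (u * (a' - a)); exact: hvM hu (hvB (hv_x M eR) (hv_cst M R a)).
  have [sA B0] : (size A <= 2)%N /\ B = 0.
    have n0 : zero_point != P by apply/eqP => h; move: eP; rewrite -h.
    have [u hu] := reg _ n0.
    have e0 : val (zero_point : point E) = None by [].
    have o := isord_div (isord_xc_inf M a e0) (isord_xc_inf M 0 e0).
    rewrite rmorph0 subr0 subrr in o; have [d _ hd] := isord_ord0 o.
    apply: (@poly_pole2 _ _ M zero_point A B (u * d) e0); rewrite -gE -mulrA.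
    exact: hvM.
  have A0 : A.[a] = 0.
    have h0 (R : point E) b' : val R = Some (a, b') -> hv R (f * (x - j a)) 0 -> A.[a] = 0.
      by move=> eR; rewrite gE B0 rmorph0 mul0r addr0; apply: hv_uniq; exact: hv_px eR.
    have [s0|s0] := eqVneq (2 * b + a1 E * a + a3 E) 0.
      apply: (h0 P b eP); have o := isord_div (isord_xc_tors M eP s0) (isord_t0 M P).
      have := hvM hP (isord_gt0 _ o); rewrite mulr0 => /(_ isT).
      by congr (hv _ _ _); field; exact: t0_neq0.
    pose R := mk_point (on_curve_neg ob); have eR : val R = Some (a, neg_y E a b) by [].
    have ne : R != P.
      apply/eqP => h; move: eR; rewrite h eP => -[/esym/eqP].
      by rewrite neg_y_eq (negPf s0).
    have [u hu] := reg R ne; apply: (h0 R _ eR).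
    have := hvM hu (hvB (hv_x M eR) (hv_cst M R a)); by rewrite subrr mulr0.
  have [u [w' eA]] := poly_size2 sA.
  exists u; apply: (mulIf xa0); rewrite gE B0 rmorph0 mul0r addr0.
  move: A0; rewrite eA hornerD hornerMX !hornerC => /eqP; rewrite addrC addr_eq0 => /eqP ->.
  by rewrite pxD pxM !pxC pxX rmorphN rmorphM; ring.
have P0 : P = zero_point by apply: val_inj; rewrite eP.
subst P.
have [A [B fE]] : exists A B, f = px A + px B * y.
  by apply: affine_regular_poly => R nR; apply: reg; apply: contraNneq nR => ->.
have x0 := x_neq0 M; have y0 := y_neq0 M.
have [sA B0] : (size A <= 2)%N /\ B = 0.
  have hu : hv zero_point (x / y / winf M) (0 / 1).
    by apply: hv_div (hv_winf M eP); [exact: oner_neq0 | exact: hv_z].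
  apply: (@poly_pole2 _ _ M zero_point A B (v * (0 / 1)) eP).
  rewrite -fE; have := hvM hP hu; congr (hv _ _ _).
  by rewrite winfE t0_inf //; field; rewrite x0 y0.
have [u [w eA]] := poly_size2 sA; move: fE; rewrite B0 rmorph0 mul0r addr0 eA.
rewrite pxD pxM !pxC pxX => fE.
have [u0|u0] := eqVneq u 0; first by exists w; rewrite fE u0 rmorph0 mul0r add0r.
exfalso; have o := isordM (isordM (isord_cst M zero_point u0)
   (isord_xc_inf M (- (w / u)) eP)) (isord_t0 M zero_point).
apply: (isord_neg _ o (c := v)) => //.
move: hP; rewrite fE; congr (hv _ (_ * _) _).
by rewrite rmorphN fmorph_div; field; rewrite fmorph_eq0.
Qed.

Lemma regular_cst (f : M) : (forall R, exists v, hv R f v) -> exists a, f = j a.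
Proof.
move=> reg; apply: (@single_pole zero_point) => [R _|]; first exact: reg.
by have [v hv1] := reg zero_point; exists (v * 0); exact: hvM hv1 (hv_t0 _ _).
Qed.
End Constants.

(** * The divisors of a Lamé curve *)

Section LameDivisors.
Variables (k : closedFieldType) (E : ecurve k) (M : ffmodel E).
Local Notation j := (ff_cst M).
Local Notation D := (@D k E M).

Variables (P Q : point E) (n : nat).
Hypotheses (P0 : P != zero_point) (Q0 : Q != zero_point) (QP : Q != P).
Hypotheses (n0 : n%:R != 0 :> k) (three0 : 3 != 0 :> k).
Variables (F G g : M).
Local Notation at_ R := (at_pt (val R)).
Local Notation O := (zero_point : point E).
Local Notation S := (add_pt E (val Q) (val Q)).
Hypothesis divF : forall R, isord R F (n%:Z * (at_ P R - at_ O R)).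
Hypothesis ramQ : exists a, isord Q (F - j a) 3.
Hypothesis divG : forall R, isord R G (n%:Z * (at_ Q R - at_ O R)).
Hypothesis divg : forall R, isord R g (2 * at_ Q R - at_pt S R - at_ O R).

Lemma at_ptxx (R : point E) : at_ R R = 1. Proof. by rewrite /at_pt eqxx. Qed.
Lemma at_pt_ne (R R' : point E) : R' != R -> at_ R R' = 0.
Proof. by rewrite /at_pt (inj_eq val_inj) => /negPf->. Qed.
Lemma at_pt_ge0 p (R : point E) : 0 <= at_pt p R. Proof. by []. Qed.

Lemma dlog_F_regular R : R != P -> exists v, hv R (D F / (F * g)) v.
Proof.
move=> RP; have nz : (- (n%:Z))%:~R != 0 :> k by rewrite mulrNz oppr_eq0 -pmulrn.
have gR := divg R; have FR := divF R.
rewrite (at_pt_ne RP) in FR.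
have -> : D F / (F * g) = D F / F / g by rewrite invfM mulrA.
have [RO|RO] := eqVneq R O.
  subst R; rewrite at_ptxx (at_pt_ne (R := Q)) 1?eq_sym // in gR FR.
  have o : isord O F (- n%:Z) by move: FR; congr isord; lia.
  have := isord_div (isord_dlog nz o) gR; apply: isord_ge0.
  by have := at_pt_ge0 S O; lia.
rewrite (at_pt_ne RO) in gR FR.
rewrite subrr mulr0 in FR; rewrite subr0 in gR.
have [RQ|RQ] := eqVneq R Q.
  subst R; have [a oa] := ramQ; rewrite at_ptxx in gR.
  have := isord_D (m := 3) _ oa; rewrite DB D_cst subr0 => /(_ three0) oD.
  have := isord_div (isord_div oD FR) gR; apply: isord_ge0.
  by have := at_pt_ge0 S Q; lia.
rewrite (at_pt_ne RQ) mulr0 sub0r in gR.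
have [u _ hF] := isord_ord0 FR; have [d hd] := hv_D hF.
have [w hw] : exists w, hv R (F^-1 * g^-1) w.
  by apply: isord_ge0 (isordM (isordV FR) (isordV gR)); have := at_pt_ge0 S R; lia.
by exists (d * w); rewrite -mulrA; exact: hvM hd hw.
Qed.

(** The quotient of dF/(F omega) by g has at most a simple pole at P, so that it is
    constant. Were 2 Q different from P, this pole would be there. *)
Lemma dlog_F : S = val P /\ exists2 a, a != 0 & D F = j a * g * F.
Proof.
have nz : (n%:Z)%:~R != 0 :> k by rewrite -pmulrn.
have oF : isord P F n%:Z.
  by have := divF P; rewrite at_ptxx at_pt_ne //; congr isord; lia.
have oh : isord P (D F / (F * g)) (-1 + at_pt S P).
  have := isord_div (isord_dlog nz oF) (divg P).
  rewrite (at_pt_ne (R := Q)) 1?eq_sym // (at_pt_ne P0) invfM mulrA.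
  by congr isord; lia.
have [a ha] : exists a, D F / (F * g) = j a.
  apply: (@single_pole _ _ _ P); first exact: dlog_F_regular.
  have := isordM oh (isord_t0 M P); apply: isord_ge0.
  by have := at_pt_ge0 S P; lia.
have SP : S = val P.
  apply/eqP; apply: contraT => ne; exfalso.
  rewrite /at_pt eq_sym (negPf ne) addr0 ha in oh.
  exact: isord_neg _ oh (hv_cst M P a).
split=> //; exists a.
  by have := isord_neq0 oh; rewrite ha fmorph_eq0.
have F0 := isord_neq0 oF; have g0 := isord_neq0 (divg P).
by rewrite -ha; field; rewrite F0 g0.
Qed.

(** F and G^2 / g^n have the same divisor, as P = 2 Q. *)
Lemma F_eq : exists2 a, a != 0 & F = j a * G ^+ 2 / g ^+ n.
Proof.
have [SP _] := dlog_F.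
have o R : isord R (F * g ^+ n / G ^+ 2) 0.
  have := isord_div (isordM (divF R) (isordX n (divg R))) (isordX 2 (divG R)).
  by rewrite SP; congr isord; lia.
have [a ha] : exists a, F * g ^+ n / G ^+ 2 = j a.
  by apply: regular_cst => R; apply: isord_ge0 (o R).
have G0 := isord_neq0 (divG P); have g0 := isord_neq0 (divg P).
exists a; first by have := isord_neq0 (o P); rewrite ha fmorph_eq0.
by rewrite -ha; field; rewrite G0 expf_neq0.
Qed.

Lemma dlog_G : exists a, 2 * (D G / G) = j a * g + n%:R * (D g / g).
Proof.
have [_ [a a0 DF]] := dlog_F; have [b b0 eF] := F_eq; exists a.
have G0 := isord_neq0 (divG P); have g0 := isord_neq0 (divg P).
have F0 := isord_neq0 (divF P).
have -> : j a * g = D F / F by rewrite DF mulfK.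
have eF' : F * g ^+ n = j b * G ^+ 2 by rewrite eF; field; rewrite expf_neq0.
have := congr1 D eF'; rewrite !DM DXn D_cst mul0r add0r => h.
have e : D F / F = 2 * (D G / G) - n%:R * (D g / g); last by rewrite e; ring.
have gn0 : g ^+ n != 0 by rewrite expf_neq0.
apply: (mulIf F0); apply: (mulIf gn0); rewrite divfK //.
have -> : D F * g ^+ n = j b * (D G * G + G * D G) - F * (n%:R * g ^+ n.-1 * D g) by rewrite -h; ring.
have n_gt0 : (0 < n)%N by case: (n) n0 => //; rewrite eqxx.
rewrite mulrBl mulrBl -[X in _ = X - _]mulrA eF'.
have -> : n%:R * (D g / g) * F * g ^+ n = F * (n%:R * g ^+ n.-1 * D g).
  by rewrite -{2}(prednK n_gt0) exprS; field.
by congr (_ - _); field.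
Qed.

(** As n Q = O with n = 2 m - 1 and P = 2 Q, the point Q is m P. *)
Lemma Q_multiple m : n.+1 = (2 * m)%N -> val Q = mul_pt E m (val P).
Proof.
move=> nm; have [SP _] := dlog_F.
have [oT [f hf]] := mul_pt_div M m (valP P).
set T := mk_point oT; have vT : val T = mul_pt E m (val P) by [].
have oh R : isord R (f * g ^+ m / G) (at_ Q R - at_ T R).
  have := isord_div (isordM (hf R) (isordX m (divg R))) (divG R).
  rewrite SP -vT; congr isord.
  have -> : n%:Z = 2 * m%:Z - 1 by lia.
  by rewrite /= ; ring.
have [<-//|TQ] := eqVneq T Q.
have [a ha] : exists a, f * g ^+ m / G = j a.
  apply: (@single_pole _ _ _ T) => [R RT|].
    apply: isord_ge0 (oh R); rewrite (at_pt_ne RT) subr0; exact: at_pt_ge0.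
  have := isordM (oh T) (isord_t0 M T); apply: isord_ge0.
  by rewrite at_ptxx; have := at_pt_ge0 (val Q) T; lia.
have := oh Q; rewrite at_ptxx at_pt_ne 1?eq_sym // subr0 => o.
have := isord_gt0 _ o => /(_ isT); rewrite ha => /(hv_uniq (hv_cst M Q a)) a0.
by have := isord_neq0 o; rewrite ha a0 rmorph0 eqxx.
Qed.
End LameDivisors.

(** * The differential equation of a Lamé curve *)

(** The equation x dG/omega = n (y + a3) G for G = A + B y, on the curve
    y^2 + a3 y = x^3 + a2 x^2 + a4 x. *)
Definition ncub (k : comNzRingType) (a2 a4 : k) : {poly k} :=
  'X^3 + a2%:P * 'X^2 + a4%:P * 'X.
Definition lame_ode (k : comNzRingType) (a2 a3 a4 : k) (n : nat) (A B : {poly k}) :=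
  'X * (2 * A^`() - a3%:P * B^`()) = n%:R * A /\
  'X * (a3%:P * A^`() + 2 * ncub a2 a4 * B^`() + (ncub a2 a4)^`() * B)
    = n%:R * (a3%:P * A + ncub a2 a4 * B).

Section NormalForm.
Variables (k : closedFieldType) (E : ecurve k) (M : ffmodel E).
Local Notation j := (ff_cst M).
Local Notation x := (ff_x M).
Local Notation y := (ff_y M).
Local Notation px := (@px k E M).
Local Notation D := (@D k E M).
Hypotheses (a1E : a1 E = 0) (a6E : a6 E = 0).

Variables (P Q : point E) (n : nat).
Hypotheses (P0 : P != zero_point) (Q0 : Q != zero_point) (QP : Q != P).
Hypotheses (n0 : n%:R != 0 :> k) (two0 : 2 != 0 :> k) (three0 : 3 != 0 :> k).
Variables (F G : M).
Local Notation at_ R := (at_pt (val R)).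
Local Notation O := (zero_point : point E).
Hypothesis divF : forall R, isord R F (n%:Z * (at_ P R - at_ O R)).
Hypothesis ramQ : exists a, isord Q (F - j a) 3.
Hypothesis divG : forall R, isord R G (n%:Z * (at_ Q R - at_ O R)).
Hypothesis Q00 : val Q = Some (0, 0).

Lemma double_div : exists g : M, forall R, isord R g
  (2 * at_ Q R - at_pt (add_pt E (val Q) (val Q)) R - at_ O R).
Proof.
have [_ [g divg]] := add_pt_div M (valP Q) (valP Q); exists g => R.
by have := divg R; congr isord; ring.
Qed.

Lemma nf_a3_neq0 : a3 E != 0.
Proof.
have [g divg] := double_div.
have [SP _] := dlog_F P0 Q0 QP n0 three0 divF ramQ divg.
apply/eqP => a30; move: SP; rewrite Q00 /= a30 !(mulr0, oppr0, addr0, eqxx) /=.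
by move=> SP; case/negP: P0; apply/eqP/val_inj; exact: esym SP.
Qed.

(** The point P = 2 Q in terms of the slope la of the tangent at Q = (0, 0), and
    the function g as the quotient of this tangent by a vertical line. *)
Lemma nf_tangent : exists la, [/\ a4 E = a3 E * la,
  val P = Some (la ^+ 2 - a2 E, - (la * (la ^+ 2 - a2 E)) - a3 E) &
  forall R, isord R ((y - j la * x) / (x - j (la ^+ 2 - a2 E))) (2 * at_ Q R - at_ P R - at_ O R)].
Proof.
have oQ : on_curve E (Some (0, 0)) by rewrite -Q00; exact: (valP Q).
have nneg : ~~ ((0 == 0 :> k) && (0 == - 0 - a1 E * 0 - a3 E)).
  by rewrite eqxx mulr0 oppr0 !add0r ?oppr0 ?add0r eq_sym oppr_eq0 nf_a3_neq0.
have [la [nu [x3 [e1 _ N e]]]] := add_pt_line oQ oQ nneg.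
have nu0 : nu = 0 by rewrite e1 mulr0 add0r.
have := intersection_poly E la nu 0 0; rewrite /= N => h.
have [g divg] := double_div.
have [SP _] := dlog_F P0 Q0 QP n0 three0 divF ramQ divg.
rewrite Q00 e in SP divg.
have [h1 h2] : a4 E = a3 E * la /\ x3 = la ^+ 2 - a2 E.
  move: h; rewrite nu0 a1E !polyC0 !(mulr0, mul0r, subr0, add0r, addr0) -expr2 !mulrBr -exprSr.
  set u := _ - a2 E; set v := _ - a3 E * la => h.
  have := congr1 (fun p : {poly k} => p`_1) h; have := congr1 (fun p : {poly k} => p`_2) h.
  rewrite /= !(coefD, coefB, coefN, coefMC, coefMX, coefCM, coefC, coefXn, coefX) /=.
  rewrite !(mulr0, mul1r, mulr1, subr0, sub0r, add0r, addr0) => /oppr_inj h2.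
  by rewrite !mul0r oppr0 add0r => /esym/subr0_eq ->; rewrite h2.
have o3 := on_curve_line N.
exists la; split=> // [|R]; first by rewrite -SP -h2 nu0 addr0 /neg_y a1E mul0r subr0.
have := isord_div (isord_line M R N) (isord_vertical M R o3).
rewrite nu0 rmorph0 subr0 mulr0 !addr0 -h2 Q00 -SP nu0 addr0.
by congr isord; ring.
Qed.

(** By [dlog_G], 2 dG/G = (a g + n dg/g), and g + dg/g = 2 (y + a3) / x; the
    constant a is n because g has a pole at P, where dG/G and (y + a3) / x are
    regular. *)
Lemma nf_dlog_G : x * D G = n%:R * (y + j (a3 E)) * G.
Proof.
have [la [a4E valP' divg]] := nf_tangent.
have divg' R : isord R ((y - j la * x) / (x - j (la ^+ 2 - a2 E)))
   (2 * at_ Q R - at_pt (add_pt E (val Q) (val Q)) R - at_ O R).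
  have [g0 divg0] := double_div.
  have [-> _] := dlog_F P0 Q0 QP n0 three0 divF ramQ divg0.
  exact: divg.
have [a dG] := dlog_G P0 Q0 QP n0 three0 divF ramQ divG divg'.
move: dG divg; set p := la ^+ 2 - a2 E; set u := y - j la * x; set v := x - j p; set g := u / v => dG divg.
have x0 := x_neq0 M; have v0 : v != 0 := xc_neq0 M p.
have u0 : u != 0 by have := line_neq0 M la 0; rewrite rmorph0 subr0.
have two0M : 2 != 0 :> M by have := two0; rewrite -(fmorph_eq0 j) rmorph_nat.
have G0 := isord_neq0 (divG P).
have eqM : y ^+ 2 = x ^+ 3 + j (a2 E) * x ^+ 2 + j (a3 E) * j la * x - j (a3 E) * y.
  have := ff_weierstrass M; rewrite a1E a6E rmorph0 a4E rmorphM => h.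
  by rewrite !mul0r addr0 in h; rewrite addr0 in h; rewrite -h; ring.
have dx : D x = 2 * y + j (a3 E).
  by rewrite D_x /Dx px_wlin a1E rmorph0 mul0r add0r.
have dy : D y = 3 * x ^+ 2 + 2 * j (a2 E) * x + j (a3 E) * j la.
  by rewrite D_y /Dy px_deriv_wlin px_deriv_wcub a1E a4E rmorph0 mul0r subr0 rmorphM.
have gid : g + D g / g = 2 * (y + j (a3 E)) / x.
  have e2 : u * (y + j la * x + j (a3 E)) = x ^+ 2 * v.
    transitivity (y ^+ 2 + j (a3 E) * y - j la ^+ 2 * x ^+ 2 - j la * j (a3 E) * x); first by rewrite /u; ring.
    by rewrite eqM /v /p rmorphB rmorphXn /=; ring.
  have e3 : (y + j (a3 E)) * u = x * (x ^+ 2 + j (a2 E) * x - j la * y).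
    transitivity (y ^+ 2 + j (a3 E) * y - j la * x * y - j la * j (a3 E) * x); first by rewrite /u; ring.
    by rewrite eqM; ring.
  have Du : D u = 3 * x ^+ 2 + 2 * j (a2 E) * x - 2 * j la * y.
    by rewrite /u DB DM D_cst dx dy; ring.
  have Dv : D v = 2 * y + j (a3 E) by rewrite /v DB D_cst dx subr0.
  transitivity (D u / u - (D v - u) / v).
    by rewrite /g D_div //; field; rewrite u0 v0.
  have -> : (D v - u) / v = x ^+ 2 / u.
    by apply/eqP; rewrite eqr_div // -e2 Dv /u; apply/eqP; ring.
  rewrite -mulrBl Du; apply/eqP; rewrite eqr_div //; apply/eqP.
  by rewrite -[RHS]mulrA e3; ring.
have gid' : 2 * ((y + j (a3 E)) / x) = g + D g / g by rewrite mulrA gid.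
have an : a = n%:R.
  apply/eqP; rewrite -subr_eq0; apply: contraT => an; exfalso.
  have oG : isord P G 0.
    by have := divG P; rewrite at_pt_ne 1?eq_sym // at_pt_ne // subrr mulr0.
  have og : isord P g (-1).
    by have := divg P; rewrite at_ptxx at_pt_ne 1?eq_sym // at_pt_ne // mulr0 subr0 sub0r.
  have oag := isordM (isord_cst M P an) og.
  have [c1 hc1] : exists c1, hv P ((y + j (a3 E)) / x) c1.
    have hx := hv_x M valP'; have hy := hv_y M valP'.
    have [p0|p0] := eqVneq (la ^+ 2 - a2 E) 0; last first.
      eexists; apply: hv_div p0 _ hx; exact: hvD hy (hv_cst M P (a3 E)).
    have tP : t0 M P = x.
      have den : 2 * (- (la * 0) - a3 E) + a1 E * 0 + a3 E = - a3 E by ring.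
      by rewrite /t0 valP' p0 den oppr_eq0 (negPf nf_a3_neq0) rmorph0 subr0.
    rewrite -tP; apply: hv_div_t0; have := hvD hy (hv_cst M P (a3 E)).
    by rewrite p0 mulr0 oppr0 add0r addNr.
  have [d0 d00 hG] := isord_ord0 oG; have [d1 hDG] := hv_D hG.
  have hr : hv P (j (a - n%:R) * g) (2 * (d1 / d0) - n%:R * (2 * c1)).
    have -> : j (a - n%:R) * g = 2 * (D G / G) - n%:R * (2 * ((y + j (a3 E)) / x)).
      by rewrite gid' dG rmorphB rmorph_nat; ring.
    apply: hvB; first by apply: hvM; [exact: hv_nat | exact: hv_div].
    by apply: hvM; [exact: hv_nat | apply: hvM => //; exact: hv_nat].
  exact: isord_neg _ oag hr.
have h2 : 2 * (D G / G) = 2 * (n%:R * ((y + j (a3 E)) / x)).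
  by rewrite dG an rmorph_nat -mulrDr -gid' mulrCA.
have h3 := mulfI two0M h2.
by rewrite -[D G](divfK G0) h3; field.
Qed.

(** Every power of G is a polynomial in x and y, so that it yields polynomial
    solutions of the differential equation for all multiples of n. *)
Lemma nf_ode r : exists A B, (A, B) != 0 /\
  lame_ode (a2 E) (a3 E) (a4 E) (r * n)%N A B.
Proof.
have oGr R := isordX r (divG R).
have [A [B e]] : exists A B, G ^+ r = px A + px B * y.
  apply: affine_regular_poly => R nR; apply: isord_ge0 (oGr R).
  have -> : at_ O R = 0 by rewrite /at_pt (negPf nR).
  by have := at_pt_ge0 (val Q) R; lia.
exists A, B; split.
  apply/eqP => -[A0 B0]; have := isord_neq0 (oGr O).
  by rewrite e A0 B0 !rmorph0 mul0r addr0 eqxx.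
have x0 := x_neq0 M.
have h : x * D (G ^+ r) = (r * n)%:R * (y + j (a3 E)) * G ^+ r.
  case: (r) => [|s]; first by rewrite expr0 D1 mulr0 mul0n !mul0r.
  rewrite DXn /= mulrCA nf_dlog_G exprS natrM; ring.
have wl : wlin E = (a3 E)%:P by rewrite /wlin a1E polyC0 mul0r add0r.
have wc : wcub E = ncub (a2 E) (a4 E) by rewrite /wcub a6E polyC0 addr0.
have e1 : px ('X * ((a3 E)%:P * A^`() + 2 * ncub (a2 E) (a4 E) * B^`() + (ncub (a2 E) (a4 E))^`() * B))
    + px ('X * (2 * A^`() - (a3 E)%:P * B^`())) * y
  = px ((r * n)%:R * ((a3 E)%:P * A + ncub (a2 E) (a4 E) * B)) + px ((r * n)%:R * A) * y.
  move: h (y2E M); rewrite e D_poly /Dx /Dy wl wc derivC.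
  generalize (ncub (a2 E) (a4 E)) => c; rewrite rmorph0 mul0r subr0 pxC => h h2.
  rewrite !(pxM, pxB, pxD) !pxC pxX !rmorph_nat.
  have hc : px c = y ^+ 2 + j (a3 E) * y by rewrite h2; ring.
  rewrite hc.
  transitivity (x * ((px A^`() + px B^`() * y) * (2 * y + px (a3 E)%:P) + px B * px c^`())).
    by rewrite pxC; ring.
  by rewrite pxC h; ring.
by have [] := px_inj e1.
Qed.
End NormalForm.

(** * Morphisms of function fields *)

Lemma bijective_rmorphV (A B : fieldType) (f : {rmorphism A -> B}) : bijective f ->
  exists g : {rmorphism B -> A}, cancel f g /\ cancel g f.
Proof.
move=> [g fg gf].
have zm : zmod_morphism g by move=> a b; apply: (can_inj fg); rewrite rmorphB !gf.
have mm : monoid_morphism g.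
  by split=> [|a b]; apply: (can_inj fg); rewrite ?rmorph1 ?rmorphM !gf.
pose gZ := GRing.isZmodMorphism.Build _ _ g zm.
pose gM := GRing.isMonoidMorphism.Build _ _ g mm.
pose gR : {rmorphism B -> A} := HB.pack g gZ gM.
by exists gR.
Qed.

Section UniversalProperty.
Variables (k : fieldType) (E : ecurve k) (M : ffmodel E).
Variables (L : fieldType) (h : {rmorphism k -> L}) (X Y : L).
Hypothesis eXY : on_weq E h X Y.
Hypothesis free : forall A B, ev1 h X A + ev1 h X B * Y = 0 -> A = 0 /\ B = 0.
Local Notation px := (@px k E M).
Local Notation y := (ff_y M).
Local Notation eX := (ev1 h X).

Lemma up_neq0 d : d != 0 -> eX d != 0.
Proof.
move=> d0; apply: contraNneq d0 => e; have [] := @free d 0; last by move=> -> _.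
by rewrite rmorph0 mul0r addr0.
Qed.

Lemma up_ex : exists phi : M -> L, forall A B d, d != 0 ->
  phi ((px A + px B * y) / px d) = (eX A + eX B * Y) / eX d.
Proof.
have H f : exists v, forall A B d, d != 0 -> f = (px A + px B * y) / px d ->
    v = (eX A + eX B * Y) / eX d.
  have [A [B [d [d0 e]]]] := px_gen f; exists ((eX A + eX B * Y) / eX d) => A' B' d' d0' e'.
  move: e; rewrite e' => /eqP; rewrite eqr_div ?px_eq0 // => /eqP e.
  have [eA eB] : A' * d = A * d' /\ B' * d = B * d'.
    apply: (@px_inj _ _ M); rewrite !pxM; transitivity ((px A' + px B' * y) * px d); first by ring.
    by rewrite e; ring.
  apply/eqP; rewrite eqr_div ?up_neq0 //; apply/eqP.
  have := congr1 eX eA; have := congr1 eX eB; rewrite !rmorphM /= => eB' eA'.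
  transitivity (eX A * eX d' + eX B * eX d' * Y); first by ring.
  by rewrite -eA' -eB'; ring.
by have [phi hphi] := choice H; exists phi => A B d d0; exact: hphi.
Qed.

(** Every function has the form (A + B y) / d, which is unique up to a common
    factor and dictates the image; the equation of the curve makes the map
    multiplicative. *)
Lemma universal_property : exists phi : {rmorphism M -> L},
  [/\ forall c, phi (ff_cst M c) = h c, phi (ff_x M) = X & phi y = Y].
Proof.
have [phi hphi] := up_ex.
have h1 A B : phi (px A + px B * y) = eX A + eX B * Y.
  by have := hphi A B 1 (oner_neq0 _); rewrite !rmorph1 !divr1.
have zm : zmod_morphism phi.
  move=> f g; have [A [B [d [d0 ->]]]] := px_gen f; have [A' [B' [d' [d0' ->]]]] := px_gen g.
  have -> : (px A + px B * y) / px d - (px A' + px B' * y) / px d' =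
      (px (A * d' - A' * d) + px (B * d' - B' * d) * y) / px (d * d').
    by rewrite !pxB !pxM; field; rewrite !px_eq0 d0 d0'.
  rewrite !hphi ?mulf_neq0 // !rmorphB !rmorphM /=.
  by field; rewrite !up_neq0.
have mm : monoid_morphism phi.
  split=> [|f g]; first by have := h1 1 0; rewrite !rmorph1 !rmorph0 !mul0r !addr0.
  have [A [B [d [d0 ->]]]] := px_gen f; have [A' [B' [d' [d0' ->]]]] := px_gen g.
  rewrite mulf_div px_mul -pxM !hphi ?mulf_neq0 // mulf_div !rmorphM /=; congr (_ / _).
  have := on_weqE eXY; generalize (wcub E) (wlin E) => c l e.
  rewrite !(ev1M, ev1D, ev1B).
  have -> : eX c = Y ^+ 2 + eX l * Y by rewrite e; ring.
  by ring.
pose pZ := GRing.isZmodMorphism.Build _ _ phi zm.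
pose pM := GRing.isMonoidMorphism.Build _ _ phi mm.
pose pR : {rmorphism M -> L} := HB.pack phi pZ pM.
exists pR; split=> /=.
- by move=> c; have := h1 c%:P 0; rewrite pxC ev1C !rmorph0 !mul0r !addr0.
- by have := h1 'X 0; rewrite pxX ev1X !rmorph0 !mul0r !addr0.
- by have := h1 0 1; rewrite !rmorph0 !rmorph1 !mul1r !add0r.
Qed.
End UniversalProperty.

Lemma rmorph_px (k : fieldType) (E : ecurve k) (M : ffmodel E) (L : fieldType)
  (phi : {rmorphism M -> L}) (h : {rmorphism k -> L}) A :
  (forall c, phi (ff_cst M c) = h c) -> phi (px M A) = ev1 h (phi (ff_x M)) A.
Proof.
move=> hc; elim/poly_ind: A => [|A c IH]; first by rewrite !rmorph0.
by rewrite pxD pxM pxC pxX ev1D ev1M ev1C ev1X rmorphD rmorphM IH hc.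
Qed.

Lemma rmorph_ext (k : fieldType) (E : ecurve k) (M : ffmodel E) (L : fieldType)
  (phi psi : {rmorphism M -> L}) (h : {rmorphism k -> L}) :
  (forall c, phi (ff_cst M c) = h c) -> (forall c, psi (ff_cst M c) = h c) ->
  phi (ff_x M) = psi (ff_x M) -> phi (ff_y M) = psi (ff_y M) -> phi =1 psi.
Proof.
move=> h1 h2 ex ey f; have [A [B [d [d0 ->]]]] := px_gen f.
by rewrite !fmorph_div !rmorphD !rmorphM /= !(rmorph_px _ h1) !(rmorph_px _ h2) ex ey.
Qed.

Lemma rmorph_ev2 (k L L' : comNzRingType) (h : {rmorphism k -> L}) (h' : {rmorphism k -> L'})
  (phi : {rmorphism L -> L'}) X Y g : (forall c, phi (h c) = h' c) ->
  phi (ev2 h X Y g) = ev2 h' (phi X) (phi Y) g.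
Proof.
move=> hc; elim/poly2_ind: g => [c|||f g IHf IHg|f g IHf IHg].
- by rewrite !ev2CC.
- by rewrite !ev2X.
- by rewrite !ev2Y.
- by rewrite !rmorphD /= IHf IHg.
- by rewrite !rmorphM /= IHf IHg.
Qed.

(** Values are computed from those of the chart coordinates. *)
Lemma hv_morph (k : fieldType) (E E' : ecurve k) (M : ffmodel E) (M' : ffmodel E')
  (phi : {rmorphism M -> M'}) (R : point E') (S : point E) :
  (forall c, phi (ff_cst M c) = ff_cst M' c) ->
  hv R (phi (mchart M S).1.1) (mchart M S).2.1 ->
  hv R (phi (mchart M S).1.2) (mchart M S).2.2 ->
  forall f c, hv S f c -> hv R (phi f) c.
Proof.
move=> hc h1 h2 f c [g [h [h0 -> ->]]]; rewrite fmorph_div !mptE in h0 *.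
rewrite !(rmorph_ev2 _ _ _ hc).
by apply: hv_div h0 _ _; apply: hv_ev2.
Qed.

(** The affine substitution x -> al x + be, y -> ga y + de x + ep. *)
Section Substitution.
Variables (k : fieldType) (E E' : ecurve k) (M : ffmodel E) (M' : ffmodel E').
Variables (al be ga de ep : k).
Hypotheses (al0 : al != 0) (ga0 : ga != 0).
Hypothesis sub : forall (L : comNzRingType) (h : {rmorphism k -> L}) u v, on_weq E' h u v ->
  on_weq E h (h al * u + h be) (h ga * v + h de * u + h ep).
Local Notation j := (ff_cst M').
Local Notation x := (ff_x M').
Local Notation y := (ff_y M').
Local Notation px := (@px k E' M').
Let X := j al * x + j be.
Let Y := j ga * y + j de * x + j ep.

Lemma ev1_X A : ev1 j X A = px (A \Po (al%:P * 'X + be%:P)).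
Proof.
elim/poly_ind: A => [|A c IH]; first by rewrite comp_poly0 !rmorph0.
rewrite comp_polyD comp_polyM comp_polyC comp_polyX pxD pxM -IH pxD pxM !pxC pxX.
by rewrite ev1D ev1M ev1C ev1X.
Qed.

Lemma comp_affine_eq0 A : A \Po (al%:P * 'X + be%:P) = 0 -> A = 0.
Proof.
move=> e; have := congr1 (fun p => p \Po (al^-1%:P * ('X - be%:P))) e.
rewrite /= comp_poly0 -comp_polyA comp_polyD comp_polyM !comp_polyC comp_polyX.
rewrite mulrA -polyCM divff // mul1r subrK comp_polyXr //.
Qed.

Lemma sub_free A B : ev1 j X A + ev1 j X B * Y = 0 -> A = 0 /\ B = 0.
Proof.
rewrite !ev1_X; set A' := A \Po _; set B' := B \Po _ => e.
have [e1 e2] : A' + B' * (de%:P * 'X + ep%:P) = 0 /\ ga%:P * B' = 0.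
  apply: (@px_free _ _ M'); rewrite -e !(pxD, pxM) !pxC pxX /Y; ring.
have B'0 : B' = 0.
  by move/eqP: e2; rewrite mulf_eq0 polyC_eq0 (negPf ga0) => /eqP.
by move: e1; rewrite B'0 mul0r addr0 => /comp_affine_eq0 ->; rewrite (comp_affine_eq0 B'0).
Qed.

Definition sub_pt (c : option (k * k)) : option (k * k) :=
  omap (fun c => (al * c.1 + be, ga * c.2 + de * c.1 + ep)) c.

Lemma on_curve_sub c : on_curve E' c -> on_curve E (sub_pt c).
Proof.
case: c => [[a b]|] //= /eqP oab; apply/eqP.
exact: (@sub k idfun a b oab).
Qed.

Definition sub_point (R : point E') : point E := mk_point (on_curve_sub (valP R)).

Lemma hv_sub_den R : val R = None ->
  hv R (j ga + j de * (x / y) + j ep * y^-1) ga.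
Proof.
move=> e; have : hv R (j ga + j de * (x / y) + j ep * y^-1) (ga + de * 0 + ep * 0).
  by do ![apply: hv_cst|exact: hv_z e|exact: hv_w e|apply: hvD|apply: hvM].
by rewrite !mulr0 !addr0.
Qed.

Lemma sub_morph : exists phi : {rmorphism M -> M'},
  [/\ forall c, phi (ff_cst M c) = j c, phi (ff_x M) = X, phi (ff_y M) = Y &
    forall R f c, hv (sub_point R) f c -> hv R (phi f) c].
Proof.
have eXY : on_weq E j X Y by apply: sub; exact: curve_xy.
have [phi [pc pX pY]] := @universal_property _ _ M _ _ _ _ eXY sub_free.
exists phi; split=> // R f c; apply: hv_morph => //; rewrite /mchart /=;
  case e : (val R) => [[a b]|] /=.
- by rewrite pX; exact: hvD (hvM (hv_cst _ _ _) (hv_x _ e)) (hv_cst _ _ _).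
- have y0 := y_neq0 M'.
  have hd := hv_sub_den e.
  rewrite fmorph_div pX pY.
  have -> : X / Y = (j al * (x / y) + j be * y^-1) / (j ga + j de * (x / y) + j ep * y^-1).
    rewrite (_ : X = (j al * (x / y) + j be * y^-1) * y); last by rewrite /X; field.
    rewrite (_ : Y = (j ga + j de * (x / y) + j ep * y^-1) * y); last by rewrite /Y; field.
    by rewrite -mulf_div divff // mulr1.
  have -> : 0 = (al * 0 + be * 0) / ga by rewrite !mulr0 addr0 mul0r.
  apply: hv_div ga0 _ hd.
  by do ![apply: hv_cst|exact: hv_z e|exact: hv_w e|apply: hvD|apply: hvM].
- rewrite pY; do ![apply: hv_cst|exact: hv_x e|exact: hv_y e|apply: hvD|apply: hvM].
- have y0 := y_neq0 M'.
  have hd := hv_sub_den e.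
  rewrite fmorphV pY.
  rewrite (_ : Y = (j ga + j de * (x / y) + j ep * y^-1) * y); last by rewrite /Y; field.
  rewrite invfM mulrC -(mul0r ga^-1); exact: hv_div ga0 (hv_w M' e) hd.
Qed.
End Substitution.

(** * Isomorphisms of pointed curves *)

Opaque funfield.

Section GenericTransport.
Variables (k : fieldType) (E E' : ecurve k) (M : ffmodel E) (M' : ffmodel E').
Variables (g : point E' -> point E) (phi : {rmorphism M -> M'}).
Hypotheses (bphi : bijective phi).
Hypothesis hr : forall R f, mregular (g R) f <-> mregular R (phi f).

(** The maximal ideal of a local ring in terms of the ring alone. *)
Lemma mvanishes_regular (E1 : ecurve k) (M1 : ffmodel E1) (R : point E1) (f : M1) :
  mvanishes R f <-> mregular R f /\ (f = 0 \/ ~ mregular R f^-1).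
Proof.
split=> [/mvanishesE h0|[/mregularE[c hc] [->|h1]]]; last 2 first.
- by apply/mvanishesE; exact: hv0.
- have [c0|c0] := eqVneq c 0; first by apply/mvanishesE; rewrite -c0.
  by case: h1; apply/mregularE; exists c^-1; exact: hvV.
split; first by apply/mregularE; exists 0.
have [->|n0] := eqVneq f 0; [by left | right=> /mregularE[c hc]].
have := hvM h0 hc; rewrite divff // mul0r => /hv_uniq/(_ (hv1 M1 R))/eqP.
by rewrite eq_sym oner_eq0.
Qed.

Lemma mvanishes_transport R f : mvanishes (g R) f <-> mvanishes R (phi f).
Proof.
apply: (iff_trans (mvanishes_regular _ _)).
apply: iff_sym; apply: (iff_trans (mvanishes_regular _ _)); rewrite -fmorphV.
have e : phi f = 0 <-> f = 0 by split=> [/eqP|->]; rewrite ?fmorph_eq0 ?rmorph0 // => /eqP.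
by split=> -[/hr h1 h2]; split=> //; case: h2 => [/e|] h2; [left| right => /hr |left|right=> /hr].
Qed.

Lemma mord_transport R f m : mord (g R) f m -> mord R (phi f) m.
Proof.
have [psi [phiK psiK]] := bijective_rmorphV bphi.
move=> [t [u [[vt ut] u0 ru rv ->]]]; exists (phi t), (phi u); split.
- split=> [|f']; first exact/mvanishes_transport.
  rewrite -(psiK f') => /mvanishes_transport/ut[r rr ->]; exists (phi r); first exact/hr.
  by rewrite rmorphM.
- by rewrite fmorph_eq0.
- exact/hr.
- by rewrite -fmorphV; exact/hr.
- by rewrite rmorphM fmorphXz.
Qed.
End GenericTransport.

Section Isomorphisms.
Variable k : closedFieldType.
Implicit Types C D : pointed_curve k.

Definition isom C D (g : point C -> point D) (phi : {rmorphism funfield D -> funfield C}) :=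
  [/\ bijective g /\ bijective phi,
        forall c : k, phi (fun_cst D c) = fun_cst C c,
        forall R f, regular_at (g R) f <-> regular_at R (phi f),
        g zero_point = zero_point & g (pc_point C) = pc_point D].

Lemma isom_sym C D g phi : @isom C D g phi ->
  exists g' psi, [/\ @isom D C g' psi, cancel g g' & cancel g' g].
Proof.
move=> [[[g' gK g'K] /bijective_rmorphV[psi [phiK psiK]]] hc hr g0 gP].
exists g', psi; split; [split | exact: gK | exact: g'K].
- by split; [exists g | exists phi].
- by move=> c; exact: (canLR phiK (esym (hc c))).
- move=> R f; apply: iff_sym; rewrite -{1}(g'K R) -[X in _ <-> regular_at _ X](psiK f).
  exact: hr.
- by rewrite -g0 gK.
- by rewrite -gP gK.
Qed.

Lemma isom_trans C D B g phi g' psi : @isom C D g phi -> @isom D B g' psi ->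
  @isom C B (g' \o g) (phi \o psi).
Proof.
move=> [[bg bphi] hc hr g0 gP] [[bg' bpsi] hc' hr' g0' gP']; split.
- by split; exact: bij_comp.
- by move=> c; exact: (etrans (congr1 phi (hc' c)) (hc c)).
- by move=> R f; apply: iff_trans (hr' _ _) _; exact: hr.
- by rewrite /= g0 g0'.
- by rewrite /= gP gP'.
Qed.

Lemma isomorphic_sym C D : isomorphic C D -> isomorphic D C.
Proof. by move=> [g [phi /isom_sym[g' [psi [h _ _]]]]]; exists g', psi. Qed.
Lemma isomorphic_trans C D B : isomorphic C D -> isomorphic D B -> isomorphic C B.
Proof.
move=> [g [phi h]] [g' [psi h']].
by exists (g' \o g), (phi \o psi); exact: isom_trans h h'.
Qed.
Lemma iso_class_eq C D : isomorphic C D -> iso_class C = iso_class D.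
Proof.
move=> h; rewrite /iso_class; apply/funext => B; apply/propext; split => h' /=.
  exact: isomorphic_trans (isomorphic_sym h) h'.
exact: isomorphic_trans h h'.
Qed.

Lemma isom_ord C D g phi R f m : @isom C D g phi -> ord_at (g R) f m -> ord_at R (phi f) m.
Proof.
move=> [[_ bphi] _ hr _ _] /ord_atE/mordE h; apply/ord_atE/mordE.
refine (@mord_transport k D C (function_field D) (function_field C) g phi bphi _ R f m h).
move=> R' f'; refine (iff_trans _ (iff_trans (hr R' f') _)).
  exact: (iff_sym (regular_mE (g R') f')).
exact: regular_mE R' (phi f').
Qed.

(** What the argument uses of a Lamé curve: a function F with divisor
    n P - n O that is triply ramified at Q, and a function G with divisor
    n Q - n O. Unlike the group law, these data travel along isomorphisms. *)
Definition lame_div C (Q : point C) (n : nat) : Prop :=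
  [/\ pc_point C != zero_point, Q != zero_point, Q != pc_point C,
   exists2 F, has_divisor F n (pc_point C) & exists a, ord_at Q (F - fun_cst C a) 3 &
   exists G, has_divisor G n Q].

Lemma isom_lame_div C D g phi (Q : point C) n : @isom C D g phi ->
  lame_div (g Q) n -> lame_div Q n.
Proof.
move=> h; have [[bg _] hc _ g0 gP] := h; have gi := bij_inj bg.
move=> [P0 Q0 QP [F dF [a oa]] [G dG]]; split.
- by rewrite -(inj_eq gi) g0 gP.
- by rewrite -(inj_eq gi) g0.
- by rewrite -(inj_eq gi) gP.
- exists (phi F) => [R|].
    by have := isom_ord h (dF (g R)); rewrite -gP -g0 !(inj_eq gi).
  by exists a; have := isom_ord h oa; rewrite rmorphB /= (hc a).
- exists (phi G) => R.
  by have := isom_ord h (dG (g R)); rewrite -g0 !(inj_eq gi).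
Qed.

Lemma lame_lame_div C (Q : point C) n : lame n Q -> has_order Q n -> lame_div Q n.
Proof.
move=> [n1 n0 [_ _ oP] [F [dF _ Q0 QP [_ _ rQ _]]]] [_ nQ _].
have P0 : pc_point C != zero_point.
  apply/eqP => e; apply: (oP 1%N); first by rewrite n1.
  by rewrite /mul_pt /= e.
split=> //.
  exists F => //; case: rQ => _ [[c oc]|oQ]; first by exists c.
  have := isord_uniq (proj1 (ord_atE _ _ _) oQ) (proj1 (ord_atE _ _ _) (dF Q)).
  by rewrite (negPf QP) (negPf Q0) subrr mulr0.
have [_ [G dG]] := mul_pt_div (function_field C) n (valP Q).
exists G => R; apply/ord_atE; have := dG R; congr isord.
by rewrite nQ subrr subr0.
Qed.
End Isomorphisms.

(** * Changes of variables *)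

Section ChangeOfVariables.
Variables (k : fieldType) (E E' : ecurve k) (M : ffmodel E) (M' : ffmodel E').
Variables (al be ga de ep : k).
Hypotheses (al0 : al != 0) (ga0 : ga != 0).

(** The equation of the curve, as a function of the two coordinates. *)
Definition wdiff (E : ecurve k) (L : comNzRingType) (h : k -> L) (u v : L) : L :=
  v ^+ 2 + h (a1 E) * u * v + h (a3 E) * v -
  (u ^+ 3 + h (a2 E) * u ^+ 2 + h (a4 E) * u + h (a6 E)).
Hypothesis subE : forall (L : comNzRingType) (h : {rmorphism k -> L}) u v,
  wdiff E h (h al * u + h be) (h ga * v + h de * u + h ep) = h ga ^+ 2 * wdiff E' h u v.

Lemma on_weq_wdiff (E1 : ecurve k) (L : comNzRingType) (h : k -> L) u v :
  on_weq E1 h u v <-> wdiff E1 h u v = 0.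
Proof. by rewrite /on_weq /wdiff; split=> [->|/subr0_eq //]; rewrite subrr. Qed.

Lemma sub_forward (L : comNzRingType) (h : {rmorphism k -> L}) u v : on_weq E' h u v ->
  on_weq E h (h al * u + h be) (h ga * v + h de * u + h ep).
Proof. by move=> /on_weq_wdiff e; apply/on_weq_wdiff; rewrite subE e mulr0. Qed.

Let al' := al^-1.
Let be' := - be / al.
Let ga' := ga^-1.
Let de' := - de / (ga * al).
Let ep' := (de * be / al - ep) / ga.

Lemma sub_backward (L : comNzRingType) (h : {rmorphism k -> L}) u v : on_weq E h u v ->
  on_weq E' h (h al' * u + h be') (h ga' * v + h de' * u + h ep').
Proof.
move=> /on_weq_wdiff e; apply/on_weq_wdiff.
set u' := _ + h be'; set v' := _ + h ep'.
have eu : h al * u' + h be = u.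
  rewrite /u' mulrDr mulrA -!rmorphM divff // rmorph1 mul1r -addrA -rmorphD.
  by rewrite /be' mulrC divfK // addNr rmorph0 addr0.
have ev : h ga * v' + h de * u' + h ep = v.
  have h1 : h ga * h ga' = 1 by rewrite -rmorphM divff // rmorph1.
  have h2 : h ga * h de' + h de * h al' = 0.
    by rewrite -!rmorphM -rmorphD -(rmorph0 h) /de' /al'; congr (h _); field; rewrite ga0 al0.
  have h3 : h ga * h ep' + h de * h be' + h ep = 0.
    by rewrite -!rmorphM -!rmorphD -(rmorph0 h) /ep' /be'; congr (h _); field; rewrite ga0 al0.
  transitivity ((h ga * h ga') * v + (h ga * h de' + h de * h al') * u
     + (h ga * h ep' + h de * h be' + h ep)); first by rewrite /v' /u'; ring.
  by rewrite h1 h2 h3; ring.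
have := subE h u' v'; rewrite eu ev e => e'.
have h1 : h ga' * h ga = 1 by rewrite -rmorphM mulVf // rmorph1.
rewrite -[LHS]mul1r -[1](expr1n _ 2) -h1 exprMn -mulrA -e'.
by rewrite mulr0.
Qed.

Lemma al'0 : al' != 0. Proof. exact: invr_neq0. Qed.
Lemma ga'0 : ga' != 0. Proof. exact: invr_neq0. Qed.

Local Notation g := (sub_point sub_forward).
Local Notation g' := (sub_point sub_backward).

Lemma sub_pointK : cancel g g'.
Proof.
move=> R; apply: val_inj; rewrite /=; case: (val R) => [[a b]|] //=.
by congr (Some (_, _)); rewrite /al' /be' /ga' /de' /ep'; field; rewrite ?ga0 al0.
Qed.
Lemma sub_pointVK : cancel g' g.
Proof.
move=> R; apply: val_inj; rewrite /=; case: (val R) => [[a b]|] //=.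
by congr (Some (_, _)); rewrite /al' /be' /ga' /de' /ep'; field; rewrite ?ga0 al0.
Qed.

Lemma sub_iso : exists phi : {rmorphism M -> M'},
  [/\ bijective phi, forall c, phi (ff_cst M c) = ff_cst M' c &
      forall R f, mregular (g R) f <-> mregular R (phi f)].
Proof.
have [phi [pc pX pY pr]] := sub_morph M M' al0 ga0 sub_forward.
have [psi [sc sX sY sr]] := sub_morph M' M al'0 ga'0 sub_backward.
have k1 : cancel phi psi.
  apply: (@rmorph_ext _ _ M M (psi \o phi : {rmorphism M -> M}) idfun (ff_cst M)) => //=.
  - by move=> c; rewrite pc sc.
  - rewrite pX rmorphD rmorphM /= !sc sX.
    by rewrite /al' /be' !rmorphM rmorphN !fmorphV; field; rewrite fmorph_eq0.
  - rewrite pY !rmorphD !rmorphM /= !sc sX sY.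
    rewrite /al' /be' /ga' /de' /ep' !(rmorphM, rmorphB, rmorphN, fmorphV) /=.
    by field; rewrite !fmorph_eq0 ?al0 ?ga0.
have k2 : cancel psi phi.
  apply: (@rmorph_ext _ _ M' M' (phi \o psi : {rmorphism M' -> M'}) idfun (ff_cst M')) => //=.
  - by move=> c; rewrite sc pc.
  - rewrite sX rmorphD rmorphM /= !pc pX.
    by rewrite /al' /be' !rmorphM rmorphN !fmorphV; field; rewrite fmorph_eq0.
  - rewrite sY !rmorphD !rmorphM /= !pc pX pY.
    rewrite /al' /be' /ga' /de' /ep' !(rmorphM, rmorphB, rmorphN, fmorphV) /=.
    by field; rewrite !fmorph_eq0 ?al0 ?ga0.
exists phi; split=> //; first by exists psi.
move=> R f; split=> /mregularE[c hc]; apply/mregularE; exists c; first exact: pr.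
by rewrite -(k1 f); apply: sr; rewrite sub_pointK.
Qed.
End ChangeOfVariables.

(** Translating (r, t) to the origin and shearing by y -> y + (a1 / 2) x leaves
    the coefficients 0, c2, c3, c4, 0. *)
Definition nf_shear (k : fieldType) (W : weierstrass k) : k := a1 W / 2.
Definition nf_c2 (k : fieldType) (W : weierstrass k) (r : k) := a2 W + 3 * r + nf_shear W ^+ 2.
Definition nf_c3 (k : fieldType) (W : weierstrass k) (r t : k) := 2 * t + a1 W * r + a3 W.
Definition nf_c4 (k : fieldType) (W : weierstrass k) (r : k) :=
  3 * r ^+ 2 + 2 * a2 W * r + a4 W + nf_shear W * (a1 W * r + a3 W).

Section NormalFormIso.
Variables (k : closedFieldType) (C : pointed_curve k) (Q : point C) (r t : k).
Hypotheses (two0 : 2 != 0 :> k) (Qrt : val Q = Some (r, t)).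
Variable u : k.
Hypothesis u0 : u != 0.

Local Notation W := (weq C).
Local Notation s := (nf_shear W).

Definition nf_weierstrass := Weierstrass 0 (u ^+ 2 * nf_c2 W r) (u ^+ 3 * nf_c3 W r t)
  (u ^+ 4 * nf_c4 W r) 0.

Lemma nf_a1_eq : a1 W = 2 * s.
Proof. by rewrite /nf_shear mulrC divfK. Qed.
Lemma nf_a6_eq : a6 W = t ^+ 2 + a1 W * r * t + a3 W * t - (r ^+ 3 + a2 W * r ^+ 2 + a4 W * r).
Proof. by rewrite (valP_curve Qrt); ring. Qed.

Lemma nf_discriminant : discriminant nf_weierstrass = u ^+ 12 * discriminant W.
Proof.
have e1 := nf_a1_eq; have e6 := nf_a6_eq; move: e1 e6.
rewrite /nf_weierstrass /discriminant /nf_c2 /nf_c3 /nf_c4 /=; generalize s => s'.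
by move=> e1 -> ; rewrite e1; ring.
Qed.

Lemma nf_discriminant_neq0 : discriminant nf_weierstrass != 0.
Proof. by rewrite nf_discriminant mulf_neq0 ?expf_neq0 // discriminant_neq0. Qed.

Definition nf_curve := ECurve nf_discriminant_neq0.

Lemma nf_sub (L : comNzRingType) (h : {rmorphism k -> L}) v w :
  wdiff nf_curve h (h (u ^+ 2) * v + h (- u ^+ 2 * r))
    (h (u ^+ 3) * w + h (u ^+ 3 * s) * v + h (- u ^+ 3 * (t + s * r)))
  = h (u ^+ 3) ^+ 2 * wdiff C h v w.
Proof.
have e1 := nf_a1_eq; have e6 := nf_a6_eq; move: e1 e6.
rewrite /wdiff /= /nf_c2 /nf_c3 /nf_c4; generalize s => s' e1 ->; rewrite e1.
rewrite !(rmorph0, rmorphM, rmorphD, rmorphB, rmorphN, rmorphXn) /= ?rmorph1; ring.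
Qed.

Lemma nf_isom : exists (N : pointed_curve k) (QN : point N),
  [/\ weq N = nf_weierstrass, val QN = Some (0, 0), isomorphic C N &
      forall n, lame_div Q n -> lame_div QN n].
Proof.
have al0 : u ^+ 2 != 0 by rewrite expf_neq0.
have ga0 : u ^+ 3 != 0 by rewrite expf_neq0.
pose g : point C -> point nf_curve := sub_point (sub_forward nf_sub).
have [phi [bphi pc pr]] := sub_iso (function_field nf_curve) (function_field C) al0 ga0 nf_sub.
pose N := PointedCurve (g (pc_point C)).
have iso : @isom k C N g phi.
  split.
  - split; last exact: bphi.
    exists (sub_point (sub_backward al0 ga0 nf_sub)); [exact: sub_pointK | exact: sub_pointVK].
  - exact: pc.
  - move=> R f; refine (iff_trans (regular_mE (g R) f) _).
    refine (iff_trans (pr R f) _); exact: (iff_sym (regular_mE R (phi f))).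
  - exact: val_inj.
  - by [].
exists N, (g Q : point N); split.
- by [].
- by rewrite /= Qrt /=; congr (Some (_, _)); ring.
- by exists g, phi.
move=> n; have [g' [psi [iso' gK g'K]]] := isom_sym iso.
by move=> h; apply: (isom_lame_div iso'); rewrite gK.
Qed.
End NormalFormIso.

(** * Normal forms over the field of definition *)

Section LameDivisor.
Variables (k : closedFieldType) (C : pointed_curve k) (Q : point C) (n : nat).
Hypotheses (n0 : n%:R != 0 :> k) (two0 : 2 != 0 :> k) (three0 : 3 != 0 :> k).
Hypothesis lQ : lame_div Q n.
Local Notation M := (function_field C).
Local Notation P := (pc_point C).

Lemma has_divisor_isord (F : funfield C) m (R0 : point C) : has_divisor F m R0 ->
  forall R, isord (M := M) R F
    (m%:Z * (at_pt (val R0) R - at_pt (val (zero_point : point C)) R)).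
Proof. by move=> dF R; have /ord_atE := dF R; rewrite -!val_eqE. Qed.

Lemma lame_div_multiple m : n.+1 = (2 * m)%N -> val Q = mul_pt C m (val P).
Proof.
have [P0 Q0 QP [F dF [a oa]] [G dG]] := lQ.
have [g divg] := double_div M Q.
have rQ : exists a, isord (M := M) Q ((F : M) - ff_cst M a) 3 by exists a; exact/ord_atE.
exact: (Q_multiple P0 Q0 QP n0 three0 (has_divisor_isord dF) rQ (has_divisor_isord dG) divg).
Qed.

Hypotheses (a10 : a1 C = 0) (a60 : a6 C = 0) (Q00 : val Q = Some (0, 0)).

Lemma lame_div_ode : [/\ a3 C != 0,
  exists la, a4 C = a3 C * la /\
    val P = Some (la ^+ 2 - a2 C, - (la * (la ^+ 2 - a2 C)) - a3 C) &
  forall r, exists A B, (A, B) != 0 /\ lame_ode (a2 C) (a3 C) (a4 C) (r * n)%N A B].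
Proof.
have [P0 Q0 QP [F dF [a oa]] [G dG]] := lQ.
have rQ : exists a, isord (M := M) Q ((F : M) - ff_cst M a) 3 by exists a; exact/ord_atE.
have dF' := has_divisor_isord dF; have dG' := has_divisor_isord dG.
split.
- exact: (nf_a3_neq0 P0 Q0 QP n0 three0 dF' rQ Q00).
- have [la [h1 h2 _]] := nf_tangent a10 P0 Q0 QP n0 three0 dF' rQ Q00.
  by exists la.
- exact: (nf_ode a10 a60 P0 Q0 QP n0 two0 three0 dF' rQ dG' Q00).
Qed.
End LameDivisor.

Section MapGroupLaw.
Variables (K L : fieldType) (iota : {rmorphism K -> L}) (W : weierstrass K).

Lemma map_add_pt P Q : add_pt (map_weierstrass iota W) (map_coords iota P) (map_coords iota Q)
  = map_coords iota (add_pt W P Q).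
Proof.
case: P => [[x1 y1]|]; case: Q => [[x2 y2]|] //=.
have e : (iota y1 == - iota y2 - iota (a1 W) * iota x2 - iota (a3 W)) = (y1 == - y2 - a1 W * x2 - a3 W).
  by rewrite -(inj_eq (fmorph_inj iota)) !rmorphB rmorphN rmorphM.
rewrite e (inj_eq (fmorph_inj iota)); case: ifP => // _ /=.
set l := if x1 == x2 then _ else _; set l' := if x1 == x2 then _ else _.
have -> : l' = iota l.
  rewrite /l' /l; case: ifP => _; by rewrite !(rmorph1, rmorphM, fmorphV, rmorphN, rmorphD, rmorphXn).
by congr (Some (_, _)); rewrite !(rmorphN, rmorphD, rmorphM, rmorphXn).
Qed.

Lemma map_mul_pt n P : mul_pt (map_weierstrass iota W) n (map_coords iota P)
  = map_coords iota (mul_pt W n P).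
Proof. by elim: n => [|n IH] //; rewrite /mul_pt !iterS -/(mul_pt _ n _) IH map_add_pt. Qed.
End MapGroupLaw.

(** As a multiple of P, the point Q is rational over K, and so are the
    coefficients c2, c3, c4 of the model with Q at the origin. *)
Lemma lame_normal_form (K : fieldType) (iota : {rmorphism K -> algC})
    (C : pointed_curve algC) :
  odd_lame_signature1 C -> defined_over iota C ->
  exists (n : nat) (c2 c3 c4 : K), [/\ odd n, c3 != 0 &
   forall u : algC, u != 0 -> exists N : pointed_curve algC, let W := weq N in
    [/\ W = Weierstrass 0 (u ^+ 2 * iota c2) (u ^+ 3 * iota c3) (u ^+ 4 * iota c4) 0,
        isomorphic C N,
        exists la, a4 W = a3 W * la /\
          val (pc_point N) = Some (la ^+ 2 - a2 W, - (la * (la ^+ 2 - a2 W)) - a3 W) &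
        forall r, exists A B, (A, B) != 0 /\ lame_ode (a2 W) (a3 W) (a4 W) (r * n)%N A B]].
Proof.
move=> [n on [Q lQ [[_ oQ]|[//]]]] [C0 [g [phi iso]]].
have natC m : (0 < m)%N -> m%:R != 0 :> algC by move=> m0; rewrite pnatr_eq0 -lt0n.
have n0 : n%:R != 0 :> algC by apply: natC; case: (n) on.
have two0 := natC 2%N isT; have three0 := natC 3%N isT.
have [g' [psi [iso' gK g'K]]] := isom_sym iso.
set Dc := map_pointed_curve iota C0 in g phi iso g' psi iso' gK g'K *.
pose QD : point Dc := g Q.
have lQD : lame_div QD n.
  by apply: (isom_lame_div iso'); rewrite gK; exact: lame_lame_div.
have nm : n.+1 = (2 * n.+1./2)%N by rewrite mul2n even_halfK //= on.
have := lame_div_multiple n0 three0 lQD nm.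
rewrite (_ : val (pc_point Dc) = map_coords iota (val (pc_point C0))) //.
rewrite (map_mul_pt iota C0) => eQ.
have [_ QD0 _ _ _] := lQD.
case e : (mul_pt C0 n.+1./2 (val (pc_point C0))) eQ => [[r t]|] eQ; last first.
  by case/negP: QD0; apply/eqP/val_inj.
have isoCD : isomorphic C Dc by exists g, phi.
have eW : nf_shear (weq Dc) = iota (nf_shear (weq C0)).
  by rewrite /nf_shear /= fmorph_div rmorph_nat.
have c3E u : u ^+ 3 * nf_c3 (weq Dc) (iota r) (iota t) = u ^+ 3 * iota (nf_c3 (weq C0) r t).
  by rewrite /nf_c3 /= !(rmorphD, rmorphM) rmorph1.
have c2E u : u ^+ 2 * nf_c2 (weq Dc) (iota r) = u ^+ 2 * iota (nf_c2 (weq C0) r).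
  by rewrite /nf_c2 eW /= !(rmorphD, rmorphM, rmorphXn) /= rmorph1.
have c4E u : u ^+ 4 * nf_c4 (weq Dc) (iota r) = u ^+ 4 * iota (nf_c4 (weq C0) r).
  by rewrite /nf_c4 eW /= !(rmorphD, rmorphM, rmorphXn) /= rmorph1.
have main u : u != 0 -> exists N : pointed_curve algC, let W := weq N in
    [/\ W = Weierstrass 0 (u ^+ 2 * iota (nf_c2 (weq C0) r)) (u ^+ 3 * iota (nf_c3 (weq C0) r t)) (u ^+ 4 * iota (nf_c4 (weq C0) r)) 0,
        isomorphic C N, a3 W != 0,
        exists la, a4 W = a3 W * la /\
          val (pc_point N) = Some (la ^+ 2 - a2 W, - (la * (la ^+ 2 - a2 W)) - a3 W) &
        forall r, exists A B, (A, B) != 0 /\ lame_ode (a2 W) (a3 W) (a4 W) (r * n)%N A B].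
  move=> u0; have [N [QN [eN eQN iN lN]]] := nf_isom two0 eQ u0.
  have [h3 hP hode] := lame_div_ode n0 two0 three0 (lN _ lQD) (congr1 (@a1 _) eN)
    (congr1 (@a6 _) eN) eQN.
  exists N; split=> //; last exact: isomorphic_trans isoCD iN.
  by rewrite eN /nf_weierstrass c2E c3E c4E.
exists n, (nf_c2 (weq C0) r), (nf_c3 (weq C0) r t), (nf_c4 (weq C0) r); split=> //.
  have [N [eN _ h3 _ _]] := main 1 (oner_neq0 _); move: h3.
  by rewrite (congr1 (@a3 _) eN) /= expr1n mul1r fmorph_eq0.
by move=> u /main[N [h1 h2 _ h3 h4]]; exists N.
Qed.

(** * Valuation rings *)

Section Valuation.
Variable L : fieldType.
Local Open Scope classical_set_scope.

Record valuation_ring (V m : set L) : Prop := ValuationRing {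
  vr1 : V 1;
  vrB : forall x y, V x -> V y -> V (x - y);
  vrM : forall x y, V x -> V y -> V (x * y);
  vrm0 : m 0;
  vrmD : forall x y, m x -> m y -> m (x + y);
  vrmM : forall x y, V x -> m y -> m (x * y);
  vrmV : m `<=` V;
  vrm1 : ~ m 1;
  vr_total : forall x, V x \/ m x^-1
}.

Section Domination.
Variables (A0 I0 : set L).
Hypotheses (A01 : A0 1) (A0B : forall x y, A0 x -> A0 y -> A0 (x - y))
  (A0M : forall x y, A0 x -> A0 y -> A0 (x * y)) (I00 : I0 0)
  (I0D : forall x y, I0 x -> I0 y -> I0 (x + y)) (I0M : forall x y, A0 x -> I0 y -> I0 (x * y))
  (I0A : I0 `<=` A0) (I01 : ~ I0 1).

(** A subring and an ideal of it, coded as one set so as to be ordered by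
    inclusion. *)
Record ideal_pair (X : set (L * bool)) : Prop := IdealPair {
  ipA0 : forall x, A0 x -> X (x, true);
  ipI0 : forall x, I0 x -> X (x, false);
  ipB : forall x y, X (x, true) -> X (y, true) -> X (x - y, true);
  ipM : forall x y, X (x, true) -> X (y, true) -> X (x * y, true);
  ipD : forall x y, X (x, false) -> X (y, false) -> X (x + y, false);
  ipMI : forall x y, X (x, true) -> X (y, false) -> X (x * y, false);
  ipI : forall x, X (x, false) -> X (x, true);
  ip1 : ~ X (1, false)
}.

Lemma maximal_pair : exists X, ideal_pair X /\ forall Y, ideal_pair Y -> X `<=` Y -> Y `<=` X.
Proof.
(* the empty set is let in as an upper bound of the empty chain *)
have [|X [PX maxX]] := @Zorn_bigcup _ [set X | X !=set0 -> ideal_pair X].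
  move=> F FP Ftot /= [z [X0 FX0 X0z]].
  have good X t : F X -> X t -> ideal_pair X by move=> FX Xt; apply: (FP X FX); exists t.
  have common t t' : (\bigcup_(X in F) X) t -> (\bigcup_(X in F) X) t' ->
      exists X, [/\ F X, X t & X t'].
    move=> [X FX Xt] [Y FY Yt]; have [XY|YX] := Ftot _ _ FX FY.
      by exists Y; split=> //; exact: XY.
    by exists X; split=> //; exact: YX.
  have g0 := good _ _ FX0 X0z; split.
  - by move=> x Ax; exists X0 => //; exact: ipA0.
  - by move=> x Ix; exists X0 => //; exact: ipI0.
  - move=> x y hx hy; have [X [FX Xx Xy]] := common _ _ hx hy.
    by exists X => //; apply: (ipB (good _ _ FX Xx)).
  - move=> x y hx hy; have [X [FX Xx Xy]] := common _ _ hx hy.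
    by exists X => //; apply: (ipM (good _ _ FX Xx)).
  - move=> x y hx hy; have [X [FX Xx Xy]] := common _ _ hx hy.
    by exists X => //; apply: (ipD (good _ _ FX Xx)).
  - move=> x y hx hy; have [X [FX Xx Xy]] := common _ _ hx hy.
    by exists X => //; apply: (ipMI (good _ _ FX Xx)).
  - by move=> x [X FX Xx]; exists X => //; apply: (ipI (good _ _ FX Xx)).
  - by move=> [X FX X1]; exact: (ip1 (good _ _ FX X1)).
pose X1 : set (L * bool) := [set t | if t.2 then A0 t.1 else I0 t.1].
have gX1 : ideal_pair X1 by split.
have Xn0 : X !=set0.
  apply: contrapT => Xe; apply: (maxX X1) => //; split; last first.
    by move=> h; apply: Xe; exists (1, true); exact: h.
  by move=> t Xt; case: Xe; exists t.
exists X; split; first exact: PX.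
move=> Y gY XY; apply: contrapT => nYX; exact: (maxX Y).
Qed.

Variable X : set (L * bool).
Hypotheses (gX : ideal_pair X) (maxX : forall Y, ideal_pair Y -> X `<=` Y -> Y `<=` X).
Local Notation A x := (X (x, true)).
Local Notation I x := (X (x, false)).

Let A1 : A 1. Proof. exact: ipA0. Qed.
Let AA0 : A 0. Proof. by rewrite -(subrr 1); apply: (ipB gX). Qed.
Let AN x : A x -> A (- x). Proof. by move=> Ax; rewrite -sub0r; exact: (ipB gX). Qed.
Let AD x y : A x -> A y -> A (x + y).
Proof. by move=> Ax Ay; rewrite -[y]opprK; apply: (ipB gX) => //; exact: AN. Qed.
Let II0 : I 0. Proof. exact: (ipI0 gX). Qed.
Let AXn x n : A x -> A (x ^+ n).
Proof. by move=> Ax; elim: n => [|n IH]; rewrite ?expr0 // exprS; exact: (ipM gX). Qed.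

Let one_sub_neq0 a : I a -> 1 - a != 0.
Proof. by move=> Ia; rewrite subr_eq0; apply: contra_notN (ip1 gX) => /eqP->. Qed.

(** The pair A[x], I[x]. *)
Let adj (x : L) : set (L * bool) :=
  [set t | exists p : {poly L}, (forall i, X (p`_i, t.2)) /\ t.1 = p.[x]].

Let sumP (b : bool) n (F : nat -> L) : (forall i, X (F i, b)) -> X (\sum_(i < n) F i, b).
Proof.
move=> h; elim/big_ind: _ => //; first by case: (b).
by case: (b) => u v hu hv; [exact: AD | exact: (ipD gX)].
Qed.

Let X_MI (b b' : bool) x y : X (x, b) -> X (y, b') -> X (x * y, b && b').
Proof.
case: b; case: b' => /= hx hy.
- exact: (ipM gX).
- exact: (ipMI gX).
- by rewrite mulrC; exact: (ipMI gX).
- by apply: (ipMI gX) => //; exact: (ipI gX).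
Qed.

Let adj_good x : ~ adj x (1, false) -> ideal_pair (adj x).
Proof.
move=> h1.
have cst b c : X (c, b) -> adj x (c, b).
  move=> Xc; exists c%:P; rewrite hornerC; split=> // i; rewrite coefC; case: ifP => // _.
  by case: (b).
have mulP (b b' : bool) u v : adj x (u, b) -> adj x (v, b') -> adj x (u * v, b && b').
  move=> [p [/= hp ->]] [q [/= hq ->]]; exists (p * q); rewrite hornerM; split=> // i.
  by rewrite coefM; apply: (@sumP (b && b') i.+1 (fun j => p`_j * q`_(i - j))) => j; exact: X_MI.
split.
- by move=> u Au; apply: cst; exact: (ipA0 gX).
- by move=> u Iu; apply: cst; exact: (ipI0 gX).
- move=> u v [p [/= hp ->]] [q [/= hq ->]]; exists (p - q); rewrite hornerD hornerN; split=> // i.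
  by rewrite coefB; apply: (ipB gX).
- by move=> u v; exact: (mulP true true).
- move=> u v [p [/= hp ->]] [q [/= hq ->]]; exists (p + q); rewrite hornerD; split=> // i.
  by rewrite coefD; apply: (ipD gX).
- by move=> u v; exact: (mulP true false).
- by move=> u [p [/= hp ->]]; exists p; split=> // i; exact: (ipI gX).
- by [].
Qed.

Let adj_one x : ~ A x -> exists p : {poly L}, (forall i, I p`_i) /\ p.[x] = 1.
Proof.
move=> nAx; apply: contrapT => h.
have h1 : ~ adj x (1, false) by move=> [p [hp e]]; apply: h; exists p.
apply: nAx; apply: (maxX (adj_good h1)).
  move=> [c b] Xc; exists c%:P; rewrite hornerC; split=> // i; rewrite coefC; case: ifP => // _.
  by case: (b).
exists 'X; rewrite hornerX; split=> // i; rewrite coefX /=.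
by case: (_ == _).
Qed.

(** Otherwise 1 is in I[1 / (1 - a)], and clearing denominators puts a power of
    1 - a in I, hence 1 as well. *)
Let unit_one_sub a : I a -> A (1 - a)^-1.
Proof.
move=> Ia; apply: contrapT => /adj_one[p [hp]].
have d0 := one_sub_neq0 Ia; set d := 1 - a in d0 *.
have Ad : A d by apply: (ipB gX) => //; exact: (ipI gX).
rewrite horner_coef => e.
have Idn n : I (1 - d ^+ n).
  elim: n => [|n IH]; first by rewrite expr0 subrr.
  rewrite exprS (_ : 1 - d * d ^+ n = a + d * (1 - d ^+ n)); last by rewrite /d; ring.
  by apply: (ipD gX) => //; apply: (ipMI gX).
have : I (d ^+ size p).
  rewrite -[_ ^+ _]mulr1 -e mulr_sumr.
  elim/big_ind: _ => //; first exact: (ipD gX).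
  move=> i _; rewrite mulrCA; rewrite mulrC; apply: (ipMI gX) => //.
  rewrite exprVn -expfB //; exact: AXn.
move=> h; apply: (ip1 gX); rewrite -[1](subrK (d ^+ size p)); exact: (ipD gX).
Qed.

(** The relation 1 = q(1/x), multiplied by x^n, expresses x^n by lower powers of x
    with coefficients in I, and so removes the leading term of 1 = p(x). *)
Let reduce x (p q : {poly L}) : x != 0 -> (forall i, I p`_i) -> p.[x] = 1 ->
  (forall i, I q`_i) -> q.[x^-1] = 1 -> (size q <= size p)%N ->
  exists p' : {poly L}, [/\ forall i, I p'`_i, p'.[x] = 1 & (size p' < size p)%N].
Proof.
move=> x0 hp ep hq eq sqp.
have p0 : p != 0 by apply/eqP => p0; move/eqP: ep; rewrite p0 horner0 eq_sym oner_eq0.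
have s0 : (0 < size p)%N by rewrite size_poly_gt0.
set n := (size p).-1; have sp : size p = n.+1 by rewrite /n prednK.
have d0 := one_sub_neq0 (hq 0%N); have Ae := unit_one_sub (hq 0%N).
set e := (1 - q`_0)^-1 in Ae.
exists (\poly_(i < n) (p`_i + p`_n * e * q`_(n - i))); split.
- move=> i; rewrite coef_poly; case: ifP => // _; apply: (ipD gX) => //.
  by apply: (ipMI gX) => //; apply: (ipM gX) => //; exact: (ipI gX).
- rewrite horner_poly.
  under eq_bigr do rewrite mulrDl.
  rewrite big_split /= -[RHS]ep [in RHS]horner_coef sp big_ord_recr /=; congr (_ + _).
  under eq_bigr do rewrite -mulrA.
  rewrite -mulr_sumr -mulrA; congr (_ * _).
  have -> : \sum_(i < n) q`_(n - i) * x ^+ i = (1 - q`_0) * x ^+ n.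
    rewrite -{1}eq (@horner_coef_wide _ n.+1); last by rewrite -sp.
    rewrite big_ord_recl /= expr0 mulr1.
    rewrite addrC addKr mulr_suml (reindex_inj rev_ord_inj) /=; apply: eq_bigr => i _.
    rewrite /bump /= add1n subKn //.
    by rewrite -mulrA; congr (_ * _); rewrite exprVn [RHS]mulrC expfB_cond ?(negPf x0) ?add0n //.
  by rewrite mulrA mulVf // mul1r.
- by rewrite sp ltnS size_poly.
Qed.

Let no_both x : x != 0 -> A x \/ A x^-1.
Proof.
move=> x0; apply: contrapT => /not_orP[nA nA'].
have [p [hp ep]] := adj_one nA; have [q [hq eq]] := adj_one nA'.
move: {2}(size p + size q)%N (leqnn (size p + size q)) => n.
elim: n p q hp ep hq eq => [|n IH] p q hp ep hq eq hn.
  have : size p == 0%N by rewrite -leqn0 (leq_trans _ hn) // leq_addr.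
  by rewrite size_poly_eq0 => /eqP p0; move/eqP: ep; rewrite p0 horner0 eq_sym oner_eq0.
have [h|h] := leqP (size q) (size p).
  have [p' [hp' ep' sp']] := reduce x0 hp ep hq eq h.
  by apply: (IH p' q) => //; lia.
have x0' : x^-1 != 0 by rewrite invr_eq0.
have ep2 : p.[x^-1^-1] = 1 by rewrite invrK.
have [q' [hq' eq' sq']] := reduce x0' hq eq hp ep2 (ltnW h).
by apply: (IH p q') => //; lia.
Qed.

Lemma maximal_valuation_ring : valuation_ring [set x | A x] [set x | I x].
Proof.
split.
- exact: A1.
- exact: (ipB gX).
- exact: (ipM gX).
- exact: II0.
- exact: (ipD gX).
- exact: (ipMI gX).
- by move=> x; exact: (ipI gX).
- exact: (ip1 gX).
move=> x; have [Ax|nAx] := pselect (A x); [by left | right].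
have x0 : x != 0 by apply/eqP => x0; apply: nAx; rewrite x0.
have Ax' : A x^-1 by have [] := no_both x0.
(* if x is not in A, then x^-1 can be added to the ideal *)
pose Y : set (L * bool) := [set t | if t.2 then A t.1 else
  exists i a, [/\ I i, A a & t.1 = i + x^-1 * a]].
have XY : X `<=` Y.
  by move=> [u [|]] Xu //=; exists u, 0; rewrite mulr0 addr0.
have Yx : Y (x^-1, false) by exists 0, 1; rewrite mulr1 add0r.
have [[i [a [Ii Aa /= e]]]|n1] := pselect (Y (1, false)).
  exfalso; apply: nAx.
  have e' : x^-1 * a = 1 - i by rewrite e; ring.
  have -> : x = a * (1 - i)^-1.
    have d0 := one_sub_neq0 Ii.
    by apply: (mulIf d0); rewrite divfK // -e' mulrA divff // mul1r.
  by apply: (ipM gX) => //; exact: unit_one_sub.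
apply: (maxX _ XY Yx); split=> //=.
- exact: (ipA0 gX).
- by move=> u Iu; exists u, 0; rewrite mulr0 addr0; split=> //; exact: (ipI0 gX).
- exact: (ipB gX).
- exact: (ipM gX).
- move=> u v [i [a [Ii Aa /= ->]]] [i' [a' [Ii' Aa' /= ->]]].
  by exists (i + i'), (a + a'); split; [exact: (ipD gX) | exact: AD | rewrite /=; ring].
- move=> u v Au [i [a [Ii Aa /= ->]]].
  by exists (u * i), (u * a); split; [exact: (ipMI gX) | exact: (ipM gX) | rewrite /=; ring].
- move=> u [i [a [Ii Aa /= ->]]]; apply: AD; first exact: (ipI gX).
  exact: (ipM gX).
Qed.
End Domination.

(** Chevalley's extension theorem. *)
Theorem dominating_valuation_ring (A0 I0 : set L) :
  A0 1 -> (forall x y, A0 x -> A0 y -> A0 (x - y)) -> (forall x y, A0 x -> A0 y -> A0 (x * y)) ->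
  I0 0 -> (forall x y, I0 x -> I0 y -> I0 (x + y)) -> (forall x y, A0 x -> I0 y -> I0 (x * y)) ->
  I0 `<=` A0 -> ~ I0 1 ->
  exists V m, [/\ valuation_ring V m, A0 `<=` V & I0 `<=` m].
Proof.
move=> h1 h2 h3 h4 h5 h6 h7 h8.
have [X [gX maxX]] := maximal_pair h1 h2 h3 h5 h6 h7 h8.
exists [set x | X (x, true)], [set x | X (x, false)]; split.
- exact: (maximal_valuation_ring h1 h4 gX maxX).
- by move=> x /(ipA0 gX).
- by move=> x /(ipI0 gX).
Qed.
End Valuation.

Section ResidueField.
Variables (L : fieldType) (V m : set L).
Hypothesis hV : valuation_ring V m.

Definition vring_pred of valuation_ring V m : {pred L} := fun x => `[< V x >].
Local Notation VP := (vring_pred hV).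
Lemma vring_predP x : reflect (V x) (x \in VP). Proof. exact: asboolP. Qed.

Fact vring_subring : subring_closed VP.
Proof.
split; first by apply/vring_predP; exact: (vr1 hV).
  by move=> x y /vring_predP hx /vring_predP hy; apply/vring_predP; exact: (vrB hV).
by move=> x y /vring_predP hx /vring_predP hy; apply/vring_predP; exact: (vrM hV).
Qed.
HB.instance Definition _ := GRing.isSubringClosed.Build L VP vring_subring.

Record vring := VRing { vring_val :> L; _ : vring_val \in VP }.
HB.instance Definition _ := [isSub for vring_val].
HB.instance Definition _ := [Choice of vring by <:].
HB.instance Definition _ := [SubChoice_isSubComNzRing of vring by <:].

Definition vmax : {pred vring} := fun x => `[< m (vring_val x) >].
Lemma vmaxP x : reflect (m (vring_val x)) (x \in vmax). Proof. exact: asboolP. Qed.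
Lemma vring_valP (x : vring) : V (vring_val x).
Proof. by case: x => x /= /vring_predP. Qed.

Lemma vr_inv x : V x -> ~ m x -> V x^-1.
Proof. by move=> Vx nmx; have [//|] := vr_total hV x^-1; rewrite invrK. Qed.

Fact vmax_ideal : idealr_closed vmax.
Proof.
split.
- by apply/vmaxP; exact: (vrm0 hV).
- by apply/vmaxP; exact: (vrm1 hV).
- move=> a u v /vmaxP hu /vmaxP hv; apply/vmaxP; apply: (vrmD hV) => //.
  by apply: (vrmM hV) => //; exact: vring_valP.
Qed.
HB.instance Definition _ := isIdealr.Build vring vmax vmax_ideal.

Local Notation Q := {ideal_quot vmax}.
Local Open Scope quotient_scope.
Definition vproj : {rmorphism vring -> Q} := \pi_Q.

Lemma vproj_eq0 u : (vproj u == 0) = (u \in vmax).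
Proof. by rewrite -[0 in LHS](rmorph0 vproj) -[u in RHS]subr0 Quotient.idealrBE. Qed.

Lemma quot_inv (x : Q) : exists y, x != 0 -> y * x = 1.
Proof.
elim/quotW: x => u; rewrite -[\pi u]/(vproj u).
have [mu|nmu] := pselect (m (vring_val u)).
  by exists 0; rewrite vproj_eq0; move/vmaxP: mu => ->.
have oV : (vring_val u)^-1 \in VP by apply/vring_predP; apply: vr_inv => //; exact: vring_valP.
exists (vproj (VRing oV)) => _; rewrite -rmorphM /= -(rmorph1 vproj).
congr (vproj _); apply: val_inj => /=; rewrite mulVf //; apply/eqP => u0.
by apply: nmu; rewrite u0; exact: (vrm0 hV).
Qed.

Lemma residue_field : exists (F : fieldType) (rho : {rmorphism vring -> F}),
  forall x : vring, rho x = 0 <-> m (vring_val x).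
Proof.
have [inv0 hinv] := choice quot_inv.
pose inv (x : Q) : Q := if x == 0 then 0 else inv0 x.
have mulVx (x : Q) : x != 0 -> inv x * x = 1.
  by move=> x0; rewrite /inv (negPf x0); exact: hinv.
have invx0 : inv 0 = 0 by rewrite /inv eqxx.
pose fQ := GRing.ComNzRing_isField.Build Q mulVx invx0.
pose F : fieldType := HB.pack Q fQ.
exists F, (vproj : {rmorphism vring -> F}) => x.
by split=> [/eqP|mx]; [|apply/eqP]; rewrite vproj_eq0; [move/vmaxP | apply/vmaxP].
Qed.
End ResidueField.

(** * The differential equation in characteristic 2 *)

Section LameEquations.
Variables (k : comNzRingType) (a2 a3 a4 : k) (n : nat) (A B : {poly k}).
Hypothesis ode : lame_ode a2 a3 a4 n A B.
Local Notation c := (ncub a2 a4).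
Local Notation N := (wnorm a3%:P c A B).

Lemma ode_norm : 'X * N^`() = n%:R * N.
Proof.
have [e1 e2] := ode.
have -> : 'X * N^`() = A * ('X * (2 * A^`() - a3%:P * B^`()))
  - B * ('X * (a3%:P * A^`() + 2 * c * B^`() + c^`() * B)).
  rewrite /wnorm !derivB !expr2 !derivM derivC; ring.
by rewrite e1 e2 /wnorm; ring.
Qed.

Lemma ode_coef i : (i%:R * 2 - n%:R) * A`_i = i%:R * a3 * B`_i.
Proof.
have [e _] := ode; have := congr1 (fun p : {poly k} => p`_i) e.
rewrite coefXM -!polyC_natr coefCM; case: i => [|i] /=.
  by move=> h; rewrite !mul0r sub0r mulNr -h oppr0.
rewrite coefB 2!coefCM 2!coef_deriv -[A`_ _ *+ _]mulr_natl -[B`_ _ *+ _]mulr_natl => h.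
by rewrite mulrBl -h; ring.
Qed.
End LameEquations.

Lemma ode_A0 (k : fieldType) (a2 a3 a4 : k) n A B :
  lame_ode a2 a3 a4 n A B -> n%:R != 0 :> k -> A`_0 = 0.
Proof.
move=> ode n0; have := ode_coef ode 0; rewrite !mul0r sub0r => /eqP.
by rewrite mulf_eq0 oppr_eq0 (negPf n0) => /eqP.
Qed.

Section CharTwo.
Variables (k : fieldType) (a2 a3 a4 : k) (n : nat) (A B : {poly k}) (C : k).
Hypotheses (two0 : 2 = 0 :> k) (on : odd n).
Local Notation c := (ncub a2 a4).

Let two0p : 2 = 0 :> {poly k}.
Proof. by rewrite -polyC_natr two0. Qed.
Let n1 : n%:R = 1 :> {poly k}.
Proof. by rewrite -[n]odd_double_half on natrD -muln2 natrM two0p mulr0 addr0. Qed.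

Lemma ode_char2_A : lame_ode a2 a3 a4 n A B -> A = 'X * (a3%:P * B^`()).
Proof.
move=> [+ _]; rewrite n1 two0p mul0r sub0r mul1r => <-.
have -> : - (a3%:P * B^`()) = a3%:P * B^`() - 2 * (a3%:P * B^`()) by ring.
by rewrite two0p mul0r subr0.
Qed.

(** From A = a3 X B' and B'' = 0 follows X A' = A, and the second equation shrinks
    to a2 X^2 B = 0. If a3 = 0 as well, then A = 0 and the norm
    - (X^3 + a4 X) B^2 is a monomial. *)
Lemma ode_char2 : lame_ode a2 a3 a4 n A B -> B != 0 ->
  wnorm a3%:P c A B = C *: 'X^n -> a2 = 0 /\ (a3 = 0 -> a4 = 0).
Proof.
move=> ode B0 eN; have eA := ode_char2_A ode.
have B2 : B^`()^`() = 0.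
  have := nderivn_def 2 B; rewrite derivnS derivn1 => ->.
  by rewrite -mulr_natr two0p mulr0.
have A' : 'X * A^`() = A.
  rewrite eA derivM derivX derivM derivC B2; ring.
have ec : 'X * c^`() = c + a2%:P * 'X^2.
  have -> : 'X * c^`() = c + a2%:P * 'X^2 + 2 * 'X^3.
    by rewrite /ncub !derivD derivXn ![(_%:P * _)^`()]derivM !derivC !derivXn derivX /=; ring.
  by rewrite two0p mul0r addr0.
have h2 : a2 = 0.
  have [_] := ode; rewrite n1 two0p mul1r !mul0r addr0 mulrDr.
  rewrite mulrCA A' mulrA ec => h.
  have {}h : a2%:P * 'X^2 * B = 0.
    by apply: (addrI (a3%:P * A + c * B)); rewrite addr0 -[RHS]h; ring.
  move/eqP: h; rewrite mulf_eq0 (negPf B0) orbF mulf_eq0 polyC_eq0.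
  by rewrite [_ ^+ _ == 0]expf_eq0 polyX_eq0 orbF => /eqP.
split=> // a30; apply/eqP/negP => /negP a40.
have A0 : A = 0 by rewrite eA a30 mul0r mulr0.
have {}eN : - (c * B ^+ 2) = C *: 'X^n by rewrite -eN A0 /wnorm; ring.
have cE : c = 'X * ('X^2 + a4%:P) by rewrite /ncub h2; ring.
have C0 : C != 0.
  apply/eqP => C0; move/eqP: eN.
  rewrite C0 scale0r oppr_eq0 mulf_eq0 expf_eq0 (negPf B0) orbF cE mulf_eq0 polyX_eq0 /=.
  by rewrite -size_poly_eq0 size_XnaddC.
have dv : ('X^2 + a4%:P : {poly k}) %| 'X^n.
  rewrite -(dvdpZr _ _ C0) -eN cE -mulNr; apply/dvdpP.
  by exists (- ('X * B ^+ 2)); ring.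
have cop : coprimep ('X^2 + a4%:P : {poly k}) 'X^n.
  apply: coprimep_expr; rewrite -[X in coprimep _ X]subr0 -polyC0 coprimep_XsubC.
  by rewrite /root !hornerE expr0n /= add0r.
by have := coprimep_dvdl dv cop; rewrite coprimepp size_XnaddC.
Qed.
End CharTwo.

(** Here y is given by the power series Y in x. The product of A + B Y by the
    conjugate A - B - B Y is - X^n up to higher terms, and the conjugate does not
    vanish at 0. *)
Lemma norm_zero (k : fieldType) (c A B Y E : {poly k}) (n : nat) :
  wnorm 1 c A B = - 'X^n -> A`_0 = 0 -> B`_0 != 0 -> Y`_0 = 0 ->
  Y ^+ 2 + Y = c + 'X^(n.+1) * E -> exists2 H, A + B * Y = H * 'X^n & H`_0 * B`_0 = 1.
Proof.
move=> eN A0 B0 Y0 eY.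
have e : (A + B * Y) * (A - B - B * Y) = - 'X^n * (1 + 'X * (E * B ^+ 2)).
  have -> : (A + B * Y) * (A - B - B * Y) = wnorm 1 c A B - B ^+ 2 * (Y ^+ 2 + Y - c).
    by rewrite /wnorm; ring.
  by rewrite eN eY ['X^(_.+1)]exprS; ring.
have r0 : (A - B - B * Y)`_0 = - B`_0.
  by rewrite !coefB coefM big_ord1 /= A0 Y0 mulr0 subr0 sub0r.
have cop : coprimep 'X^n (A - B - B * Y).
  rewrite coprimep_sym coprimep_expr // -[X in coprimep _ X]subr0 -polyC0 coprimep_XsubC.
  by rewrite /root horner_coef0 r0 oppr_eq0.
have : 'X^n %| (A + B * Y) by rewrite -(Gauss_dvdpl _ cop) e mulNr dvdpNr dvdp_mulr.
move=> /dvdpP[H eH]; exists H => //.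
have Xn0 : ('X^n : {poly k}) != 0 by rewrite monic_neq0 ?monicXn.
have {}e : H * (A - B - B * Y) = - 1 - 'X * (E * B ^+ 2).
  by apply: (mulIf Xn0); rewrite mulrAC -eH e; ring.
have := congr1 (fun p : {poly k} => p`_0) e.
rewrite coefM big_ord1 r0 coefB coefXM /= subr0 coefN coef1 eqxx mulrN.
by move=> /oppr_inj.
Qed.

Section CharTwoRigidity.
Variables (k : fieldType) (c : {poly k}) (n : nat).
Hypothesis two0 : 2 = 0 :> k.

Let two0p : 2 = 0 :> {poly k}.
Proof. by rewrite -polyC_natr two0. Qed.
Let oppp (p : {poly k}) : - p = p.
Proof. by apply/eqP; rewrite -subr_eq0 -opprD -mulr2n -mulr_natl two0p mul0r oppr0. Qed.

(** Since the norm of X B' + B y is a power of X, a common factor of B and B'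
    divides that power. *)
Lemma char2_coprime (B : {poly k}) :
  wnorm 1 c ('X * B^`()) B = - 'X^n -> B`_0 != 0 -> coprimep B B^`().
Proof.
move=> eN B0.
have copX : coprimep B 'X^n.
  apply: coprimep_expr; rewrite -[X in coprimep _ X]subr0 -polyC0 coprimep_XsubC.
  by rewrite /root horner_coef0.
have : coprimep B (('X * B^`()) ^+ 2).
  have -> : ('X * B^`()) ^+ 2 = ('X * B^`() + c * B) * B + 'X^n.
    by rewrite -[in RHS](oppp 'X^n) -eN /wnorm; ring.
  by rewrite coprimep_addl_mul.
by rewrite coprimep_pexpr // coprimepMr => /andP[].
Qed.

(** B divides H B', hence H. *)
Lemma char2_no_deformation (B H : {poly k}) : coprimep B B^`() ->
  (size H < size B)%N -> (H * B)^`() = 0 -> H = 0.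
Proof.
move=> cop sH; rewrite derivM => /eqP; rewrite addr_eq0 => /eqP e.
apply/eqP; apply/negPn/negP => H0.
have : B %| H by rewrite -(Gauss_dvdpl _ cop) -dvdpNr -e dvdp_mull.
by move/dvdp_leq => /(_ H0); rewrite leqNgt sH.
Qed.

(** As both A1 + B1 y and A2 + B2 y vanish to order n at (0, 0), so does
    A2 B1 - A1 B2 = X (B1 B2)', whose degree is less than n. *)
Lemma char2_unique (B1 B2 Y E : {poly k}) :
  wnorm 1 c ('X * B1^`()) B1 = - 'X^n -> wnorm 1 c ('X * B2^`()) B2 = - 'X^n ->
  B1`_0 != 0 -> B2`_0 != 0 -> B1 \is monic -> B2 \is monic -> size B1 = size B2 ->
  (2 * size B1 <= n.+1)%N -> Y`_0 = 0 -> Y ^+ 2 + Y = c + 'X^(n.+1) * E -> B1 = B2.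
Proof.
move=> N1 N2 B10 B20 m1 m2 s12 sn Y0 eY.
have A0 (B : {poly k}) : ('X * B^`())`_0 = 0 by rewrite coefXM.
have [H1 e1 _] := norm_zero N1 (A0 _) B10 Y0 eY.
have [H2 e2 _] := norm_zero N2 (A0 _) B20 Y0 eY.
have eW : 'X * (B1 * B2)^`() = (H2 * B1 - H1 * B2) * 'X^n.
  rewrite mulrBl -![_ * _ * 'X^n]mulrAC -e1 -e2 derivM.
  by rewrite -[in LHS](oppp (B1^`() * B2)); ring.
have b1 : B1 != 0 by rewrite monic_neq0.
have d0 : (B1 * B2)^`() = 0.
  apply/eqP/negPn/negP => d0.
  have W0 : H2 * B1 - H1 * B2 != 0.
    by apply/eqP => W0; move/eqP: eW; rewrite W0 mul0r mulf_eq0 polyX_eq0 (negPf d0).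
  have := congr1 (fun p : {poly k} => size p) eW.
  rewrite mulrC size_mulX // size_mulXn // => es.
  have b12 : B1 * B2 != 0 by rewrite mulf_neq0 // monic_neq0.
  have := lt_size_deriv b12; rewrite size_mul ?monic_neq0 // -s12.
  have : (0 < size (H2 * B1 - H1 * B2)%R)%N by rewrite size_poly_gt0.
  by move: es sn; size_lia.
have cop := char2_coprime N1 B10.
have h : ((B2 - B1) * B1)^`() = 0.
  rewrite mulrBl derivB [B2 * B1]mulrC d0 sub0r derivM.
  by rewrite [B1 * _]mulrC -mulr2n -mulr_natl two0p mul0r oppr0.
apply/esym/eqP; rewrite -subr_eq0; apply/eqP; apply: char2_no_deformation cop _ h.
have s0 : (0 < size B1)%N by rewrite size_poly_gt0.
rewrite -(prednK s0) ltnS; apply/leq_sizeP => j hj; rewrite coefB.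
have [->|nj] := eqVneq j (size B1).-1; last first.
  by rewrite !nth_default ?subr0 // -?s12; move: hj nj; size_lia.
by move: m1 m2; rewrite !monicE /lead_coef -s12 => /eqP-> /eqP->; rewrite subrr.
Qed.
End CharTwoRigidity.

(** * The differential equation in characteristic 0 *)

Section Cubic.
Variables (k : comNzRingType) (a2 a4 : k).

Let size_tail : (size (a2%:P * 'X^2 + a4%:P * 'X : {poly k})%R < 4)%N.
Proof.
rewrite (leq_ltn_trans (size_polyD _ _)) // gtn_max !mul_polyC.
by rewrite !(leq_ltn_trans (size_scale_leq _ _)) // ?size_polyXn ?size_polyX.
Qed.
Lemma size_ncub : size (ncub a2 a4) = 4%N.
Proof. by rewrite /ncub -addrA size_polyDl size_polyXn. Qed.
Lemma lead_coef_ncub : lead_coef (ncub a2 a4) = 1.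
Proof. by rewrite /ncub -addrA lead_coefDl ?lead_coefXn // size_polyXn. Qed.
End Cubic.

Section CharZero.
Variables (L : numFieldType) (a2 a3 a4 : L) (n : nat) (A B : {poly L}).
Hypotheses (on : odd n) (ode : lame_ode a2 a3 a4 n A B).
Local Notation c := (ncub a2 a4).
Local Notation N := (wnorm a3%:P c A B).

Lemma odd_sub_neq0 (i : nat) : i%:R * 2 - n%:R != 0 :> L.
Proof.
rewrite subr_eq0 -natrM eqr_nat; apply/eqP => e.
by move: on; rewrite -e muln2 odd_double.
Qed.

Let n0 : n%:R != 0 :> L.
Proof. by rewrite pnatr_eq0; case: (n) on. Qed.

Lemma ode_A i : A`_i = i%:R * a3 * B`_i / (i%:R * 2 - n%:R).
Proof. by rewrite -(ode_coef ode) mulrC mulKf // odd_sub_neq0. Qed.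

Lemma ode_size : (size A <= size B)%N.
Proof.
by apply/leq_sizeP => j hj; rewrite ode_A [B`_j]nth_default // mulr0 mul0r.
Qed.

Lemma ode_B_neq0 : (A, B) != 0 -> B != 0.
Proof.
apply: contra => /eqP B0; have := ode_size; rewrite B0 size_poly0 leqn0 size_poly_eq0.
by move=> /eqP->.
Qed.

(** By X N' = n N the norm is a monomial of degree n. *)
Lemma ode_norm_coef i : i != n -> N`_i = 0.
Proof.
move=> ni; have := congr1 (fun p : {poly L} => p`_i) (ode_norm ode).
rewrite -polyC_natr coefCM coefXM; case: i ni => [|i] ni /=.
  by move=> /esym/eqP; rewrite mulf_eq0 (negPf n0) => /eqP.
rewrite coef_deriv -[_ *+ i.+1]mulr_natl => /eqP; rewrite -subr_eq0 -mulrBl mulf_eq0 subr_eq0.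
by rewrite eqr_nat (negPf ni) => /eqP.
Qed.

Lemma ode_norm_monomial : N = N`_n *: 'X^n.
Proof.
apply/polyP => i; rewrite coefZ coefXn; have [->|ni] := eqVneq i n; first by rewrite mulr1.
by rewrite ode_norm_coef // mulr0.
Qed.

Hypothesis B0 : B != 0.

(** c B^2 is the only term of top degree in the norm A^2 - a3 A B - c B^2. *)
Lemma ode_degree : n = (2 * size B).+1 /\ N = - (lead_coef B ^+ 2) *: 'X^n.
Proof.
have s0 : (0 < size B)%N by rewrite size_poly_gt0.
have sc := size_ncub a2 a4; have lc := lead_coef_ncub a2 a4.
have sl : (size (a3%:P : {poly L}) <= 1)%N by exact: size_polyC_leq1.
have sB2 := size_cB2 (leqW sl) sc B0; have sA := ode_size.
have sT : (size (A ^+ 2 - a3%:P * A * B)%R < size (- (c * B ^+ 2))%R)%N.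
  rewrite size_polyN sB2 (leq_ltn_trans (psizeB _ _)) // gtn_max.
  have := psizeM A A; have := psizeM (a3%:P * A) B; have := psizeM (a3%:P) A.
  by rewrite -expr2; move: sA sl s0; size_lia.
have eN : size N = (2 * size B + 2)%N.
  by rewrite /wnorm addrC size_polyDl // size_polyN.
have lN : lead_coef N = - lead_coef B ^+ 2.
  by rewrite /wnorm addrC lead_coefDl // lead_coefN lead_coefM lc mul1r expr2 lead_coefM expr2.
have N0 : N`_n != 0.
  apply/eqP => h; move: eN; rewrite ode_norm_monomial h scale0r size_poly0; lia.
move: (eN) (lN); rewrite ode_norm_monomial size_scale // size_polyXn lead_coefZ lead_coefXn mulr1.
by move=> e1 ->; split=> //; lia.
Qed.

Hypothesis a30 : a3 != 0.

(** Both polynomials cannot vanish at 0: the orders of vanishing there are the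
    roots of the indicial equation, that is 0 and n, and n exceeds the degree. *)
Lemma ode_B0 : B`_0 != 0.
Proof.
apply/negP => /eqP B00.
have dX (p : {poly L}) : p`_0 = 0 -> exists q, p = q * 'X.
  by move=> p0; exists (p %/ 'X); rewrite divpK // -['X]subr0 -polyC0 dvdp_XsubCl /root horner_coef0 p0.
have step j : (0 < j <= n)%N -> exists A1 B1, A = A1 * 'X^j /\ B = B1 * 'X^j.
  elim: j => // j IH /andP[_ jn]; case: (posnP j) => [->|j0].
    have [A1 eA] := dX A (ode_A0 ode n0); have [B1 eB] := dX B B00.
    by exists A1, B1.
  have [A1 [B1 [eA eB]]] := IH (introT andP (conj j0 (ltnW jn))).
  have Xj0 : ('X^j : {poly L}) != 0 by rewrite monic_neq0 ?monicXn.
  have dXj (p : {poly L}) : 'X * (p * 'X^j)^`() = (j%:R * p + 'X * p^`()) * 'X^j.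
    rewrite derivM derivXn; case: (j) j0 => // i _ /=.
    by rewrite -['X^i *+ _]mulr_natl ['X^(_.+1)]exprS; ring.
  have [e1 e2] := ode.
  have {}e1 : 2 * (j%:R * A1 + 'X * A1^`()) - a3%:P * (j%:R * B1 + 'X * B1^`()) = n%:R * A1.
    apply: (mulIf Xj0); rewrite mulrBl -!mulrA -!dXj -eA -eB -e1; ring.
  have {}e2 : a3%:P * (j%:R * A1 + 'X * A1^`()) + 2 * c * (j%:R * B1 + 'X * B1^`())
      + 'X * c^`() * B1 = n%:R * (a3%:P * A1 + c * B1).
    apply: (mulIf Xj0).
    have -> : (n%:R * (a3%:P * A1 + c * B1)) * 'X^j = n%:R * (a3%:P * A + c * B).
      by rewrite eA eB; ring.
    rewrite -e2 2!mulrDl -!mulrA -!dXj -eA -eB mulrDr; ring.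
  have c00 : c.[0] = 0 by rewrite /ncub !hornerE expr0n /= !mulr0 !addr0.
  move: c00 e2; generalize (ncub a2 a4) => cc c00 e2.
  move/(congr1 (fun p : {poly L} => p.[0])): e1; move/(congr1 (fun p : {poly L} => p.[0])): e2.
  rewrite -!polyC_natr !(hornerD, hornerN, hornerM, hornerC, hornerX) c00.
  rewrite !mulr0 !mul0r !addr0 => e2 e1.
  have a0 : A1.[0] = 0.
    apply/eqP; have : (j%:R - n%:R) * (a3 * A1.[0]) == 0.
      by rewrite mulrBl subr_eq0 -e2; apply/eqP; ring.
    by rewrite mulf_eq0 subr_eq0 eqr_nat ltn_eqF //= mulf_eq0 (negPf a30).
  have b0 : B1.[0] = 0.
    apply/eqP; move: e1; rewrite a0 !mulr0 sub0r => /eqP.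
    by rewrite oppr_eq0 !mulf_eq0 (negPf a30) pnatr_eq0 -[j == 0%N]negbK -lt0n j0.
  have [A2 eA2] := dX A1 (etrans (esym (horner_coef0 _)) a0).
  have [B2 eB2] := dX B1 (etrans (esym (horner_coef0 _)) b0).
  by exists A2, B2; rewrite exprS !mulrA -eA2 -eB2.
have [|A1 [B1 [_ eB]]] := step n; first by rewrite leqnn andbT; case: (n) on.
have B10 : B1 != 0 by apply: contraNneq B0 => B10; rewrite eB B10 mul0r.
have [en _] := ode_degree; have := congr1 (fun p : {poly L} => size p) eB.
rewrite size_mulXn // => es; have : (0 < size B1)%N by rewrite size_poly_gt0.
by move: en es; size_lia.
Qed.
End CharZero.

(** * Reduction and rigidity *)

Lemma map_ncub (R S : comNzRingType) (f : {rmorphism R -> S}) a2 a4 :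
  map_poly f (ncub a2 a4) = ncub (f a2) (f a4).
Proof. by rewrite /ncub !rmorphD /= ![map_poly f (_%:P * _)]rmorphM /= !map_polyC !map_polyXn map_polyX. Qed.

Lemma map_lame_ode (R S : comNzRingType) (f : {rmorphism R -> S}) a2 a3 a4 n A B :
  lame_ode a2 a3 a4 n A B ->
  lame_ode (f a2) (f a3) (f a4) n (map_poly f A) (map_poly f B).
Proof.
rewrite /lame_ode -map_ncub; move: (ncub _ _) => c [e1 e2].
move: (congr1 (map_poly f) e1) (congr1 (map_poly f) e2).
rewrite !(rmorph_nat, rmorphM, rmorphB, rmorphD) /= !map_polyC map_polyX -!deriv_map.
by split.
Qed.

Lemma map_wnorm (R S : comNzRingType) (f : {rmorphism R -> S}) (l c A B : {poly R}) :
  map_poly f (wnorm l c A B) = wnorm (map_poly f l) (map_poly f c) (map_poly f A) (map_poly f B).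
Proof. by rewrite /wnorm !rmorphB /= !rmorphM !expr2. Qed.

Lemma lame_ode_scale (R : comNzRingType) (a2 a3 a4 e : R) n A B :
  lame_ode a2 a3 a4 n A B -> lame_ode a2 a3 a4 n (e *: A) (e *: B).
Proof.
move=> [e1 e2]; rewrite /lame_ode !derivZ -!mul_polyC; split.
  have -> : n%:R * (e%:P * A) = e%:P * (n%:R * A) by ring.
  by rewrite -e1; ring.
have -> : n%:R * (a3%:P * (e%:P * A) + ncub a2 a4 * (e%:P * B))
  = e%:P * (n%:R * (a3%:P * A + ncub a2 a4 * B)) by ring.
by rewrite -e2; ring.
Qed.

(** The solution of y^2 + y = c in power series, to any finite precision. *)
Lemma y_series (R : comNzRingType) (c : {poly R}) n :
  exists Z E, ('X * Z) ^+ 2 + 'X * Z = 'X * c + 'X^(n.+1) * E.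
Proof.
elim: n => [|n [Z [E e]]]; first by exists 0, (- c); ring.
exists (Z - 'X^n * E), (E * ('X^n * E - 2 * Z)).
have -> : ('X * (Z - 'X^n * E)) ^+ 2 + 'X * (Z - 'X^n * E) = (('X * Z) ^+ 2 + 'X * Z)
  - 'X * 'X^n * E + ('X * 'X^n * E) ^+ 2 - 2 * ('X * Z) * ('X * 'X^n * E) by ring.
by rewrite e !['X^(_.+1)]exprS; ring.
Qed.

Section Reduction.
Variables (L : numFieldType) (R : comNzRingType) (F : fieldType).
Variables (v : {rmorphism R -> L}) (rho : {rmorphism R -> F}).
(* R is a valuation ring of L, and rho is the reduction to its residue field *)
Hypotheses (v_inj : injective v) (rho_unit : forall a, rho a != 0 -> exists b, b * a = 1)
  (v_total : forall x, (exists a, v a = x) \/ (exists2 a, v a = x^-1 & rho a = 0))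
  (two0 : 2 = 0 :> F).
Local Notation V x := (exists a, v a = x).

Let vp_inj : injective (map_poly v).
Proof. by apply: map_inj_poly; [exact: v_inj | rewrite rmorph0]. Qed.

Lemma vring_lift_poly (p : {poly L}) : (forall i, V p`_i) -> exists P, map_poly v P = p.
Proof.
move=> Vp; have [f hf] := choice Vp.
exists (\poly_(i < size p) f i); apply/polyP => i.
rewrite coef_map coef_poly; case: ltnP => [_|hi]; first exact: hf.
by rewrite raddf0 nth_default.
Qed.

(** The coefficients of A are those of B multiplied by i a3 / (2 i - n). *)
Lemma odd_vring_unit n : odd n -> exists w : nat -> R,
  forall i, w i * (i%:R * 2 - n%:R) = 1 /\ rho (w i) = 1.
Proof.
move=> on; suff h (i : nat) : exists w : R, w * (i%:R * 2 - n%:R) = 1 /\ rho w = 1.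
  by have [w] := choice h; exists w.
have N1 : -1 = 1 :> F.
  by apply/eqP; rewrite -subr_eq0 -opprD -mulr2n -[_ *+ 2]mulr_natl mulr1 two0 oppr0.
have r1 : rho (i%:R * 2 - n%:R) = 1.
  rewrite rmorphB rmorphM !rmorph_nat two0 mulr0 sub0r.
  by rewrite -[n]odd_double_half on natrD -muln2 natrM two0 mulr0 addr0.
have [|w ew] := @rho_unit (i%:R * 2 - n%:R); first by rewrite r1 oner_neq0.
by exists w; split=> //; rewrite -[LHS]mulr1 -r1 -rmorphM ew rmorph1.
Qed.

(** An element of maximal absolute value. *)
Lemma vr_max (s : seq L) : has (fun x => x != 0) s ->
  exists2 x, x \in s & x != 0 /\ forall y, y \in s -> V (y / x).
Proof.
have V0 : V 0 by exists 0; rewrite rmorph0.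
have Vself x : x != 0 -> V (x / x) by move=> x0; rewrite divff //; exists 1; rewrite rmorph1.
elim: s => // y s IH /=; have [/IH[x xs [x0 hx]] _|/hasPn ns] := boolP (has _ s).
  have [Vy|[b eb _]] := v_total (y / x).
    exists x; first by rewrite inE xs orbT.
    by split=> // z; rewrite inE => /orP[/eqP->|/hx].
  rewrite invf_div in eb; have [y0|y0] := eqVneq y 0.
    exists x; first by rewrite inE xs orbT.
    by split=> // z; rewrite inE => /orP[/eqP->|/hx //]; rewrite y0 mul0r.
  exists y; first by rewrite inE eqxx.
  split=> // z; rewrite inE => /orP[/eqP->|/hx[a ea]]; first exact: Vself.
  by exists (a * b); rewrite rmorphM ea eb mulrA divfK.
rewrite orbF => y0; exists y; first by rewrite inE eqxx.
split=> // z; rewrite inE => /orP[/eqP->|zs]; first exact: Vself.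
by move: (ns z zs); rewrite negbK => /eqP->; rewrite mul0r.
Qed.

Section Solution.
Variables (a2 a3 a4 : R) (n : nat) (A B : {poly L}).
Hypotheses (on : odd n) (ode : lame_ode (v a2) (v a3) (v a4) n A B) (B0 : B != 0).

(** Divide by a coefficient of B of maximal absolute value. *)
Lemma integral_solution : exists A0 B0 : {poly R},
  [/\ lame_ode a2 a3 a4 n A0 B0, map_poly rho B0 != 0, n = (2 * size B0).+1 &
      wnorm a3%:P (ncub a2 a4) A0 B0 = - lead_coef B0 ^+ 2 *: 'X^n].
Proof.
have lB : lead_coef B \in (B : seq L) by rewrite mem_nth // prednK // size_poly_gt0.
have [|e eB [e0 he]] := @vr_max B; first by apply/hasP; exists (lead_coef B); rewrite ?lead_coef_eq0.
have VB i : V (e^-1 *: B)`_i.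
  rewrite coefZ mulrC; have [hi|hi] := ltnP i (size B); first by apply: he; rewrite mem_nth.
  by rewrite nth_default // mul0r; exists 0; rewrite rmorph0.
have ode1 := lame_ode_scale e^-1 ode; move: VB ode1.
have : e^-1 *: B != 0 by rewrite scaler_eq0 invr_eq0 (negPf e0).
have : exists i, (e^-1 *: B)`_i = 1.
  by exists (index e B); rewrite coefZ nth_index // mulVf.
move: (e^-1 *: A) (e^-1 *: B) => A1 B1 [i Bi] B10 VB ode1.
have [B2 eB2] := vring_lift_poly VB; have [w hw] := odd_vring_unit on.
have VA j : V A1`_j.
  have [/(congr1 v) + _] := hw j; rewrite rmorphM rmorphB rmorphM !rmorph_nat rmorph1 => wj.
  have -> : A1`_j = v (w j) * (j%:R * v a3 * B1`_j).
    by rewrite -(ode_coef ode1) mulrA wj mul1r.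
  by rewrite -eB2 coef_map -(rmorph_nat v) -!rmorphM; eexists.
have [A2 eA2] := vring_lift_poly VA.
have ode2 : lame_ode a2 a3 a4 n A2 B2.
  move: ode1; rewrite -eA2 -eB2 /lame_ode -map_ncub !deriv_map -!map_polyC -!(rmorph_nat (map_poly v)).
  rewrite -['X](map_polyX v) -!rmorphM -!rmorphD -!rmorphB -!rmorphM.
  by move=> [/vp_inj e1 /vp_inj e2]; split.
have sB : size B1 = size B2 by rewrite -eB2 size_map_inj_poly ?rmorph0.
have [en eN] := ode_degree on ode1 B10.
exists A2, B2; split=> //; last 2 first.
- by rewrite -sB.
- apply: vp_inj; rewrite map_wnorm map_ncub map_polyC eA2 eB2 [LHS]eN.
  by rewrite map_polyZ map_polyXn rmorphN rmorphXn -eB2 lead_coef_map_inj ?rmorph0.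
apply/eqP => r0; have := congr1 (fun p : {poly F} => p`_i) r0.
rewrite coef_map coef0 /= => /eqP; rewrite (_ : B2`_i = 1) ?rmorph1 ?oner_eq0 //.
by apply: v_inj; rewrite -coef_map eB2 Bi rmorph1.
Qed.

Lemma lame_reduction : rho a2 = 0 /\ (rho a3 = 0 -> rho a4 = 0).
Proof.
have [A1 [B1 [ode1 rB0 en eN]]] := integral_solution.
apply: (ode_char2 two0 on (map_lame_ode rho ode1) rB0 (C := rho (- lead_coef B1 ^+ 2))).
by rewrite -map_polyC -map_ncub -map_wnorm eN map_polyZ map_polyXn.
Qed.
End Solution.

(** The leading coefficient of an integral solution with nonzero reduction is a
    unit, since the norm of the reduction is not 0. The value at 0 of B is a unit
    too: its inverse is the value of the integral power series
    (A + B y) / X^n. *)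
Lemma monic_solution (a2 a4 : R) (n : nat) (A B : {poly L}) : odd n ->
  lame_ode (v a2) (v 1) (v a4) n A B -> B != 0 -> exists A1 B1 : {poly R},
  [/\ lame_ode a2 1 a4 n A1 B1, B1 \is monic, n = (2 * size B1).+1,
      wnorm 1 (ncub a2 a4) A1 B1 = - 'X^n & rho B1`_0 != 0].
Proof.
move=> on ode B0; have [A0 [B1 [ode0 rB0 en eN]]] := integral_solution on ode B0.
have [|u ul] := @rho_unit (lead_coef B1).
  apply/eqP => rl; have := congr1 (map_poly rho) eN.
  rewrite map_wnorm map_ncub map_polyZ rmorphN rmorphXn /= rl expr0n /= oppr0 scale0r.
  move/wnorm_eq0 => []; rewrite ?map_polyC ?(leq_trans (size_polyC_leq1 _)) //.
    exact: size_ncub.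
  by move=> _ rB; rewrite rB eqxx in rB0.
have u0 : u != 0 by apply/eqP => u0; move/eqP: ul; rewrite u0 mul0r eq_sym oner_eq0.
have su : size (u *: B1) = size B1.
  apply/eqP; rewrite eqn_leq size_scale_leq /=.
  by rewrite -{1}[B1]scale1r -ul mulrC -scalerA size_scale_leq.
have mB : u *: B1 \is monic by rewrite monicE /lead_coef su coefZ ul.
have ode1 := lame_ode_scale u ode0.
have eN1 : wnorm 1 (ncub a2 a4) (u *: A0) (u *: B1) = - 'X^n.
  have -> : wnorm 1 (ncub a2 a4) (u *: A0) (u *: B1) = (u ^+ 2) *: wnorm 1 (ncub a2 a4) A0 B1.
    by rewrite /wnorm -!mul_polyC rmorphXn /=; ring.
  by rewrite eN scalerA mulrN -exprMn ul expr1n scaleN1r.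
exists (u *: A0), (u *: B1); split=> //; first by rewrite su.
have [Z [E eY]] := y_series ('X^2 + a2%:P * 'X + a4%:P) n.
have ec : 'X * ('X^2 + a2%:P * 'X + a4%:P) = ncub a2 a4 by rewrite /ncub; ring.
rewrite ec in eY.
have := congr1 (map_poly v) eN1; rewrite map_wnorm rmorph1 rmorphN /= map_polyXn => eN2.
have odeL := map_lame_ode v ode1.
have n0 : n%:R != 0 :> L by rewrite pnatr_eq0; case: (n) on.
have v10 : v 1 != 0 by rewrite rmorph1 oner_neq0.
have B20 : map_poly v (u *: B1) != 0 by rewrite monic_neq0 ?monic_map.
have eYv : (map_poly v ('X * Z)) ^+ 2 + map_poly v ('X * Z)
    = ncub (v a2) (v a4) + 'X^(n.+1) * map_poly v E.
  by rewrite -map_ncub -(map_polyXn v) -!rmorphM -rmorphXn -!rmorphD eY.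
rewrite map_ncub in eN2.
have A00 := ode_A0 odeL n0; have B00 := ode_B0 on odeL B20 v10.
have [|H eH H0] := norm_zero eN2 A00 B00 _ eYv; first by rewrite coef_map coefXM raddf0.
move: (u *: A0) (u *: B1) eH H0 {su mB ode1 eN1 eN2 odeL B20 A00 B00} => A1 B2 eH H0.
have eH0 : H`_0 = v (A1 + B2 * ('X * Z))`_n.
  have := congr1 (fun p : {poly L} => p`_n) eH.
  rewrite coefMXn ltnn subnn => <-.
  by rewrite -coef_map rmorphD /= [map_poly v (B2 * _)]rmorphM /=.
move: H0; rewrite eH0 coef_map -rmorphM -(rmorph1 v) => /v_inj h.
apply/eqP => h0; have := congr1 rho h; rewrite rmorphM h0 mulr0 rmorph1 => /eqP.
by rewrite eq_sym oner_eq0.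
Qed.

Lemma map_ode_A (a2 a4 : R) n (A B : {poly R}) : odd n -> lame_ode a2 1 a4 n A B ->
  map_poly rho A = 'X * (map_poly rho B)^`().
Proof.
move=> on /(map_lame_ode rho) ode; have := ode_char2_A two0 on ode.
by rewrite rmorph1 mul1r.
Qed.

(** The deformation argument. Two solutions that agree modulo the maximal ideal
    differ by e (G, H, D), where e has maximal absolute value among the
    coefficients of the difference, so that H or D has nonzero reduction. Dividing
    the difference of the two norm equations by e and reducing leaves
    X (H B)' = B^2 D; here D vanishes for reasons of degree, and then H too. *)
Lemma deformation (a2 a4 b2 b4 : R) (n : nat) (A1 B1 A2 B2 : {poly R}) : odd n ->
  lame_ode a2 1 a4 n A1 B1 -> lame_ode b2 1 b4 n A2 B2 ->
  wnorm 1 (ncub a2 a4) A1 B1 = - 'X^n -> wnorm 1 (ncub b2 b4) A2 B2 = - 'X^n ->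
  B1 \is monic -> B2 \is monic -> size B1 = size B2 -> rho B2`_0 != 0 ->
  rho a2 = rho b2 -> rho a4 = rho b4 -> map_poly rho B1 = map_poly rho B2 ->
  a2 = b2 /\ a4 = b4.
Proof.
move=> on ode1 ode2 N1 N2 m1 m2 s12 r0 r2 r4 rB.
pose s : seq R := [:: a2 - b2, a4 - b4 & (B1 - B2 : {poly R})].
have [|] := boolP (has (fun x => x != 0) [seq v x | x <- s]); last first.
  rewrite has_map /= !negb_or !negbK => /and3P[/eqP e2 /eqP e4 _].
  split; apply: v_inj; apply/eqP; rewrite -subr_eq0 -rmorphB.
    by apply/eqP.
  by apply/eqP.
move=> /vr_max[_ /mapP[e es ->] [e0 he]].
have rs x : x \in s -> rho x = 0.
  rewrite !inE => /or3P[/eqP->|/eqP->|/(nthP 0)[i _ <-]]; rewrite ?coefB rmorphB ?r2 ?r4 ?subrr //.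
  by have := congr1 (fun p : {poly F} => p`_i) rB; rewrite !coef_map => ->; rewrite subrr.
have hs x : x \in s -> exists y, x = e * y.
  move=> xs; have [|y ey] := he (v x); first by apply/mapP; exists x.
  by exists y; apply: v_inj; rewrite rmorphM ey mulrC divfK.
have re := rs e es.
have eI (p q : {poly R}) : e%:P * p = e%:P * q -> p = q.
  move=> /(congr1 (map_poly v)); rewrite !rmorphM /= map_polyC => h.
  by apply/vp_inj/(mulfI _ h); rewrite polyC_eq0.
have [d2 e2] : exists d2, a2 - b2 = e * d2 by apply: hs; rewrite inE eqxx.
have [d4 e4] : exists d4, a4 - b4 = e * d4 by apply: hs; rewrite !inE eqxx orbT.
have [h hh] : exists h : nat -> R, forall i, (B1 - B2)`_i = e * h i.
  suff hex (i : nat) : exists y, (B1 - B2)`_i = e * y by have [h] := choice hex; exists h.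
  have [hi|hi] := ltnP i (size (B1 - B2)).
    by apply: hs; rewrite !inE; apply/orP; right; apply/orP; right; apply: mem_nth.
  by exists 0; rewrite nth_default ?mulr0.
have [w hw] := odd_vring_unit on.
pose H := \poly_(i < size (B1 - B2)) h i.
pose G := \poly_(i < size (B1 - B2)) (w i * i%:R * h i).
have eB : B1 = B2 + e%:P * H.
  apply/polyP => i; rewrite coefD coefCM coef_poly; case: ltnP => hi.
    by rewrite -hh coefB; ring.
  by apply/eqP; rewrite mulr0 addr0 -subr_eq0 -coefB nth_default.
have Aw a c A B i : lame_ode a 1 c n A B -> A`_i = w i * i%:R * B`_i.
  by move=> /ode_coef => /(_ i); rewrite mulr1 => e1; rewrite -mulrA -e1 mulrA (hw i).1 mul1r.
have eA : A1 = A2 + e%:P * G.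
  apply/polyP => i; rewrite coefD coefCM (Aw _ _ _ _ _ ode1) (Aw _ _ _ _ _ ode2).
  have -> : B1`_i = B2`_i + e * H`_i by rewrite {1}eB coefD coefCM.
  by rewrite !coef_poly; case: ltnP => hi; ring.
pose D := d2%:P * 'X^2 + d4%:P * 'X.
have ec : ncub a2 a4 = ncub b2 b4 + e%:P * D.
  rewrite /ncub /D -(subrK b2 a2) -(subrK b4 a4) e2 e4 !polyCD !polyCM; ring.
have eq0 : A2 * H + G * B2 + B2 * B2 * D = e%:P * (G ^+ 2 - G * H - H ^+ 2 * ncub a2 a4)
    + 2 * (A2 * G - B2 * H * ncub a2 a4).
  apply: eI; apply/eqP; rewrite -subr_eq0; apply/eqP.
  by rewrite -[RHS](subrr (- 'X^n)) -{1}N2 -N1 /wnorm eA eB ec; ring.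
set Hb := map_poly rho H; set Bb := map_poly rho B2.
have eG : map_poly rho G = 'X * Hb^`().
  apply/polyP => i; rewrite coefXM coef_map coef_poly; case: i => [|i] /=.
    by rewrite mulr0n mulr0 mul0r if_same rmorph0.
  rewrite coef_deriv coef_map !coef_poly; case: ltnP => _; last by rewrite !raddf0 mul0rn.
  by rewrite !rmorphM (hw _).2 mul1r rmorph_nat mulr_natl.
have eD : map_poly rho D = 'X * ((rho d2)%:P * 'X + (rho d4)%:P).
  have -> : D = 'X * (d2%:P * 'X + d4%:P) by rewrite /D; ring.
  by rewrite rmorphM rmorphD rmorphM /= !map_polyC map_polyX.
have two0p : 2 = 0 :> {poly F} by rewrite -polyC_natr two0.
have eHB : (Hb * Bb)^`() = - (Bb * Bb * ((rho d2)%:P * 'X + (rho d4)%:P)).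
  have X0 : 'X != 0 :> {poly F} by rewrite polyX_eq0.
  apply: (mulfI X0); apply/eqP; rewrite -subr_eq0; apply/eqP.
  have := congr1 (map_poly rho) eq0.
  have hD (p q : {poly R}) : map_poly rho (p + q) = map_poly rho p + map_poly rho q by exact: rmorphD.
  have hM (p q : {poly R}) : map_poly rho (p * q) = map_poly rho p * map_poly rho q by exact: rmorphM.
  have er : map_poly rho e%:P = 0 by rewrite map_polyC /= re polyC0.
  have er2 : map_poly rho 2 = 0 by rewrite rmorph_nat.
  rewrite !hD !hM er er2 !mul0r addr0 (map_ode_A on ode2) eG eD.
  rewrite -/Hb -/Bb => <-; rewrite derivM; ring.
have b1 : Bb \is monic by exact: monic_map.
have bn0 : Bb != 0 by exact: monic_neq0.
have sBb : size Bb = size B1 by rewrite s12 size_map_poly_id0 // (eqP m2) rmorph1 oner_neq0.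
have sE : (size (B1 - B2)%R < size B1)%N.
  have s0 : (0 < size B1)%N by rewrite size_poly_gt0 monic_neq0.
  rewrite -(prednK s0) ltnS; apply/leq_sizeP => j hj; rewrite coefB.
  have [->|nj] := eqVneq j (size B1).-1; last first.
    by rewrite !nth_default ?subr0 // -?s12 -(prednK s0) ltn_neqAle eq_sym nj.
  by move: m1 m2; rewrite !monicE /lead_coef -s12 => /eqP-> /eqP->; rewrite subrr.
have sH : (size Hb < size Bb)%N.
  by rewrite sBb (leq_ltn_trans _ sE) // (leq_trans (size_poly _ _)) // size_poly.
have D0 : (rho d2)%:P * 'X + (rho d4)%:P = 0.
  apply/eqP/negPn/negP => D0.
  have HB0 : Hb * Bb != 0.
    apply/eqP => h0; move/eqP: eHB; rewrite h0 deriv0 eq_sym oppr_eq0.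
    by rewrite !mulf_eq0 (negPf bn0) (negPf D0).
  have := lt_size_deriv HB0; rewrite eHB size_polyN !size_mul ?mulf_neq0 //; last first.
    by apply: contraNneq HB0 => ->; rewrite mul0r.
  have : (0 < size ((rho d2)%:P * 'X + (rho d4)%:P)%R)%N by rewrite size_poly_gt0.
  move: (size _) (size Bb) (size Hb) sH => x y z; clear; lia.
have cop : coprimep Bb Bb^`().
  apply: (@char2_coprime _ (ncub (rho b2) (rho b4)) n two0); last by rewrite coef_map.
  rewrite -(map_ode_A on ode2) -(rmorph1 (map_poly rho)) -map_ncub -map_wnorm N2.
  by rewrite rmorphN /= map_polyXn.
have Hb0 : Hb = 0.
  by apply: char2_no_deformation cop sH _; rewrite eHB D0 mulr0 oppr0.
have d20 : rho d2 = 0.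
  have := congr1 (fun p : {poly F} => p`_1) D0.
  by rewrite coefD coefCM coefX coefC mulr1 addr0 => ->; rewrite coef0.
have d40 : rho d4 = 0.
  have := congr1 (fun p : {poly F} => p`_0) D0.
  by rewrite coefD coefCM coefX coefC mulr0 add0r => ->; rewrite coef0.
have e1 y : e = e * y -> rho y = 1.
  move=> ey; rewrite -(rmorph1 rho); congr (rho _); apply/v_inj/(mulfI e0).
  by rewrite rmorph1 mulr1 {2}ey rmorphM.
have : rho 1 = 0.
  rewrite rmorph1; move: es; rewrite !inE => /or3P[/eqP es|/eqP es|/(nthP 0)[i hi es]].
  - by rewrite -d20; apply/esym/e1; rewrite -e2.
  - by rewrite -d40; apply/esym/e1; rewrite -e4.
  have := congr1 (fun p : {poly F} => p`_i) Hb0; rewrite coef_map coef_poly hi coef0 => <-.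
  by apply/esym/e1; rewrite -hh.
by rewrite rmorph1 => /eqP; rewrite oner_eq0.
Qed.

(** The two curves have the same reduction, as a2 and b2 vanish modulo the place.
    There the solutions agree by [char2_unique], so that [deformation] applies. *)
Lemma lame_rigid (a2 a4 b2 b4 : R) (n : nat) (A B A' B' : {poly L}) : odd n ->
  lame_ode (v a2) 1 (v a4) n A B -> (A, B) != 0 ->
  lame_ode (v b2) 1 (v b4) n A' B' -> (A', B') != 0 ->
  rho a4 = rho b4 -> a2 = b2 /\ a4 = b4.
Proof.
rewrite -(rmorph1 v) => on ode AB0 ode' AB0' r4.
have B0 := ode_B_neq0 on ode AB0; have B0' := ode_B_neq0 on ode' AB0'.
have [ra _] := lame_reduction on ode B0; have [rb _] := lame_reduction on ode' B0'.
have [A1 [B1 [ode1 m1 n1 N1 z1]]] := monic_solution on ode B0.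
have [A2 [B2 [ode2 m2 n2 N2 z2]]] := monic_solution on ode' B0'.
have s12 : size B1 = size B2 by move: n2; rewrite n1; clear; size_lia.
apply: (deformation on ode1 ode2 N1 N2 m1 m2 s12 z2 _ r4); first by rewrite ra rb.
have [Z [E eY]] := y_series ('X^2 + a2%:P * 'X + a4%:P) n.
have ec : 'X * ('X^2 + a2%:P * 'X + a4%:P) = ncub a2 a4 by rewrite /ncub; ring.
rewrite ec in eY.
have eYr : (map_poly rho ('X * Z)) ^+ 2 + map_poly rho ('X * Z)
    = ncub (rho a2) (rho a4) + 'X^(n.+1) * map_poly rho E.
  by rewrite -map_ncub -(map_polyXn rho) -!rmorphM -rmorphXn -!rmorphD eY.
have norm c2 c4 C D : lame_ode c2 1 c4 n C D -> wnorm 1 (ncub c2 c4) C D = - 'X^n ->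
    wnorm 1 (ncub (rho c2) (rho c4)) ('X * (map_poly rho D)^`()) (map_poly rho D) = - 'X^n.
  move=> odeC NC; rewrite -(map_ode_A on odeC) -(rmorph1 (map_poly rho)) -map_ncub -map_wnorm NC.
  by rewrite rmorphN /= map_polyXn.
have sz (D : {poly R}) : D \is monic -> size (map_poly rho D) = size D.
  by move=> mD; rewrite size_map_poly_id0 // (eqP mD) rmorph1 oner_neq0.
have N1' := norm _ _ _ _ ode1 N1; have N2' := norm _ _ _ _ ode2 N2.
rewrite rb -r4 -ra in N2'.
apply: (char2_unique two0 N1' N2' _ _ _ _ _ _ _ eYr); rewrite ?coef_map ?monic_map ?sz //.
  by rewrite n1; exact: leqW (leqnSn _).
by rewrite coefXM raddf0.
Qed.

(** Potential good reduction: after normalising the largest of 1, r2, r4 to be a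
    unit, the reduction lemma leaves 1 as the only candidate. *)
Lemma lame_integral (r2 r4 : L) (n : nat) : odd n ->
  (forall u, u != 0 -> exists A B,
     (A, B) != 0 /\ lame_ode ((u * r2) ^+ 2) (u ^+ 3) ((u * r4) ^+ 4) n A B) ->
  V r2 /\ V r4.
Proof.
move=> on ode; have [|e es [e0 he]] := @vr_max [:: 1; r2; r4]; first by rewrite /= oner_neq0.
have u0 : e^-1 != 0 by rewrite invr_eq0.
have [|t et] := he 1; first by rewrite !inE eqxx.
have [|t2 e2] := he r2; first by rewrite !inE eqxx orbT.
have [|t4 e4] := he r4; first by rewrite !inE eqxx !orbT.
rewrite div1r in et; have [A [B [AB0]]] := ode _ u0.
rewrite ![e^-1 * _]mulrC -e2 -e4 -et -!rmorphXn => odeu.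
have [h2 h4] := lame_reduction on odeu (ode_B_neq0 on odeu AB0).
have X0 k (x : R) : rho (x ^+ k.+1) = 0 -> rho x = 0.
  by rewrite rmorphXn => /eqP; rewrite expf_eq0 => /eqP.
have rt : rho t != 0.
  apply/eqP => rt0; have t40 : rho t4 = 0 by apply/(X0 3%N)/h4; rewrite rmorphXn rt0 expr0n.
  have e1 x : v x = 1 -> rho x = 0 -> False.
    rewrite -(rmorph1 v) => /v_inj ->; rewrite rmorph1 => /eqP; by rewrite oner_eq0.
  move: es; rewrite !inE => /or3P[/eqP ee|/eqP ee|/eqP ee].
  - by apply: (e1 t) => //; rewrite et ee invr1.
  - by apply: (e1 t2); [rewrite e2 ee divff // -ee | exact: X0 h2].
  - by apply: (e1 t4); [rewrite e4 ee divff // -ee | ].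
have [b eb] := rho_unit rt.
have be : v b = e by apply: (mulIf u0); rewrite -et -rmorphM eb rmorph1 et divff.
by split; [exists (t2 * b); rewrite rmorphM e2 | exists (t4 * b); rewrite rmorphM e4]; rewrite be divfK.
Qed.
End Reduction.

(** * Residue fields of number fields *)

Section ResidueOfNumberField.
Variable K : fieldExtType rat.
Local Notation int_cl := (@is_integer K).

(** Multiplying the equation of degree n by l^(n-1) makes it monic in l x. *)
Lemma lead_coef_mul_integral (q : {poly K}) x : (forall i, q`_i \in int_cl) ->
  q.[x] = 0 -> (1 < size q)%N -> lead_coef q * x \in int_cl.
Proof.
move=> hq qx sq; set l := lead_coef q.
have hX y n : y \in int_cl -> y ^+ n \in int_cl by move=> hy; exact: rpredX.
have e : size q = (size q).-2.+2 by move: sq; case: (size q) => [|[|s]].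
set n := (size q).-2 in e.
pose t := \poly_(i < n.+1) (q`_i * l ^+ (n - i)).
have st : (size t < size ('X^(n.+1) : {poly K}))%N by rewrite size_polyXn ltnS size_poly.
have mr : 'X^(n.+1) + t \is monic by rewrite monicE lead_coefDl // lead_coefXn.
apply/asboolP; apply: (integral_root_monic mr).
  rewrite /root !hornerE horner_poly; apply/eqP.
  have -> : \sum_(i < n.+1) q`_i * l ^+ (n - i) * (l * x) ^+ i
      = l ^+ n * \sum_(i < n.+1) q`_i * x ^+ i.
    rewrite mulr_sumr; apply: eq_bigr => i _; rewrite exprMn.
    have -> : l ^+ n = l ^+ (n - i) * l ^+ i by rewrite -exprD subnK // -ltnS.
    by ring.
  have := qx; rewrite horner_coef e big_ord_recr /=.
  have -> : q`_n.+1 = l by rewrite /l /lead_coef e.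
  move=> /(congr1 (fun z => l ^+ n * z)); rewrite mulr0 mulrDr => h; rewrite -[RHS]h.
  by rewrite exprMn [l ^+ n.+1]exprS; ring.
apply/integral_poly => i; suff : ('X^(n.+1) + t)`_i \in int_cl by move/asboolP.
rewrite coefD coefXn coef_poly.
apply: rpredD; first by rewrite rpred_nat.
case: ifP => _; last exact: rpred0.
by apply: rpredM; [exact: hq | apply: hX; exact: hq].
Qed.

Variables (L F : fieldType) (R : comNzRingType).
Variables (v : {rmorphism R -> L}) (rho : {rmorphism R -> F}) (iota : {rmorphism K -> L}).
Hypotheses (v_inj : injective v) (two0 : 2 = 0 :> F).
Hypothesis int_V : forall y, y \in int_cl -> exists r, v r = iota y.

(** The elements of K that reduce to 0, respectively to a nonzero residue. *)
Definition in_max y := exists2 r, v r = iota y & rho r = 0.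
Definition off_max y := exists2 r, v r = iota y & rho r != 0.

Lemma off_maxD y z : off_max y -> in_max z -> off_max (y + z).
Proof.
move=> [r er r0] [s es s0]; exists (r + s); first by rewrite !rmorphD er es.
by rewrite rmorphD s0 addr0.
Qed.
Lemma off_max_neq0 y : off_max y -> y != 0.
Proof.
move=> [r er r0]; apply: contraNneq r0 => y0.
suff -> : r = 0 by rewrite rmorph0.
by apply: v_inj; rewrite er y0 !rmorph0.
Qed.
Lemma off_max_odd (z : int) : ~~ (2 %| z)%Z -> off_max z%:~R.
Proof.
move=> oz; exists z%:~R; first by rewrite !rmorph_int.
rewrite rmorph_int; apply: contraNneq oz => z0.
have := divz_eq z 2; have := modz_ge0 z (isT : 2 != 0 :> int); have := ltz_pmod z (isT : 0 < 2 :> int).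
case: (z %% 2)%Z => [[|[|//]]|//] _ _ e.
  by rewrite e addr0 dvdz_mull.
move: z0; rewrite e rmorphD rmorphM /= -[2%:~R]/(2 : F) two0 mulr0 add0r => /eqP.
by rewrite oner_eq0.
Qed.

(** An integral element of the valuation ring is a quotient of algebraic integers
    with denominator prime to the place: if the leading coefficient l of an
    integral equation is in the maximal ideal, the two top terms are merged into
    one, whose coefficient changes by the algebraic integer l x only. *)
Lemma unit_denominator (q : {poly K}) x : (exists r, v r = iota x) ->
  (forall i, q`_i \in int_cl) -> q.[x] = 0 -> (exists i, off_max q`_i) ->
  exists c, [/\ c \in int_cl, c * x \in int_cl & off_max c].
Proof.
move=> [s es]; move: {2}(size q) (leqnn (size q)) => N.
elim: N q => [|N IH] q sq hq qx [i ui].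
  by move/off_max_neq0: ui; rewrite nth_default ?eqxx // (leq_trans sq).
have [s1|s1] := leqP (size q) 1.
  move/off_max_neq0: ui; rewrite (size1_polyC s1) coefC in qx *.
  by move: qx; rewrite hornerC => ->; rewrite if_same eqxx.
have hl := lead_coef_mul_integral hq qx s1; set l := lead_coef q in hl.
have el : q`_(size q).-1 = l by [].
have [ul|nl] := pselect (off_max l).
  by exists l; split=> //; exact: hq.
have ml : in_max (l * x).
  have [r er] := int_V (hq (size q).-1); rewrite el in er.
  exists (r * s); first by rewrite !rmorphM er es.
  rewrite rmorphM; have [->|r0] := eqVneq (rho r) 0; first by rewrite mul0r.
  by case: nl; exists r.
have e : size q = (size q).-2.+2 by move: s1; case: (size q) => [|[|j]].
set n := (size q).-2 in e; have qn : q`_n.+1 = l by rewrite /l /lead_coef e.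
pose q' := \poly_(j < n.+1) q`_j + (l * x) *: 'X^n.
have cq' j : q'`_j = (if (j < n.+1)%N then q`_j else 0) + (if j == n then l * x else 0).
  rewrite coefD coef_poly coefZ coefXn; case: (j == n); by rewrite ?mulr1 ?mulr0.
apply: (IH q').
- have : (size q' <= n.+1)%N.
    apply/leq_sizeP => j hj; rewrite cq' ltnNge hj /= add0r.
    by case: eqP hj => // ->; rewrite ltnn.
  by move/leq_trans; apply; rewrite -ltnS (leq_trans _ sq) // e.
- by move=> j; rewrite cq'; apply: rpredD; case: ifP => _; [exact: hq|exact: rpred0|exact: hl|exact: rpred0].
- rewrite hornerD horner_poly hornerZ hornerXn -[RHS]qx horner_coef e [RHS]big_ord_recr /=.
  by rewrite qn [x ^+ n.+1]exprS mulrA.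
exists i; have hi : (i < n.+1)%N.
  rewrite ltnNge; apply/negP; rewrite leq_eqVlt => /orP[/eqP ei|hi].
    by apply: nl; rewrite -qn ei.
  by move/off_max_neq0: ui; rewrite nth_default ?eqxx // e.
rewrite cq' hi; case: eqP => _; last by rewrite addr0.
exact: off_maxD.
Qed.

(** The primitive multiple of the minimal polynomial. *)
Lemma odd_equation (x : K) : exists q : {poly int},
  (map_poly intr q).[x] = 0 /\ exists i, ~~ (2 %| q`_i)%Z.
Proof.
have /polyOver1P[p ep] := minPolyOver 1%AS x.
have p0 : p != 0.
  by apply/eqP => p0; have := monic_neq0 (monic_minPoly 1%AS x); rewrite ep p0 rmorph0 eqxx.
have [q [a a0 eq]] := rat_poly_scale p.
have q0 : q != 0 by apply: contraNneq p0 => q0; rewrite eq q0 rmorph0 scaler0.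
have qx : (map_poly intr q : {poly K}).[x] = 0.
  have := minPolyxx 1%AS x; rewrite ep eq map_polyZ hornerZ => /eqP.
  rewrite mulf_eq0 fmorph_eq0 invr_eq0 intr_eq0 (negPf a0) /= -map_poly_comp => /eqP <-.
  by congr (_.[x]); apply: eq_map_poly => z /=; rewrite -in_algE rmorph_int.
exists (zprimitive q); split.
  move: qx; rewrite {1}[q]zpolyEprim map_polyZ hornerZ /= => /eqP.
  by rewrite mulf_eq0 -(rmorph_int (in_alg K)) fmorph_eq0 intr_eq0 zcontents_eq0 (negPf q0) => /eqP.
apply: contrapT => h; have : (2 %| zcontents (zprimitive q))%Z.
  rewrite dvdz_contents; apply/polyOverP => i; apply/negPn/negP => hi; apply: h.
  by exists i; apply: contra hi.
by rewrite zcontents_primitive q0.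
Qed.

Variable p : prime_idealr (integers K).
Hypotheses (p_max : forall a : integers K, a \in p -> in_max (integer_val a)).
Variables (k2 : fieldType) (phi : {rmorphism {ideal_quot p} -> k2}).
Hypothesis phi_bij : bijective phi.

Definition int_proj : {rmorphism integers K -> {ideal_quot p}} := \pi_({ideal_quot p})%qT.
Definition residue (a : integers K) : k2 := phi (int_proj a).

Lemma residue_eq a b : (residue a == residue b) = (a - b \in p).
Proof. by rewrite (inj_eq (bij_inj phi_bij)) Quotient.idealrBE. Qed.

(** The valuation ring cut out on K has the same residue field as p: a denominator
    off the maximal ideal is inverted modulo p. *)
Lemma residue_approx x : (exists r, v r = iota x) ->
  exists a : integers K, in_max (x - integer_val a).
Proof.
move=> Vx; have [q [qx [i hi]]] := odd_equation x.
have [||c [hc hcx uc]] := unit_denominator Vx _ qx.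
- by move=> j; rewrite coef_map; exact: rpred_int.
- by exists i; rewrite coef_map; exact: off_max_odd.
pose c0 := Integers hc; have [phi' phiK phi'K] := phi_bij.
have c0p : residue c0 != 0.
  rewrite -(rmorph0 phi) -(rmorph0 int_proj) [_ == _]residue_eq subr0; apply/negP => /p_max[r /= er r0].
  have [s es] := uc; rewrite -er in es; by rewrite (v_inj es) r0 eqxx.
have [d ed] : exists d, residue d = (residue c0)^-1.
  have [d ed] : exists d, int_proj d = phi' (residue c0)^-1.
    by exists (repr (phi' (residue c0)^-1)); exact: reprK.
  by exists d; rewrite /residue ed phi'K.
have cd : 1 - c0 * d \in p.
  rewrite -residue_eq /residue !rmorph1 rmorphM rmorphM -/(residue c0) -/(residue d) ed.
  by rewrite divff // eqxx.
exists (Integers hcx * d); rewrite /=.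
have [s es] := Vx; have [t et t0] := p_max cd.
exists (s * t); last by rewrite rmorphM t0 mulr0.
by rewrite rmorphM es et -rmorphM; congr (iota _); rewrite /=; ring.
Qed.

Lemma residue_inj x y a b : in_max (x - integer_val a) -> in_max (y - integer_val b) ->
  residue a = residue b -> in_max (x - y).
Proof.
move=> [r er r0] [s es s0] /eqP; rewrite residue_eq => /p_max[t et t0].
exists (r - s + t); last by rewrite rmorphD rmorphB r0 s0 t0 subrr addr0.
by rewrite rmorphD rmorphB er es et -rmorphB -rmorphD; congr (iota _); rewrite /=; ring.
Qed.
End ResidueOfNumberField.

Lemma card_ext_F2 (k2 : fieldExtType 'F_2) : exists g : k2 -> 'I_(2 ^ \dim {: k2}), injective g.
Proof.
have c : #|{: 'rV['F_2]_(dim k2)}| = (2 ^ \dim {: k2})%N by rewrite card_mx card_Fp // mul1n dimvf.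
exists (fun x : k2 => cast_ord c (enum_rank (VectorInternalTheory.v2r x : 'rV['F_2]_(dim k2)))).
by move=> x y /cast_ord_inj/enum_rank_inj/VectorInternalTheory.v2r_inj.
Qed.

(** * Counting *)

Lemma pointed_curve_eq (k : fieldType) (C D : pointed_curve k) :
  weq C = weq D -> val (pc_point C) = val (pc_point D) -> C = D.
Proof.
case: C D => [[W d] P] [[W' d'] P'] /= e; move: e d' P' => <- d' P' eP.
move: P P' eP; rewrite (eq_irrelevance d d') => P P' eP.
by congr (PointedCurve _); apply: val_inj.
Qed.

Section Place.
Variables (K : fieldExtType rat) (iota : {rmorphism K -> algC}).
Variables (R : comNzRingType) (F : fieldType).
Variables (v : {rmorphism R -> algC}) (rho : {rmorphism R -> F}).
Hypotheses (v_inj : injective v) (rho_unit : forall a, rho a != 0 -> exists b, b * a = 1)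
  (v_total : forall x, (exists a, v a = x) \/ (exists2 a, v a = x^-1 & rho a = 0))
  (two0 : 2 = 0 :> F).

(** The normal forms of C with a3 = 1, for the three choices of u, are integral
    and carry solutions for all multiples of n. *)
Definition unit_forms C (c2 c3 c4 : K) (n : nat) := forall u : algC, u ^+ 3 * iota c3 = 1 ->
  exists (N : pointed_curve algC) (b2 b4 : R),
  [/\ v b2 = u ^+ 2 * iota c2 /\ v b4 = u ^+ 4 * iota c4, isomorphic C N,
      weq N = Weierstrass 0 (v b2) 1 (v b4) 0,
      val (pc_point N) = Some (v b4 ^+ 2 - v b2, - (v b4 * (v b4 ^+ 2 - v b2)) - 1) &
      forall r, exists A B, (A, B) != 0 /\ lame_ode (v b2) 1 (v b4) (r * n)%N A B].

Lemma lame_unit_forms C : odd_lame_signature1 C -> defined_over iota C ->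
  exists (n : nat) (c2 c3 c4 : K), [/\ odd n, c3 != 0 & unit_forms C c2 c3 c4 n].
Proof.
move=> hC dC; have [n [c2 [c3 [c4 [on c30 hu]]]]] := lame_normal_form hC dC.
exists n, c2, c3, c4; split=> // u eu.
have u0 : u != 0 by apply/eqP => u0; move/eqP: eu; rewrite u0 expr0n mul0r eq_sym oner_eq0.
pose r2 := sqrtC (u ^+ 2 * iota c2); pose r4 := 4.-root (u ^+ 4 * iota c4).
have e2 : r2 ^+ 2 = u ^+ 2 * iota c2 by exact: sqrtCK.
have e4 : r4 ^+ 4 = u ^+ 4 * iota c4 by exact: rootCK.
have [|[s2 es2] [s4 es4]] := lame_integral v_inj rho_unit v_total two0 (r2 := r2) (r4 := r4) on.
  move=> t t0; have [|N] := hu (t * u); first by rewrite mulf_neq0.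
  have -> : (t * u) ^+ 3 * iota c3 = t ^+ 3 by rewrite exprMn -mulrA eu mulr1.
  have -> : (t * u) ^+ 2 * iota c2 = (t * r2) ^+ 2 by rewrite !exprMn e2 [RHS]mulrA.
  have -> : (t * u) ^+ 4 * iota c4 = (t * r4) ^+ 4 by rewrite !exprMn e4 [RHS]mulrA.
  by move=> [eN _ _ /(_ 1%N)]; rewrite mul1n eN.
have [N [eN iN [la [ela hP]] ode]] := hu u u0.
rewrite eu -e2 -e4 in eN.
have h2 : a2 (weq N) = r2 ^+ 2 by rewrite eN.
have h3 : a3 (weq N) = 1 by rewrite eN.
have h4 : a4 (weq N) = r4 ^+ 4 by rewrite eN.
rewrite h3 h4 mul1r in ela; rewrite h2 h3 -ela in hP.
exists N, (s2 ^+ 2), (s4 ^+ 4); rewrite !rmorphXn es2 es4 e2 e4; split=> //.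
- by rewrite eN e2 e4.
- by rewrite hP e2 e4.
by move=> r; have := ode r; rewrite h2 h3 h4 e2 e4.
Qed.

Lemma unit_form_cube (c c' : K) u (b : R) : u ^+ 3 * iota c = 1 -> v b = u ^+ 4 * iota c' ->
  v (b ^+ 3) = iota (c' ^+ 3 / c ^+ 4).
Proof.
move=> eu eb; have c0 : iota c != 0.
  by apply/eqP => c0; move/eqP: eu; rewrite c0 mulr0 eq_sym oner_eq0.
rewrite rmorphXn eb fmorph_div !rmorphXn; apply: (canRL (mulfK (expf_neq0 4 c0))).
have -> : (u ^+ 4 * iota c') ^+ 3 * iota c ^+ 4 = (u ^+ 3 * iota c) ^+ 4 * iota c' ^+ 3 by ring.
by rewrite eu expr1n mul1r.
Qed.

Lemma cube_root_of_unity : exists w : R, w ^+ 2 + w + 1 = 0.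
Proof.
have [z pz] := C_prim_root_exists (isT : (0 < 3)%N).
have z3 : z ^+ 3 = 1 by exact: prim_expr_order.
have z1 : z != 1 by rewrite -[z]expr1 -(prim_order_dvd pz).
have ez : z ^+ 2 + z + 1 = 0.
  apply: (mulIf (_ : z - 1 != 0)); first by rewrite subr_eq0.
  have -> : (z ^+ 2 + z + 1) * (z - 1) = z ^+ 3 - 1 by ring.
  by rewrite z3 subrr mul0r.
have [w ew] : exists w, v w = z.
  have [//|[b eb _]] := v_total z; exists (b ^+ 2).
  have z0 : z != 0 by apply/eqP => z0; move/eqP: z3; rewrite z0 expr0n eq_sym oner_eq0.
  rewrite rmorphXn eb; apply: (mulIf (expf_neq0 2 z0)).
  by rewrite -exprMn mulVf // expr1n -exprS z3.
by exists w; apply: v_inj; rewrite !rmorphD rmorphXn rmorph1 rmorph0 ew.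
Qed.

(** Congruent values of a4^3 = c4^3 / c3^4 give values of a4 that are congruent up
    to a cube root of unity, which a change of u absorbs. By rigidity, applied to
    solutions of the common order n n', the two normal forms then coincide. *)
Lemma forms_isomorphic C C' (c2 c3 c4 c2' c3' c4' : K) n n' :
  odd n -> odd n' -> c3 != 0 -> c3' != 0 ->
  unit_forms C c2 c3 c4 n -> unit_forms C' c2' c3' c4' n' ->
  in_max v rho iota (c4 ^+ 3 / c3 ^+ 4 - c4' ^+ 3 / c3' ^+ 4) -> isomorphic C C'.
Proof.
move=> on on' c30 c30' hC hC' [r er r0].
have root3 (c : K) : c != 0 -> exists u : algC, u ^+ 3 * iota c = 1.
  by move=> c0; exists (3.-root (iota c)^-1); rewrite rootCK // mulVf // fmorph_eq0.
have [u eu] := root3 _ c30; have [u' eu'] := root3 _ c30'.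
have [N [b2 [b4 [[eb2 eb4] iN eN hP ode]]]] := hC u eu.
have [_ [_ [b4' [[_ eb4'] _ _ _ _]]]] := hC' u' eu'.
have [w ew] := cube_root_of_unity.
have w3 : w ^+ 3 = 1.
  have -> : w ^+ 3 = (w - 1) * (w ^+ 2 + w + 1) + 1 by ring.
  by rewrite ew mulr0 add0r.
have [k hk] : exists k, rho b4 = rho (w ^+ k * b4').
  have h : rho b4 ^+ 3 - rho b4' ^+ 3 = 0.
    have -> : rho b4 ^+ 3 - rho b4' ^+ 3 = rho (b4 ^+ 3 - b4' ^+ 3) by rewrite rmorphB !rmorphXn.
    by rewrite -r0; congr (rho _); apply: v_inj; rewrite er !rmorphB (unit_form_cube eu eb4) (unit_form_cube eu' eb4').
  have ewr : rho w ^+ 2 + rho w + 1 = 0 by rewrite -(rmorph0 rho) -ew !rmorphD rmorphXn rmorph1.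
  have : (rho b4 - rho b4') * (rho b4 - rho w * rho b4') * (rho b4 - rho w ^+ 2 * rho b4') = 0.
    move: (rho b4) (rho b4') (rho w) h ewr => x y t h ewr.
    have -> : (x - y) * (x - t * y) * (x - t ^+ 2 * y) = x ^+ 3 - y ^+ 3
      + (t ^+ 2 + t + 1) * ((x - y) * ((t - 1) * y ^+ 2 - x * y)) by ring.
    by rewrite h ewr mul0r addr0.
  move/eqP; rewrite !mulf_eq0 !subr_eq0 => /orP[/orP[]|] /eqP ->.
  - by exists 0%N; rewrite expr0 mul1r.
  - by exists 1%N; rewrite expr1 rmorphM.
  - by exists 2%N; rewrite rmorphM rmorphXn.
have [|N' [d2 [d4 [[ed2 ed4] iN' eN' hP' ode']]]] := hC' (v w ^+ k * u').
  by rewrite exprMn -exprM mulnC exprM -rmorphXn w3 rmorph1 expr1n mul1r.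
have e4 : d4 = w ^+ k * b4'.
  have vw4 : v w ^+ 4 = v w by rewrite exprS -rmorphXn w3 rmorph1 mulr1.
  have vwk : (v w ^+ k) ^+ 4 = v w ^+ k by rewrite -exprM mulnC exprM vw4.
  by apply: v_inj; rewrite ed4 rmorphM eb4' rmorphXn exprMn vwk [RHS]mulrA.
have onn : odd (n' * n)%N by rewrite oddM on on'.
have [A [B [AB0 odeN]]] := ode n'; have [A' [B' [AB0' odeN']]] := ode' n.
rewrite mulnC in odeN'.
have [h2 h4] := lame_rigid v_inj rho_unit v_total two0 onn odeN AB0 odeN' AB0' (etrans hk (congr1 rho (esym e4))).
have NN : N = N' by apply: pointed_curve_eq; rewrite ?eN ?eN' ?hP ?hP' h2 h4.
by apply: isomorphic_trans iN _; rewrite NN; exact: isomorphic_sym.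
Qed.
End Place.

(** Obtained from a valuation ring that dominates the image of the integers of K
    and that of p. *)
Lemma place_above (K : fieldExtType rat) (iota : {rmorphism K -> algC})
    (p : prime_idealr (integers K)) : 2 \in p ->
  exists (R : comNzRingType) (F : fieldType) (v : {rmorphism R -> algC}) (rho : {rmorphism R -> F}),
  [/\ injective v, forall a, rho a != 0 -> exists b, b * a = 1,
      forall x, (exists a, v a = x) \/ (exists2 a, v a = x^-1 & rho a = 0), 2 = 0 :> F &
      (forall y, y \in @is_integer K -> exists r, v r = iota y) /\
      (forall a : integers K, a \in p -> in_max v rho iota (integer_val a))].
Proof.
move=> p2.
pose A0 : set algC := [set x | exists a : integers K, x = iota (integer_val a)]%classic.
pose I0 : set algC := [set x | exists a : integers K, a \in p /\ x = iota (integer_val a)]%classic.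
have [V [m [hV AV Im]]] : exists V m, [/\ valuation_ring V m, A0 `<=` V & I0 `<=` m]%classic.
  apply: dominating_valuation_ring.
  - by exists 1; rewrite /= rmorph1.
  - by move=> x y [a ->] [b ->]; exists (a - b); rewrite /= rmorphB.
  - by move=> x y [a ->] [b ->]; exists (a * b); rewrite /= rmorphM.
  - by exists 0; rewrite rpred0 /= rmorph0.
  - by move=> x y [a [pa ->]] [b [pb ->]]; exists (a + b); rewrite rpredD //= rmorphD.
  - by move=> x y [a ->] [b [pb ->]]; exists (a * b); rewrite idealMr //= rmorphM.
  - by move=> x [a [_ ->]]; exists a.
  - move=> [a [pa e1]]; have : (1 : integers K) \in p.
      suff -> : 1 = a by [].
      by apply/val_inj/(fmorph_inj iota); rewrite /= -e1 rmorph1.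
    by rewrite idealr1.
have [F [rho hrho]] := residue_field hV.
pose v : {rmorphism vring hV -> algC} := val.
have lift x : V x -> exists a, v a = x.
  by move=> /(vring_predP hV) Vx; exists (VRing Vx).
exists (vring hV), F, v, rho; split.
- exact: val_inj.
- move=> a ra; have nm : ~ m (v a) by move=> ma; move/eqP: ra; apply; apply/hrho.
  have [b eb] := lift _ (vr_inv hV (vring_valP a) nm).
  exists b; apply: val_inj; rewrite [val (b * a)](rmorphM v) eb [val 1](rmorph1 v) mulVf //.
  by apply/eqP => va0; apply: nm; have -> : v a = 0 by []; exact: (vrm0 hV).
- move=> x; have [/lift|mx] := vr_total hV x; [by left | right].
  by have [a ea] := lift _ (vrmV hV mx); exists a => //; apply/hrho; rewrite -ea in mx.
- rewrite -(rmorph_nat rho); apply/hrho; apply: Im; exists 2; split=> //.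
  by rewrite -[vring_val _]/(v 2%:R) rmorph_nat -(rmorph_nat iota).
split=> [y hy|a pa].
  by apply/lift/AV; exists (Integers hy).
have ma : m (iota (integer_val a)) by apply: Im; exists a.
by have [r er] := lift _ (vrmV hV ma); exists r => //; apply/hrho; rewrite -er in ma.
Qed.

Local Open Scope classical_set_scope.
Local Open Scope card_scope.

Theorem mainTheorem6 (K : fieldExtType rat) (iota : {rmorphism K -> algC})
    (d : nat) (hd : max_residue_degree2 K d) :
  [set iso_class C | C in
     [set C : pointed_curve algC
       | odd_lame_signature1 C /\ defined_over iota C]]
  #<= `I_(2 ^ d).
Proof.
have [p [p2 [k2 [phi [phi_bij dk2]]]]] := hd.1; rewrite -dk2.
have [R [F [v [rho [v_inj rho_unit v_total two0 [int_V p_max]]]]]] := place_above iota p2.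
have [g g_inj] := card_ext_F2 k2.
(* the code of a class is the residue of c4^3 / c3^4 *)
pose code (X : set (pointed_curve algC)) (i : nat) := exists C n (c2 c3 c4 : K) (a : integers K),
  [/\ X = iso_class C, odd n /\ c3 != 0, unit_forms iota v C c2 c3 c4 n,
      in_max v rho iota (c4 ^+ 3 / c3 ^+ 4 - integer_val a) & i = g (residue phi a)].
have code_ex X : exists i, [set iso_class C | C in
     [set C : pointed_curve algC | odd_lame_signature1 C /\ defined_over iota C]] X -> code X i.
  have [[C [hC dC] <-]|nX] := pselect ([set iso_class C | C in
     [set C : pointed_curve algC | odd_lame_signature1 C /\ defined_over iota C]] X); last by exists 0%N.
  have [n [c2 [c3 [c4 [on c30 uf]]]]] := lame_unit_forms v_inj rho_unit v_total two0 hC dC.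
  have Vt : exists r, v r = iota (c4 ^+ 3 / c3 ^+ 4).
    have [u eu] : exists u : algC, u ^+ 3 * iota c3 = 1.
      by exists (3.-root (iota c3)^-1); rewrite rootCK // mulVf // fmorph_eq0.
    have [_ [_ [b4 [[_ eb4] _ _ _ _]]]] := uf u eu.
    by exists (b4 ^+ 3); exact: unit_form_cube eu eb4.
  have [a ha] := residue_approx v_inj two0 int_V p_max phi_bij Vt.
  by exists (g (residue phi a)) => _; exists C, n, c2, c3, c4, a.
have [f hf] := choice code_ex.
rewrite -(card_le_eql (inj_card_eq (f := f) _)); last first.
  move=> X Y /set_mem/hf[C [n [c2 [c3 [c4 [a [-> [on c30] uC ha ->]]]]]]].
  move=> /set_mem/hf[D [n' [d2 [d3 [d4 [b [-> [on' d30] uD hb ->]]]]]]].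
  move=> /val_inj/g_inj eab; apply: iso_class_eq.
  exact: (forms_isomorphic v_inj rho_unit v_total two0 on on' c30 d30 uC uD
    (residue_inj p_max phi_bij ha hb eab)).
apply: subset_card_le => _ [X hX <-].
by have [C [n [c2 [c3 [c4 [a [_ _ _ _ ->]]]]]]] := hf _ hX => /=.
Qed.
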